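(* Let $d\ge3$, $T>0$, and let $(u,f),(v,f)\in\mathcal N(Q_T)$ have the same force $f$ and the same initial data $u(0)=v(0)=u_0$. If in addition $u\in L^p(0,T;L^q(\mathbb T^d))$ with $\frac2p+\frac dq=1$, and $v$ is continuous in $L^2$ at $t=0$, then $u=v$.
   Context: $\mathbb T^d$ is the $d$-dimensional ($2\pi$-periodic) torus, $Q_T=\mathbb T^d\times(0,T)$, $\langle\cdot,\cdot\rangle$ is the $L^2(\mathbb T^d)$ inner product. The forced Navier-Stokes equations (NSE) are $\partial_t u-\Delta u+\operatorname{div}(u\otimes u)+\nabla p=f$, $\operatorname{div}u=0$, with velocity $u$, pressure $p$, force $f$. $\mathcal L(0,T)$ is the set of $g\in L^1_{loc}(0,T)$ such that $\lim_{a\to0^+,\,b\to T^-}\int_a^b g\,dt$ exists (as a finite limit). Class $\mathcal N(Q_T)$ (smooth solutions with finite energy input): pairs $(u,f)$ such that (i) $u\in C^\infty(Q_T)\cap L^\infty(0,T;L^2(\mathbb T^d))$ and $f\in C^\infty(Q_T)$; (ii) $u,f$ satisfy the NSE (with some pressure $p$) at every point of $Q_T$; (iii) $\langle u,f\rangle\in\mathcal L(0,T)$; (iv) the limits of $f(t)$ exist in $\mathcal D'(\mathbb T^d)$ as $t\to0^+$ and $t\to T^-$. For $(u,f)\in\mathcal N(Q_T)$ the weak $L^2$ limits of $u(t)$ as $t\to0^+$ and $t\to T^-$ exist, and $u(0)$, $u(T)$ always denote these weak limits. Continuity of $v$ in $L^2$ at $t=0$ means $\|v(t)-v(0)\|_{L^2}\to0$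 as $t\to0^+$.
   Formalization: The exponent p is required to be finite: the endpoint p = ∞, q = d of 2/p + d/q = 1 is excluded, since for d = 3 self-similar forced non-unique solutions in L^∞(0,T;L^3), continuous in L^2 at t = 0, contradict uniqueness there. *)

(* Defs.v *)
From HB Require Import structures.
From mathcomp Require Import all_boot all_order all_algebra.
From mathcomp Require Import all_classical all_reals all_analysis.

Set Implicit Arguments.
Unset Strict Implicit.
Unset Printing Implicit Defensive.

Import Order.TTheory GRing.Theory Num.Theory.
Import numFieldNormedType.Exports.

Local Open Scope classical_set_scope.
Local Open Scope ring_scope.

(** Functions on the torus are 2pi-periodic functions on ['rV[R]_d]; they are
    integrated over the cell [0, 2pi]^d.  The library has a product sigma-algebra
    on tuples but none on ['rV[R]_d], so the d-dimensional Lebesgue measure of the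
    cell is built on [d.-tuple R] by iterating the binary product. *)
Section TorusMeasure.
Context {R : realType}.

Let cell : set (measurableTypeR R) := `[0, 2 * pi]%classic.

Let measurable_cell : measurable cell.
Proof. exact: measurable_itv. Qed.

Let cell_lty : (lebesgue_measure cell < +oo)%E.
Proof. by rewrite /cell lebesgue_measure_itv/=; case: ifP => _; rewrite ltry. Qed.

Definition circle_measure : {finite_measure set (measurableTypeR R) -> \bar R} :=
  mfrestr measurable_cell cell_lty.

Definition cons_pair n (z : measurableTypeR R * n.-tuple (measurableTypeR R)) :
  n.+1.-tuple (measurableTypeR R) := [tuple of z.1 :: z.2].

Lemma measurable_cons_pair n : measurable_fun [set: _] (@cons_pair n).
Proof. exact: measurable_cons. Qed.

Section Step.
Variables (n : nat)
  (mu : {finite_measure set (n.-tuple (measurableTypeR R)) -> \bar R}).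

Let step := pushforward (circle_measure \x mu)%E (@cons_pair n).

Let preimage_cons_pair A : measurable A -> measurable (@cons_pair n @^-1` A).
Proof.
by move=> mA; rewrite -[X in measurable X]setTI; exact: measurable_cons_pair.
Qed.

Let step0 : step set0 = 0%E.
Proof. by rewrite /step /pushforward preimage_set0 measure0. Qed.

Let step_ge0 A : (0 <= step A)%E.
Proof.
by rewrite /step /pushforward; exact: (measure_ge0 (circle_measure \x mu)%E).
Qed.

Let step_sigma_additive : semi_sigma_additive step.
Proof.
move=> F mF tF mUF; rewrite /step /pushforward preimage_bigcup.
apply: measure_semi_sigma_additive.
- by move=> k; exact: preimage_cons_pair.
- apply/trivIsetP => /= i j _ _ ij; rewrite -preimage_setI.
  by move/trivIsetP : tF => /(_ _ _ _ _ ij) ->//; rewrite preimage_set0.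
- by rewrite -preimage_bigcup; exact: preimage_cons_pair.
Qed.

HB.instance Definition _ := isMeasure.Build _ _ _ step
  step0 step_ge0 step_sigma_additive.

Let step_fin : fin_num_fun step.
Proof.
move=> A mA; rewrite ge0_fin_numE//.
apply: (@le_lt_trans _ _ ((circle_measure \x mu)%E setT)).
  by rewrite /step /pushforward; apply: le_measure => //;
    rewrite inE//; exact: preimage_cons_pair.
rewrite -setXTT product_measure1E// lte_mul_pinfty//.
- exact: fin_num_measure.
- by rewrite -ge0_fin_numE//; exact: fin_num_measure.
Qed.

HB.instance Definition _ := Measure_isFinite.Build _ _ _ step step_fin.

Definition torus_step :
  {finite_measure set (n.+1.-tuple (measurableTypeR R)) -> \bar R} := step.

End Step.

Fixpoint torus_measure (n : nat) :
    {finite_measure set (n.-tuple (measurableTypeR R)) -> \bar R} :=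
  match n with
  | 0 => \d_([tuple] : 0.-tuple (measurableTypeR R))
  | n'.+1 => torus_step (torus_measure n')
  end.

End TorusMeasure.

Section Fields.
Context {R : realType} {d : nat}.

Local Notation E := 'rV[R]_d.

Definition pt (x : d.-tuple (measurableTypeR R)) : E := \row_i tnth x i.

Definition basis (i : 'I_d) : E := delta_mx 0 i.

Definition torus_periodic (W : Type) (g : E -> W) : Prop :=
  forall x i, g (x + (2 * pi) *: basis i) = g x.

Definition dot (a b : E) : R := \sum_i a 0 i * b 0 i.

(** Euclidean norm: the library norm on ['rV[R]_d] is the sup norm. *)
Definition enorm (a : E) : R := Num.sqrt (dot a a).

Definition inner (g h : E -> E) : R :=
  \int[torus_measure d]_x dot (g (pt x)) (h (pt x)).

Definition normL (q : \bar R) (g : E -> E) : \bar R :=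
  Lnorm (torus_measure d) q (fun x => (enorm (g (pt x)))%:E).

Definition L2_field (g : E -> E) : Prop :=
  [/\ torus_periodic g,
      forall i, measurable_fun [set: d.-tuple (measurableTypeR R)]
                  (fun x => g (pt x) 0 i) &
      (normL 2%:E g < +oo)%E].

Definition normLL (T : R) (p q : \bar R) (g : R -> E -> E) : \bar R :=
  Lnorm (mrestr lebesgue_measure (measurable_itv `]0, T[)) p
    (fun t => normL q (g t)).

Definition weakL2_cvg (F : set_system R) (g : R -> E -> E) (g0 : E -> E) : Prop :=
  L2_field g0 /\
  forall phi, L2_field phi -> inner (g t) phi @[t --> F] --> inner g0 phi.

Section Smooth.
Context {V W : normedModType R}.

Definition iter_derive (s : seq V) (g : V -> W) : V -> W :=
  foldr (fun v h => 'D_v h) g s.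

(** C^oo on an open set: iterated directional derivatives of every order, in
    all directions, exist and are continuous. *)
Definition smooth_on (D : set V) (g : V -> W) : Prop :=
  forall (s : seq V) (x : V), D x ->
    {for x, continuous (iter_derive s g)} /\
    forall v, derivable (iter_derive s g) x v.

End Smooth.

Definition smooth_QT (T : R) (g : R -> E -> E) : Prop :=
  (forall t, 0 < t < T -> torus_periodic (g t)) /\
  smooth_on [set z : R^o * E | 0 < z.1 < T] (fun z => g z.1 z.2).

Definition test_fun (phi : E -> R) : Prop :=
  torus_periodic phi /\ smooth_on [set: E] (phi : E -> R^o).

(** D'(T^d): linear functionals on the test functions that are bounded by
    finitely many of the seminorms [sup |D^s phi|]. *)
Definition distribution_on_torus (l : (E -> R) -> R) : Prop :=
  (forall (a : R) phi psi, test_fun phi -> test_fun psi ->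
     l (fun x => a * phi x + psi x) = a * l phi + l psi) /\
  exists (k : nat) (C : R), forall phi (M : R), test_fun phi ->
    (forall (s : seq 'I_d) x, (size s <= k)%N ->
       `|iter_derive (map basis s) (phi : E -> R^o) x| <= M) ->
    `|l phi| <= C * M.

Definition has_distr_limit (F : set_system R) (g : R -> E -> E) : Prop :=
  forall i : 'I_d, exists2 l, distribution_on_torus l &
    forall phi, test_fun phi ->
      (\int[torus_measure d]_x (g t (pt x) 0 i * phi (pt x))) @[t --> F]
        --> l phi.

(** The class L(0, T); the two endpoints tend to 0 and T independently. *)
Definition improper_integrable (T : R) (g : R -> R) : Prop :=
  locally_integrable `]0, T[ g /\
  exists l : R, (\int[lebesgue_measure]_(t in `[ab.1, ab.2]) g t)
    @[ab --> filter_prod 0^'+ T^'-] --> l.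

Definition laplacian (g : E -> E) (x : E) : E :=
  \sum_j 'D_(basis j) ('D_(basis j) g) x.

Definition divergence (g : E -> E) (x : E) : R :=
  \sum_j ('D_(basis j) g x) 0 j.

(** div (g (x) g), with i-th component [sum_j d_j (g_j g_i)]. *)
Definition div_tensor (g : E -> E) (x : E) : E :=
  \sum_j 'D_(basis j) (fun y => g y 0 j *: g y) x.

Definition gradient (p : E -> R) (x : E) : E :=
  \row_i 'D_(basis i) (p : E -> R^o) x.

(** No regularity is imposed on the pressure beyond what the equations need at
    each time; it may be shifted by an arbitrary function of time. *)
Definition navier_stokes (T : R) (u f : R -> E -> E) : Prop :=
  exists pr : R -> E -> R, forall t, 0 < t < T ->
    torus_periodic (pr t) /\
    forall x,
      [/\ differentiable (pr t : E -> R^o) x,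
          derive1 (fun s : R => u s x) t - laplacian (u t) x + div_tensor (u t) x
            + gradient (pr t) x = f t x &
          divergence (u t) x = 0].

(** Smooth solutions with finite energy input, N(Q_T). *)
Definition class_N (T : R) (u f : R -> E -> E) : Prop :=
  [/\ smooth_QT T u /\ (normLL T +oo%E 2%:E u < +oo)%E,
      smooth_QT T f,
      navier_stokes T u f,
      improper_integrable T (fun t => inner (u t) (f t)) &
      has_distr_limit 0^'+ f /\ has_distr_limit T^'- f].

Definition L2_continuous_at0 (v : R -> E -> E) (v0 : E -> E) : Prop :=
  normL 2%:E (fun x => v t x - v0 x) @[t --> 0^'+] --> 0%E.

End Fields.

(* Main.v *)
Require Import Defs.
From HB Require Import structures.
From mathcomp Require Import all_boot all_order all_algebra.
From mathcomp Require Import all_classical all_reals all_analysis.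
From mathcomp Require Import measurable_realfun ess_sup_inf.
From mathcomp Require Import ring lra.

(** Let [w = u - v]. The force cancels in the difference of the two equations, and
    testing this difference against [w] leaves a single nonlinear term: the
    integral of ((w . grad) u) . w, which equals minus that of ((w . grad) w) . u.
    It is at most the dissipation of [w] plus a multiple of the integral of
    |w|^2 |u|^2, and on the scaling-critical line 2/p + d/q = 1 one has
      |w u|_2^2 <= |w|_2^2 + |grad w|_2^2 + C |u|_q^p |w|_2^2
    ([bilinear_bound]). This is Hoelder's inequality together with the Sobolev
    embedding of H^1 ([sobolev]), derived here on the torus from the
    Loomis-Whitney inequality ([loomis_whitney]). Hence
      d/dt |w|_2^2 <= (1 + C a(t)) |w|_2^2,   a(t) = |u(t)|_q^p,
    with [a] integrable on (0, T), and Gronwall's argument ([gronwall_zero]) gives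
    [w = 0] as soon as |w(s)|_2 tends to zero along some sequence of times s -> 0.

    The last point is where the hypotheses at time zero enter. The solution [u] is
    only known to converge weakly to [u0], so that [w] could lose energy at time
    zero. Write
      |w(s)|_2^2 = <w(s), u(s)> - <w(s), v(s)>.
    The second product tends to zero because [v] converges strongly and [w]
    weakly. For the first one, fix [s], test the equation of [w] against the fixed
    field u(s), and integrate over (r, s). As r -> 0, <w(r), u(s)> tends to zero,
    since both solutions have the same weak limit. Each term of the rate is at
    most
      (1/h + h/2) (|grad u(t)|_2^2 + |grad v(t)|_2^2)
        + h (M + |grad u(s)|_2^2 + C M a(s)),
    where [h] is any positive number and [M] bounds the energies. The first part is
    integrable in time: the energy identity and the finiteness of the energy input
    bound the total dissipation of both solutions ([dissipation_integrable]). The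
    second part contributes at most h s (M + |grad u(s)|_2^2 + C M a(s)). Since
    |grad u|_2^2 + a is integrable near zero and 1/s is not, there are
    arbitrarily small [s] with s (|grad u(s)|_2^2 + a(s)) <= 1 ([small_times]), and
    along these times <w(s), u(s)> tends to zero: choose first [h] small, then [s].

    Integrals over the torus are taken of functions of tuples, so that continuity
    in space and time has to be turned into measurability
    ([continuous_measurable_space_time]) and integration by parts into one-variable
    calculus along each coordinate ([torus_int_upd], [tint_by_parts]). *)

Set Implicit Arguments.
Unset Strict Implicit.
Unset Printing Implicit Defensive.

Import Order.TTheory GRing.Theory Num.Theory.
Import numFieldNormedType.Exports.

Local Open Scope classical_set_scope.
Local Open Scope ring_scope.

Local Notation basis := Defs.basis.

(** * Integration of bounded measurable functions *)

(** A class closed under the algebraic operations and under partial integration,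
    whose members are integrable for every finite measure: working inside it
    discharges integrability conditions uniformly. *)
Definition bounded_measurable {d} {X : measurableType d} {R : realType}
    (F : X -> R) : Prop :=
  measurable_fun [set: X] F /\ exists M : R, forall x, `|F x| <= M.

Section BoundedMeasurable.
Context {d} {X : measurableType d} {R : realType}.
Implicit Types F G : X -> R.

Lemma bm_cst (c : R) : bounded_measurable (fun _ : X => c).
Proof. by split; [exact: measurable_cst|exists `|c|]. Qed.

Lemma bm_add F G : bounded_measurable F -> bounded_measurable G ->
  bounded_measurable (fun x => F x + G x).
Proof.
move=> [mF [M hM]] [mG [N hN]]; split; first exact: measurable_funD.
by exists (M + N) => x; rewrite (le_trans (ler_normD _ _))// lerD.
Qed.

Lemma bm_mul F G : bounded_measurable F -> bounded_measurable G ->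
  bounded_measurable (fun x => F x * G x).
Proof.
move=> [mF [M hM]] [mG [N hN]]; split; first exact: measurable_funM.
by exists (M * N) => x; rewrite normrM ler_pM.
Qed.

Lemma bm_norm F : bounded_measurable F -> bounded_measurable (fun x => `|F x|).
Proof.
move=> [mF [M hM]]; split; first exact: measurableT_comp.
by exists M => x; rewrite normr_id.
Qed.

Lemma bm_sum (I : Type) (s : seq I) (F : I -> X -> R) :
  (forall i, bounded_measurable (F i)) ->
  bounded_measurable (fun x => \sum_(i <- s) F i x).
Proof.
move=> bF; elim: s => [|i s IH].
  by under eq_fun do rewrite big_nil; exact: bm_cst.
by under eq_fun do rewrite big_cons; exact: bm_add.
Qed.

Lemma bm_prod (I : Type) (s : seq I) (F : I -> X -> R) :
  (forall i, bounded_measurable (F i)) ->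
  bounded_measurable (fun x => \prod_(i <- s) F i x).
Proof.
move=> bF; elim: s => [|i s IH].
  by under eq_fun do rewrite big_nil; exact: bm_cst.
by under eq_fun do rewrite big_cons; exact: bm_mul.
Qed.

Lemma bm_powR F (a : R) : 0 <= a -> bounded_measurable F ->
  bounded_measurable (fun x => F x `^ a).
Proof.
move=> a0 [mF [M hM]]; split.
  exact: (measurableT_comp (measurable_powR a)).
exists (Num.max 1 (M `^ a)) => x; rewrite ger0_norm ?powR_ge0// le_max.
have [F0|F0] := leP 0 (F x).
  apply/orP; right; apply: ge0_ler_powR; rewrite ?nnegrE//.
    by rewrite (le_trans _ (hM x)).
  by rewrite (le_trans (ler_norm _)).
by rewrite /powR lt_eqF//; apply/orP; left; rewrite ln0 ?mulr0 ?expR0// ltW.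
Qed.

Lemma bm_comp d' (Y : measurableType d') (h : Y -> X) F :
  measurable_fun [set: Y] h -> bounded_measurable F ->
  bounded_measurable (fun y => F (h y)).
Proof.
move=> mh [mF [M hM]]; split; first exact: measurableT_comp.
by exists M.
Qed.

Variable mu : {finite_measure set X -> \bar R}.

Lemma bm_integrable F : bounded_measurable F -> mu.-integrable setT (EFin \o F).
Proof.
move=> [mF [M hM]]; apply: measurable_bounded_integrable => //.
  by rewrite -ge0_fin_numE//; exact: fin_num_measure.
exists M; split; first exact: num_real.
by move=> N MN x _; exact: le_trans (hM x) (ltW MN).
Qed.

Lemma bm_intD F G : bounded_measurable F -> bounded_measurable G ->
  \int[mu]_x (F x + G x) = \int[mu]_x F x + \int[mu]_x G x.
Proof. by move=> bF bG; rewrite RintegralD//; exact: bm_integrable. Qed.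

Lemma bm_intB F G : bounded_measurable F -> bounded_measurable G ->
  \int[mu]_x (F x - G x) = \int[mu]_x F x - \int[mu]_x G x.
Proof. by move=> bF bG; rewrite RintegralB//; exact: bm_integrable. Qed.

Lemma bm_intZ (c : R) F : bounded_measurable F ->
  \int[mu]_x (c * F x) = c * \int[mu]_x F x.
Proof. by move=> bF; rewrite RintegralZl//; exact: bm_integrable. Qed.

Lemma bm_int_sum (I : Type) (s : seq I) (F : I -> X -> R) :
  (forall i, bounded_measurable (F i)) ->
  \int[mu]_x (\sum_(i <- s) F i x) = \sum_(i <- s) \int[mu]_x F i x.
Proof.
move=> bF; elim: s => [|i s IH].
  rewrite big_nil; under eq_Rintegral do rewrite big_nil.
  by rewrite Rintegral_cst// mul0r.
rewrite big_cons -IH -bm_intD//; last exact: bm_sum.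
by under eq_Rintegral do rewrite big_cons.
Qed.

Lemma bm_int_le F G : bounded_measurable F -> bounded_measurable G ->
  (forall x, F x <= G x) -> \int[mu]_x F x <= \int[mu]_x G x.
Proof. by move=> bF bG FG; apply: le_Rintegral => //; exact: bm_integrable. Qed.

Lemma bm_int_norm F : bounded_measurable F ->
  `|\int[mu]_x F x| <= \int[mu]_x `|F x|.
Proof. by move=> bF; apply: le_normr_Rintegral => //; exact: bm_integrable. Qed.

Lemma bm_int_EFin F : bounded_measurable F ->
  (\int[mu]_x (F x)%:E)%E = (\int[mu]_x F x)%:E.
Proof.
move=> bF; rewrite /Rintegral fineK//.
by apply: integrable_fin_num => //; exact: bm_integrable.
Qed.

End BoundedMeasurable.

Section BoundedFubini.
Context d1 d2 (X : measurableType d1) (Y : measurableType d2) (R : realType).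
Variables (m1 : {finite_measure set X -> \bar R})
          (m2 : {finite_measure set Y -> \bar R}).
Variable F : X * Y -> R.
Hypothesis bF : bounded_measurable F.

Lemma bm_pair1 x : bounded_measurable (fun y => F (x, y)).
Proof. by apply: bm_comp bF; exact: measurable_pair1. Qed.

Lemma bm_pair2 y : bounded_measurable (fun x => F (x, y)).
Proof. by apply: bm_comp bF; exact: measurable_pair2. Qed.

Lemma bm_integrable_prod : (m1 \x m2)%E.-integrable setT (EFin \o F).
Proof.
have [mF [M hM]] := bF.
apply: measurable_bounded_integrable => //.
  rewrite /= -setXTT product_measure1E// lte_mul_pinfty//.
    exact: fin_num_measure.
  by rewrite -ge0_fin_numE//; exact: fin_num_measure.
exists M; split; first exact: num_real.
by move=> N MN x _; exact: le_trans (hM x) (ltW MN).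
Qed.

Lemma bm_int1 : bounded_measurable (fun x => \int[m2]_y F (x, y)).
Proof.
have [mF [M hM]] := bF; split.
  apply/measurable_EFinP; rewrite [X in measurable_fun _ X](_ : _ =
      fubini_F m2 (EFin \o F)); last first.
    by apply/funext => x /=; rewrite /fubini_F/= bm_int_EFin//; exact: bm_pair1.
  by apply: (@measurable_fubini_F _ _ _ _ _ m1 m2); exact: bm_integrable_prod.
exists (M * fine (m2 setT)) => x.
rewrite (le_trans (bm_int_norm _ (bm_pair1 x)))// -Rintegral_cst//.
by apply: bm_int_le => //; [exact/bm_norm/bm_pair1|exact: bm_cst].
Qed.

Lemma bm_int_prod :
  \int[(m1 \x m2)%E]_z F z = \int[m1]_x \int[m2]_y F (x, y).
Proof.
rewrite {1}/Rintegral -(@integral12_prod_meas1 _ _ _ _ _ m1 m2); last first.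
  exact: bm_integrable_prod.
congr fine; apply: eq_integral => x _.
by rewrite /fubini_F/= bm_int_EFin//; exact: bm_pair1.
Qed.

Lemma bm_fubini :
  \int[m1]_x \int[m2]_y F (x, y) = \int[m2]_y \int[m1]_x F (x, y).
Proof.
rewrite -bm_int_prod {1}/Rintegral -(@integral21_prod_meas1 _ _ _ _ _ m1 m2).
  congr fine; apply: eq_integral => x _.
  by rewrite /fubini_G/= bm_int_EFin//; exact: bm_pair2.
exact: bm_integrable_prod.
Qed.

End BoundedFubini.

(** * Integration on the torus, one coordinate at a time *)

Section TorusIntegral.
Context {R : realType}.
Local Notation MR := (measurableTypeR R).
Local Notation mu := (@torus_measure R).
Local Notation circ := (@circle_measure R).

Definition tcons n (s : MR) (y : n.-tuple MR) : n.+1.-tuple MR :=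
  [tuple of s :: y].

Lemma measurable_tcons n :
  measurable_fun [set: MR * n.-tuple MR] (fun z => tcons z.1 z.2).
Proof. exact: measurable_cons_pair. Qed.

Lemma tnth_tcons0 n s (y : n.-tuple MR) : tnth (tcons s y) ord0 = s.
Proof. by []. Qed.

Lemma tnth_tconsS n s (y : n.-tuple MR) j :
  tnth (tcons s y) (lift ord0 j) = tnth y j.
Proof. by rewrite /tcons tnthS. Qed.

Lemma bm_tcons1 n (F : n.+1.-tuple MR -> R) s : bounded_measurable F ->
  bounded_measurable (fun y => F (tcons s y)).
Proof.
move=> bF; exact: (bm_pair1 (bm_comp (@measurable_tcons n) bF)).
Qed.

Lemma bm_tcons2 n (F : n.+1.-tuple MR -> R) y : bounded_measurable F ->
  bounded_measurable (fun s => F (tcons s y)).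
Proof.
move=> bF; exact: (bm_pair2 (bm_comp (@measurable_tcons n) bF)).
Qed.

Lemma bm_int_tcons n (F : n.+1.-tuple MR -> R) : bounded_measurable F ->
  bounded_measurable (fun s => \int[mu n]_y F (tcons s y)).
Proof.
move=> bF; exact: (@bm_int1 _ _ _ _ R circ (mu n) _
  (bm_comp (@measurable_tcons n) bF)).
Qed.

Lemma torus_intS n (F : n.+1.-tuple MR -> R) : bounded_measurable F ->
  \int[mu n.+1]_x F x = \int[circ]_s \int[mu n]_y F (tcons s y).
Proof.
move=> bF.
have bG := bm_comp (@measurable_tcons n) bF.
rewrite -(@bm_int_prod _ _ _ _ _ circ (mu n) _ bG).
rewrite /Rintegral; congr fine.
have [mF _] := bF.
have := @integral_pushforward _ _ _ _ R (@cons_pair R n)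
  (@measurable_cons_pair R n) (circ \x mu n)%E setT (EFin \o F).
rewrite preimage_setT; apply => //; first exact/measurable_EFinP.
exact: (bm_integrable_prod circ (mu n) bG).
Qed.

Lemma circle_measureT : circ setT = (2 * pi)%:E.
Proof.
transitivity (lebesgue_measure ([set: R] `&` `[0, 2 * pi]%classic)) => //.
rewrite setTI lebesgue_measure_itv/=.
rewrite lte_fin ifT ?sube0//.
by rewrite mulr_gt0// pi_gt0.
Qed.

Lemma circle_int_cst (c : R) : \int[circ]_s c = c * (2 * pi).
Proof.
rewrite Rintegral_cst//; congr (_ * _).
exact: (congr1 fine circle_measureT).
Qed.

Definition upd n (x : n.-tuple MR) (i : 'I_n) (s : MR) : n.-tuple MR :=
  [tuple if j == i then s else tnth x j | j < n].

Lemma tnth_upd n (x : n.-tuple MR) i s j :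
  tnth (upd x i s) j = if j == i then s else tnth x j.
Proof. by rewrite tnth_mktuple. Qed.

Lemma upd_tcons0 n s (y : n.-tuple MR) s' :
  upd (tcons s y) ord0 s' = tcons s' y.
Proof.
apply: eq_from_tnth => i; rewrite tnth_upd.
case: (unliftP ord0 i) => [j ->|->]; last by rewrite eqxx tnth_tcons0.
by rewrite !tnth_tconsS -(inj_eq val_inj).
Qed.

Lemma upd_tconsS n s (y : n.-tuple MR) i s' :
  upd (tcons s y) (lift ord0 i) s' = tcons s (upd y i s').
Proof.
apply: eq_from_tnth => k; rewrite tnth_upd.
case: (unliftP ord0 k) => [j ->|->].
  by rewrite !tnth_tconsS tnth_upd (inj_eq lift_inj).
by rewrite !tnth_tcons0 -(inj_eq val_inj).
Qed.

Lemma measurable_upd n (i : 'I_n) :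
  measurable_fun [set: n.-tuple MR * MR] (fun z => upd z.1 i z.2).
Proof.
apply/measurable_fun_tnthP => j; rewrite /comp/=.
under eq_fun do rewrite tnth_upd.
have [_|_] := eqVneq j i; first exact: measurable_snd.
apply: (measurableT_comp (measurable_tnth j)); exact: measurable_fst.
Qed.

Lemma bm_upd n (i : 'I_n) (F : n.-tuple MR -> R) x : bounded_measurable F ->
  bounded_measurable (fun s => F (upd x i s)).
Proof. by move=> bF; exact: (bm_pair1 (bm_comp (measurable_upd i) bF)). Qed.

Lemma bm_int_upd n (i : 'I_n) (F : n.-tuple MR -> R) : bounded_measurable F ->
  bounded_measurable (fun x => \int[circ]_s F (upd x i s)).
Proof.
move=> bF; exact: (@bm_int1 _ _ _ _ R (mu n) circ _
  (bm_comp (measurable_upd i) bF)).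
Qed.

(** Fubini's theorem for an arbitrary coordinate, although the measure is built
    by adding coordinates at the head: the coordinate is moved to the head by
    induction. The factor is the length of the circle, because the outer integral
    still runs over the coordinate that has been replaced. *)
Lemma torus_int_upd n (i : 'I_n) (F : n.-tuple MR -> R) :
  bounded_measurable F ->
  \int[mu n]_x \int[circ]_s F (upd x i s) = (2 * pi) * \int[mu n]_x F x.
Proof.
elim: n i F => [[]//|n IH] i F bF.
rewrite torus_intS; last exact: bm_int_upd.
rewrite torus_intS//.
case: (unliftP ord0 i) => [j ->|->].
  rewrite -bm_intZ; last exact: bm_int_tcons.
  apply: eq_Rintegral => s _.
  have := IH j (fun y => F (tcons s y)) (bm_tcons1 s bF) => <-.
  apply: eq_Rintegral => y _; apply: eq_Rintegral => s' _.
  by rewrite upd_tconsS.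
under eq_Rintegral do under eq_Rintegral do under eq_Rintegral
  do rewrite upd_tcons0.
rewrite circle_int_cst mulrC; congr (_ * _).
have bG := bm_comp (@measurable_tcons n) bF.
by rewrite (bm_fubini circ (mu n) bG).
Qed.

End TorusIntegral.

(** * The inequalities of Hoelder and of Loomis and Whitney *)

Section Inequalities.
Context {R : realType}.

(** Dividing by the left-hand side, which is [expR S], reduces the claim to
    [1 + y <= expR y] at [y = ln (x i) - S], averaged with the weights [a i]. *)
Lemma weighted_amgm (I : finType) (a x : I -> R) :
  (forall i, 0 < a i) -> \sum_i a i = 1 -> (forall i, 0 <= x i) ->
  \prod_i x i `^ a i <= \sum_i a i * x i.
Proof.
move=> a0 a1 x0.
have sum0 : 0 <= \sum_i a i * x i.
  by apply: sumr_ge0 => i _; rewrite mulr_ge0// ltW.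
have [/existsP[i /eqP xi0]|] := boolP [exists i, x i == 0].
  rewrite (bigD1 i)//= xi0 powR0 ?mul0r//.
  by rewrite gt_eqF.
rewrite negb_exists => /forallP xn0.
have {}x0 i : 0 < x i by rewrite lt_neqAle x0 andbT eq_sym.
pose S := \sum_i a i * ln (x i).
have -> : \prod_i x i `^ a i = expR S.
  rewrite expR_sum; apply: eq_bigr => i _.
  by rewrite /powR gt_eqF.
rewrite -[leLHS]mul1r -ler_pdivlMr ?expR_gt0// mulr_suml.
rewrite [leLHS](_ : 1 = \sum_i a i * (1 + (ln (x i) - S))); last first.
  transitivity (\sum_i a i + (S - (\sum_i a i) * S)); first by rewrite a1; ring.
  rewrite mulr_suml -sumrB -big_split/=; apply: eq_bigr => i _; ring.
apply: ler_sum => i _; rewrite -mulrA ler_pM2l//.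
rewrite (le_trans (expR_ge1Dx _))// expRD expRN lnK//.
by rewrite posrE.
Qed.

Lemma powR_prod (I : Type) (s : seq I) (F : I -> R) (a : R) :
  (forall i, 0 <= F i) ->
  (\prod_(i <- s) F i) `^ a = \prod_(i <- s) F i `^ a.
Proof.
move=> F0; elim: s => [|i s IH]; first by rewrite !big_nil powR1.
by rewrite !big_cons powRM ?IH// prodr_ge0.
Qed.

Lemma powR_mulV (x c a : R) : 0 <= x -> 0 < c ->
  x `^ a = (x / c) `^ a * c `^ a.
Proof.
move=> x0 c0; rewrite -powRM ?divr_ge0 ?(ltW c0)//.
by rewrite divfK// gt_eqF.
Qed.

Section Hoelder.
Context {d} {X : measurableType d} (mu : {finite_measure set X -> \bar R}).

(** The weighted inequality of the means, applied pointwise to [F i x / c i]. With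
    positive upper bounds [c i] in place of the integrals, a vanishing integral
    is not a special case. *)
Lemma bm_hoelder (I : finType) (a c : I -> R) (F : I -> X -> R) :
  (forall i, 0 < a i) -> \sum_i a i = 1 -> (forall i, 0 < c i) ->
  (forall i, bounded_measurable (F i)) -> (forall i x, 0 <= F i x) ->
  (forall i, \int[mu]_x F i x <= c i) ->
  \int[mu]_x (\prod_i F i x `^ a i) <= \prod_i c i `^ a i.
Proof.
move=> a0 a1 c0 bF F0 Fc.
pose G x := (\prod_i c i `^ a i) * \sum_i (a i / c i) * F i x.
have bS : bounded_measurable (fun x => \sum_i (a i / c i) * F i x).
  by apply: bm_sum => i; apply: bm_mul => //; exact: bm_cst.
have bG : bounded_measurable G by apply: bm_mul => //; exact: bm_cst.
have c'0 : 0 <= \prod_i c i `^ a i.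
  by apply: prodr_ge0 => i _; exact: powR_ge0.
apply: (@le_trans _ _ (\int[mu]_x G x)).
  apply: bm_int_le => // [|x].
    by apply: bm_prod => i; apply: bm_powR => //; exact: ltW.
  rewrite /G (eq_bigr (fun i => (F i x / c i) `^ a i * c i `^ a i)); last first.
    by move=> i _; exact: powR_mulV.
  rewrite big_split/= mulrC ler_wpM2l//.
  rewrite (le_trans (weighted_amgm a0 a1 _))//.
    by move=> i; rewrite divr_ge0// ltW.
  by rewrite le_eqVlt; apply/orP; left; apply/eqP; apply: eq_bigr => i _; ring.
rewrite bm_intZ// -[leRHS]mulr1 ler_wpM2l// -a1.
rewrite bm_int_sum; last first.
  by move=> i; apply: bm_mul => //; exact: bm_cst.
apply: ler_sum => i _; rewrite bm_intZ//.
by rewrite mulrAC ler_pdivrMr// ler_pM2l.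
Qed.

Lemma bm_hoelder2 (a b c e : R) (F G : X -> R) :
  0 < a -> 0 < b -> a + b = 1 -> 0 < c -> 0 < e ->
  bounded_measurable F -> bounded_measurable G ->
  (forall x, 0 <= F x) -> (forall x, 0 <= G x) ->
  \int[mu]_x F x <= c -> \int[mu]_x G x <= e ->
  \int[mu]_x (F x `^ a * G x `^ b) <= c `^ a * e `^ b.
Proof.
move=> a0 b0 ab c0 e0 bF bG F0 G0 Fc Ge.
have := @bm_hoelder bool (fun i => if i then a else b)
  (fun i => if i then c else e) (fun i => if i then F else G).
rewrite !big_bool/= => /(_ _ ab).
rewrite (_ : (fun x => \prod_i (if i then F else G) x `^ (if i then a else b)) =
  (fun x => F x `^ a * G x `^ b)); last by apply/funext => x; rewrite big_bool.
by apply; case.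
Qed.

Lemma bm_hoelder3 (a b c ca cb cc : R) (F G H : X -> R) :
  0 < a -> 0 < b -> 0 < c -> a + b + c = 1 -> 0 < ca -> 0 < cb -> 0 < cc ->
  bounded_measurable F -> bounded_measurable G -> bounded_measurable H ->
  (forall x, 0 <= F x) -> (forall x, 0 <= G x) -> (forall x, 0 <= H x) ->
  \int[mu]_x F x <= ca -> \int[mu]_x G x <= cb -> \int[mu]_x H x <= cc ->
  \int[mu]_x (F x `^ a * (G x `^ b * H x `^ c)) <=
    ca `^ a * (cb `^ b * cc `^ c).
Proof.
move=> a0 b0 c0 abc ca0 cb0 cc0 bF bG bH F0 G0 H0 Fa Gb Hc.
pose al (i : 'I_3) := tnth [tuple a; b; c] i.
pose C (i : 'I_3) := tnth [tuple ca; cb; cc] i.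
pose K (i : 'I_3) := tnth [tuple F; G; H] i.
have E (u v : 'I_3 -> R) : \prod_i u i `^ v i =
    u ord0 `^ v ord0 * (u (lift ord0 ord0) `^ v (lift ord0 ord0) *
      u (lift ord0 (lift ord0 ord0)) `^ v (lift ord0 (lift ord0 ord0))).
  by rewrite !big_ord_recl big_ord0 mulr1.
have := @bm_hoelder 'I_3 al C K; rewrite E.
rewrite (_ : (fun x => \prod_i K i x `^ al i) =
    (fun x => F x `^ a * (G x `^ b * H x `^ c))); last first.
  by apply/funext => x; rewrite (E (fun i => K i x)).
apply.
- by case; case=> [|[|[|]]].
- by rewrite !big_ord_recl big_ord0 addr0 addrA.
- by case; case=> [|[|[|]]].
- by case; case=> [|[|[|]]].
- by case; case=> [|[|[|]]].
- by case; case=> [|[|[|]]].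
Qed.

End Hoelder.

End Inequalities.

Section LoomisWhitney.
Context {R : realType}.
Local Notation MR := (measurableTypeR R).
Local Notation mu := (@torus_measure R).
Local Notation circ := (@circle_measure R).

Let tau : R := 2 * pi.

Lemma tau_gt0 : 0 < tau.
Proof. by rewrite mulr_gt0// pi_gt0. Qed.

Lemma torus_int_cst n (c : R) : \int[mu n]_x c = c * tau ^+ n.
Proof.
elim: n => [|n IH].
  rewrite Rintegral_cst// expr0; congr (_ * _).
  exact: (congr1 fine (diracT _ _)).
rewrite torus_intS; last exact: bm_cst.
under eq_Rintegral do rewrite IH.
by rewrite circle_int_cst exprSr [RHS]mulrA.
Qed.

Lemma torus_int_ge n (F : n.-tuple MR -> R) (e : R) : bounded_measurable F ->
  (forall x, e <= F x) -> e * tau ^+ n <= \int[mu n]_x F x.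
Proof.
move=> bF eF; rewrite -torus_int_cst; apply: bm_int_le => //.
exact: bm_cst.
Qed.

Lemma torus_int_indep0 n (f : n.+1.-tuple MR -> R) (s : MR) :
  bounded_measurable f -> (forall x t, f (upd x ord0 t) = f x) ->
  \int[mu n.+1]_x f x = tau * \int[mu n]_y f (tcons s y).
Proof.
move=> bf fi; rewrite torus_intS//.
rewrite mulrC -circle_int_cst.
apply: eq_Rintegral => t _; apply: eq_Rintegral => y _.
by rewrite -(fi (tcons s y) t) upd_tcons0.
Qed.

(** Induction on the dimension, slicing by the head coordinate. The function [f 0]
    is the same on all slices. On a slice, Hoelder's inequality separates it from
    the other functions, and the induction hypothesis bounds these by their
    integrals [J j s] over the slice; a second use of Hoelder's inequality, in the
    head coordinate, turns the product of the [J j s] into the product of the full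
    integrals. The lower bound [e] keeps all integrals positive. *)
Lemma loomis_whitney n : exists2 C : R, 0 < C &
  forall (f : 'I_n.+2 -> n.+2.-tuple MR -> R) (e : R), 0 < e ->
    (forall i, bounded_measurable (f i)) -> (forall i x, e <= f i x) ->
    (forall i x s, f i (upd x i s) = f i x) ->
    \int[mu n.+2]_x (\prod_i f i x `^ n.+1%:R^-1) <=
      C * \prod_i (\int[mu n.+2]_x f i x) `^ n.+1%:R^-1.
Proof.
have t0 := tau_gt0.
elim: n => [|n [C C0 IH]].
  exists (tau^-1 ^+ 2); first by rewrite exprn_gt0// invr_gt0.
  move=> f e e0 bf ef fi.
  rewrite invr1 !big_ord_recl !big_ord0 !mulr1 !powRr1; last 2 first.
  - by apply: Rintegral_ge0 => x _; rewrite (le_trans (ltW e0)).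
  - by apply: Rintegral_ge0 => x _; rewrite (le_trans (ltW e0)).
  under eq_Rintegral => x _.
    rewrite !big_ord_recl big_ord0 mulr1 !powRr1; try by rewrite (le_trans (ltW e0)).
    over.
  rewrite torus_intS; last exact: bm_mul.
  rewrite (@torus_int_indep0 _ (f ord0) 0)//.
  pose y0 : 1.-tuple MR := [tuple 0].
  have f1 s y : f (lift ord0 ord0) (tcons s y) = f (lift ord0 ord0) (tcons s y0).
    rewrite -(fi _ (tcons s y) 0) upd_tconsS; congr (f _ (tcons _ _)).
    by apply: eq_from_tnth => i; rewrite !ord1 tnth_upd eqxx.
  have -> : \int[mu 2]_x f (lift ord0 ord0) x =
      (\int[circ]_s f (lift ord0 ord0) (tcons s y0)) * tau.
    rewrite torus_intS// -RintegralZr//; last exact/bm_integrable/bm_tcons2.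
    apply: eq_Rintegral => s _; rewrite -[tau]expr1 -torus_int_cst.
    by apply: eq_Rintegral => y _; exact: f1.
  under eq_Rintegral => s _.
    rewrite (_ : \int[_]_y _ = (\int[mu 1]_y f ord0 (tcons 0 y)) *
        f (lift ord0 ord0) (tcons s y0)); last first.
      rewrite mulrC -bm_intZ; last exact: bm_tcons1.
      apply: eq_Rintegral => y _; rewrite f1 mulrC; congr (_ * _).
      by rewrite -(fi ord0 (tcons s y) 0) upd_tcons0.
    over.
  rewrite bm_intZ; last exact: bm_tcons2.
  rewrite le_eqVlt; apply/orP; left; apply/eqP.
  by field; rewrite gt_eqF.
set N : R := n.+1%:R; set N1 : R := n.+2%:R.
have N0 : 0 < N by rewrite ltr0n.
have N10 : 0 < N1 by rewrite ltr0n.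
(* Hoelder exponents on a slice: [a] for [f 0], [b] for the others together *)
pose a := N1^-1; pose b := N / N1.
have a0 : 0 < a by rewrite invr_gt0.
have b0 : 0 < b by rewrite divr_gt0.
have N1E : N1 = N + 1 by rewrite /N1 /N natr1.
have ab : a + b = 1 by rewrite /a /b; move: N1E N10 => -> N10; field; rewrite gt_eqF.
exists (C `^ b * tau^-1 `^ a).
  by rewrite mulr_gt0// powR_gt0// invr_gt0.
move=> f e e0 bf ef fi.
have ep x i : 0 <= f i x by rewrite (le_trans (ltW e0)).
have pos i : 0 < \int[mu n.+3]_x f i x.
  by rewrite (lt_le_trans _ (torus_int_ge _ (ef i)))// mulr_gt0// exprn_gt0.
pose J (j : 'I_n.+2) s := \int[mu n.+2]_y f (lift ord0 j) (tcons s y).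
have bJ j : bounded_measurable (J j) by exact: bm_int_tcons.
have J0 j s : 0 < J j s.
  apply: (@lt_le_trans _ _ (e * tau ^+ n.+2)).
    by rewrite mulr_gt0// exprn_gt0.
  by apply: torus_int_ge => [|y]; [exact: bm_tcons1|exact: ef].
pose H := \int[mu n.+2]_y f ord0 (tcons 0 y).
have HE : \int[mu n.+3]_x f ord0 x = tau * H by exact: torus_int_indep0.
have H0 : 0 < H by move: (pos ord0); rewrite HE pmulr_rgt0.
have bprod : bounded_measurable (fun x => \prod_i f i x `^ a).
  by apply: bm_prod => i; apply: bm_powR => //; exact: ltW.
rewrite torus_intS//.
have slice s : \int[mu n.+2]_y (\prod_i f i (tcons s y) `^ a) <=
    (H `^ a * C `^ b) * \prod_j J j s `^ a.
  pose G y := \prod_(j < n.+2) f (lift ord0 j) (tcons s y) `^ N^-1.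
  have bG : bounded_measurable G.
    apply: bm_prod => i; apply: bm_powR; first by rewrite invr_ge0 ltW.
    exact: bm_tcons1.
  rewrite (_ : (fun y => _) = fun y => f ord0 (tcons 0 y) `^ a * G y `^ b).
    apply: (@le_trans _ _ (H `^ a * (C * \prod_j J j s `^ N^-1) `^ b)).
      apply: bm_hoelder2 => //.
      - by rewrite mulr_gt0// prodr_gt0// => j _; rewrite powR_gt0.
      - exact: bm_tcons1.
      - by move=> y; apply: prodr_ge0 => j _; exact: powR_ge0.
      - apply: (IH (fun j y => f (lift ord0 j) (tcons s y)) e) => //.
        + by move=> j; exact: bm_tcons1.
        + by move=> j y t; rewrite -upd_tconsS fi.
    rewrite powRM ?(ltW C0)//; last by apply: prodr_ge0 => j _; exact: powR_ge0.
    rewrite mulrA ler_wpM2l//; first by rewrite mulr_ge0// powR_ge0.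
    rewrite powR_prod//; last by move=> *; exact: powR_ge0.
    rewrite le_eqVlt; apply/orP; left; apply/eqP; apply: eq_bigr => j _.
    by rewrite -powRrM; congr (_ `^ _); rewrite /a /b; field; rewrite !gt_eqF.
  apply/funext => y; rewrite big_ord_recl; congr (_ * _).
    by rewrite -(fi ord0 (tcons s y) 0) upd_tcons0.
  rewrite /G powR_prod//; last by move=> *; exact: powR_ge0.
  apply: eq_bigr => j _.
  by rewrite -powRrM; congr (_ `^ _); rewrite /a /b; field; rewrite !gt_eqF.
have bpJ : bounded_measurable (fun s => \prod_j J j s `^ a).
  by apply: bm_prod => j; apply: bm_powR => //; exact: ltW.
apply: (le_trans (bm_int_le _ _ _ slice)).
- exact: (bm_int_tcons bprod).
- by apply: bm_mul => //; exact: bm_cst.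
rewrite bm_intZ// big_ord_recl HE.
rewrite (_ : C `^ b * _ * _ =
    H `^ a * C `^ b * \prod_j (\int[mu n.+3]_x f (lift ord0 j) x) `^ a).
  rewrite ler_wpM2l//; first by rewrite mulr_ge0// powR_ge0.
  apply: bm_hoelder => //.
  - by rewrite sumr_const card_ord -(mulr_natr a) mulVf// gt_eqF.
  - by move=> j s; exact/ltW.
  - by move=> j; rewrite torus_intS.
rewrite powRM ?(ltW t0)// ?(ltW H0)// mulrA -/a; congr (_ * _).
rewrite -mulrA (mulrA (tau^-1 `^ a)) -powRM ?invr_ge0 ?(ltW t0)//.
by rewrite mulVf ?gt_eqF// powR1 mul1r mulrC.
Qed.

End LoomisWhitney.

(** * Calculus along lines and measurability of continuous functions *)

Section RestrictedMeasure.
Context {d} {X : measurableType d} {R : realType}.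
Variables (mu : {measure set X -> \bar R}) (D : set X) (mD : measurable D).

Lemma ge0_integral_mrestr (f : X -> \bar R) :
  measurable_fun setT f -> (forall x, (0 <= f x)%E) ->
  (\int[mrestr mu mD]_x f x = \int[mu]_(x in D) f x)%E.
Proof.
move=> mf f0.
rewrite (@ge0_negligible_integral _ _ _ _ setT (~` D))//; last 2 first.
- exact: measurableC.
- by rewrite /= /mrestr setICl measure0.
rewrite setDE setCK setTI; apply: eq_measure_integral => A mA AD.
by rewrite /= /mrestr setIidl.
Qed.

Hypothesis Dfin : (mu D < +oo)%E.

Lemma bm_int_mfrestr (f : X -> R) : bounded_measurable f ->
  \int[mfrestr mD Dfin]_x f x = \int[mu]_(x in D) f x.
Proof.
move=> bf; rewrite /Rintegral; congr fine.
rewrite (@negligible_integral _ _ _ _ setT (~` D))//; last 3 first.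
- exact: measurableC.
- exact: bm_integrable.
- by rewrite /= /mfrestr /mrestr setICl measure0.
rewrite setDE setCK setTI; apply: eq_measure_integral => A mA AD.
by rewrite /= /mfrestr /mrestr setIidl.
Qed.

End RestrictedMeasure.

Section Calculus.
Context {R : realType}.

Lemma is_derive_line (V : normedModType R) (g : V -> R^o) (x v : V) (s l : R) :
  is_derive (x + s *: v) v g l -> is_derive s 1 (fun h : R => g (x + h *: v)) l.
Proof.
have E : (fun h : R => h^-1 *: (((fun h : R => g (x + h *: v)) \o shift s) (h *: 1)
             - g (x + s *: v))) =
         (fun h : R => h^-1 *: ((g \o shift (x + s *: v)) (h *: v)
             - g (x + s *: v))).
  apply/funext => h /=; congr (_ *: (g _ - _)).
  by rewrite [h *: 1]mulr1 scalerDl addrCA.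
move=> [dg <-]; split; first by rewrite /derivable E.
by rewrite /derive E.
Qed.

Lemma is_derive_of_line (V : normedModType R) (g : V -> R^o) (x v : V) (l : R) :
  is_derive (0 : R) 1 (fun h : R => g (x + h *: v)) l -> is_derive x v g l.
Proof.
have E : (fun h : R => h^-1 *: (((fun h : R => g (x + h *: v)) \o shift 0) (h *: 1)
             - g (x + 0 *: v))) =
         (fun h : R => h^-1 *: ((g \o shift x) (h *: v) - g x)).
  apply/funext => h /=; rewrite scale0r !addr0.
  by rewrite [h *: 1]mulr1 [x + _]addrC.
move=> [dg <-]; split; first by rewrite /derivable -E.
by rewrite /derive -E.
Qed.

Lemma is_derive_comp1 (V : normedModType R) (g : V -> R^o) (f : R -> R)
    (x v : V) (l m : R) :
  is_derive x v g l -> is_derive (g x) 1 f m ->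
  is_derive x v ((fun y => f (g y)) : V -> R^o) (m * l).
Proof.
move=> dg df; apply: is_derive_of_line.
have dl : is_derive (0 : R) 1 (fun h : R => g (x + h *: v)) l.
  by apply: is_derive_line; rewrite scale0r addr0.
have df' : is_derive (g (x + 0 *: v)) 1 f m by rewrite scale0r addr0.
by have := @is_derive1_comp _ f (fun h : R => g (x + h *: v)) 0 m l df' dl.
Qed.

Lemma FTC_C1 (F f : R -> R) (a b : R) : a <= b ->
  (forall x, a <= x <= b -> is_derive x 1 F (f x)) ->
  (forall x, a <= x <= b -> {for x, continuous f}) ->
  \int[lebesgue_measure]_(x in `[a, b]) f x = F b - F a.
Proof.
rewrite le_eqVlt => /predU1P[->|ab] dF cf.
  rewrite set_itv1 /Rintegral integral_set1//= ?subrr//.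
have cF x : a <= x <= b -> {for x, continuous F}.
  move=> /dF[dx _].
  by apply/differentiable_continuous; rewrite -derivable1_diffP.
rewrite /Rintegral (@continuous_FTC2 _ f F a b)//.
- apply: continuous_in_subspaceT => x; rewrite inE/= in_itv/=; exact: cf.
- split.
  + move=> x; rewrite in_itv/= => /andP[ax xb].
    by have [] := dF x; rewrite ?(ltW ax) ?(ltW xb).
  + by apply: cvg_at_right_filter; apply: cF; rewrite lexx ltW.
  + by apply: cvg_at_left_filter; apply: cF; rewrite lexx ltW.
- move=> x; rewrite in_itv/= => /andP[ax xb].
  by rewrite derive1E; apply: derive_val; apply: dF; rewrite !ltW.
Qed.

End Calculus.

Section ContinuousMeasurable.
Context {R : realType}.
Local Notation MR := (measurableTypeR R).

Definition grid (n : nat) (x : R) : R := (Num.floor (x * n.+1%:R))%:~R / n.+1%:R.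

Lemma grid_le (n : nat) (x : R) : `|x - grid n x| <= n.+1%:R^-1.
Proof.
have /andP[h1 h2] := floor_itv (x * n.+1%:R).
have n0 : 0 < (n.+1%:R : R) by rewrite ltr0n.
rewrite /grid -[X in X - _](mulfK (lt0r_neq0 n0)) -mulrBl normrM.
rewrite (gtr0_norm (x := _^-1)) ?invr_gt0// ler_piMl ?invr_ge0 ?(ltW n0)//.
by rewrite ler_norml; move: h2; rewrite intrD => h2; apply/andP; split; lra.
Qed.

Lemma measurable_floor_eq (c : int) (a : R) :
  measurable [set x : MR | Num.floor (x * a) = c].
Proof.
have mm : measurable_fun [set: MR] (fun x : MR => x * a : MR).
  exact: mulrr_measurable.
have := mm measurableT `[c%:~R, (c + 1)%:~R[%classic (measurable_itv _).
rewrite setTI; congr measurable; apply/seteqP; split => x /=.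
  by rewrite in_itv/= -floor_eq => /eqP.
by move/eqP; rewrite floor_eq in_itv.
Qed.

(** The sigma-algebra on tuples is generated by the coordinates, and nothing
    relates it directly to the topology of ['rV[R]_d]. A continuous function is
    the pointwise limit of its values at the points rounded down to a grid of
    mesh [1 / (n + 1)], and these depend on countably many measurable conditions
    on the coordinates. *)
Lemma continuous_measurable_space_time (d : nat) (G : R * 'rV[R]_d -> R) :
  continuous G ->
  measurable_fun [set: MR * d.-tuple MR] (fun z => G (z.1 : R, pt z.2)).
Proof.
move=> cG.
pose Gn n (z : MR * d.-tuple MR) : R :=
  G (grid n z.1, \row_i grid n (tnth z.2 i)).
apply: (@measurable_fun_cvg _ _ _ _ Gn).
  move=> n.
  pose key (z : MR * d.-tuple MR) : int * {ffun 'I_d -> int} :=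
    (Num.floor (z.1 * n.+1%:R), [ffun i => Num.floor (tnth z.2 i * n.+1%:R)]).
  pose g (c : int * {ffun 'I_d -> int}) : R :=
    G (c.1%:~R / n.+1%:R, \row_i ((c.2 i)%:~R / n.+1%:R)).
  have E z : Gn n z = g (key z).
    rewrite /Gn /g /key /grid/=; congr (G (_, _)).
    by apply/rowP => i; rewrite !mxE ffunE.
  move=> _ B mB; rewrite setTI.
  rewrite [X in measurable X](_ : _ = \bigcup_(c : int * {ffun 'I_d -> int})
      (if `[< B (g c) >] then [set z | key z = c] else set0)); last first.
    apply/seteqP; split => z /=.
      rewrite E => Bz; exists (key z) => //.
      by case: asboolP.
    by move=> [c _]; case: asboolP => // Bc /= kc; rewrite E kc.
  apply: countable_bigcupT_measurable => // c; case: ifP => // _.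
  rewrite [X in measurable X](_ : _ =
    [set z | Num.floor (z.1 * n.+1%:R) = c.1] `&`
    \bigcap_(i in [set: 'I_d]) [set z : MR * d.-tuple MR |
        Num.floor (tnth z.2 i * n.+1%:R) = c.2 i]); last first.
    apply/seteqP; split => z /=.
      by move=> <-; split => // i _ /=; rewrite ffunE.
    case=> z1 z2; rewrite /key z1; case: c z2 {z1} => c1 c2 /= z2.
    by congr pair; apply/ffunP => i; rewrite ffunE; exact: z2.
  apply: measurableI.
    have m1 : measurable_fun [set: MR * d.-tuple MR] fst by exact: measurable_fst.
    by rewrite -[X in measurable X]setTI;
      exact: (m1 measurableT _ (measurable_floor_eq c.1 n.+1%:R)).
  apply: fin_bigcap_measurable => // i _.
  have mi : measurable_fun [set: MR * d.-tuple MR] (fun z => tnth z.2 i).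
    by apply: (measurableT_comp (measurable_tnth i)); exact: measurable_snd.
  by rewrite -[X in measurable X]setTI;
    exact: (mi measurableT _ (measurable_floor_eq (c.2 i) n.+1%:R)).
move=> z _.
apply: (@cvg_comp _ _ _ (fun n => (grid n z.1, \row_i grid n (tnth z.2 i)))
  G \oo (nbhs (z.1 : R, pt z.2))); last exact: cG.
have small (e : R) : 0 < e -> \forall n \near \oo, n.+1%:R^-1 <= e.
  move=> e0; near=> n; apply: ltW.
  near: n; exact: (near_infty_natSinv_lt (PosNum e0)).
apply: (@cvg_pair _ _ _ _ (nbhs (z.1 : R)) (nbhs (pt z.2))) => /=;
  apply/cvgrPdist_le => /= e e0; near=> n.
  by apply: le_trans (grid_le _ _) _; near: n; exact: small.
rewrite /Num.norm/= mx_normrE; apply: bigmax_le; first exact: ltW.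
move=> [i j] _ /=; rewrite !mxE.
by apply: le_trans (grid_le _ _) _; near: n; exact: small.
Unshelve. all: by end_near. Qed.

End ContinuousMeasurable.

(** * Periodic continuous functions *)

Section Periodic.
Context {R : realType} {d : nat}.
Local Notation E := 'rV[R]_d.
Local Notation MR := (measurableTypeR R).

Lemma periodic_int (W : Type) (g : E -> W) : torus_periodic g ->
  forall x i (k : int), g (x + (k%:~R * (2 * pi)) *: basis i) = g x.
Proof.
move=> pg.
have pn x i (n : nat) : g (x + (n%:R * (2 * pi)) *: basis i) = g x.
  elim: n => [|n IH]; first by rewrite mul0r scale0r addr0.
  by rewrite -natr1 mulrDl mul1r scalerDl addrA pg.
move=> x i [n|n]; first exact: pn.
rewrite NegzE intrN -[LHS](pn _ i n.+1); congr g.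
by rewrite -addrA -scalerDl mulNr addNr scale0r addr0.
Qed.

(** The point [y] is chosen before [g], so it serves all periodic functions. *)
Lemma periodic_reduce (x : E) : exists y : E,
  (forall i, 0 <= y 0 i < 2 * pi) /\
  forall (W : Type) (g : E -> W), torus_periodic g -> g x = g y.
Proof.
have t0 := @tau_gt0 R.
pose k i : int := - Num.floor (x 0 i / (2 * pi)).
exists (x + \sum_i ((k i)%:~R * (2 * pi)) *: basis i); split.
  move=> i; rewrite !mxE summxE (bigD1 i)//= big1 => [|j ji]; last first.
    by rewrite !mxE eqxx/= eq_sym (negbTE ji) mulr0.
  rewrite !mxE !eqxx/= mulr1 addr0 /k intrN mulNr.
  have /andP[h1 h2] := floor_itv (x 0 i / (2 * pi)).
  move: h1 h2; rewrite intrD ler_pdivlMr// ltr_pdivrMr// => h1 h2.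
  by apply/andP; split; [lra|move: h2; rewrite mulrDl; lra].
move=> W g pg.
elim: (index_enum _) => [|i s IH]; first by rewrite big_nil addr0.
rewrite big_cons addrCA addrC.
by rewrite periodic_int.
Qed.

Definition torus_continuous (g : E -> R) : Prop :=
  torus_periodic g /\ continuous g.

Definition st_continuous (T : R) (g : R -> E -> R) : Prop :=
  (forall t, 0 < t < T -> torus_periodic (g t)) /\
  (forall t x, 0 < t < T ->
    {for (t, x), continuous (fun z : R * E => g z.1 z.2)}).

Lemma tc_cst (c : R) : torus_continuous (fun=> c).
Proof. by split => //; exact: cst_continuous. Qed.

Lemma tc_add g h : torus_continuous g -> torus_continuous h ->
  torus_continuous (fun x => g x + h x).
Proof.
move=> [pg cg] [ph ch]; split; first by move=> x i; rewrite pg ph.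
by move=> x; exact: cvgD (cg x) (ch x).
Qed.

Lemma tc_mul g h : torus_continuous g -> torus_continuous h ->
  torus_continuous (fun x => g x * h x).
Proof.
move=> [pg cg] [ph ch]; split; first by move=> x i; rewrite pg ph.
by move=> x; exact: cvgM (cg x) (ch x).
Qed.

Lemma tc_opp g : torus_continuous g -> torus_continuous (fun x => - g x).
Proof.
move=> [pg cg]; split; first by move=> x i; rewrite pg.
by move=> x; exact: cvgN (cg x).
Qed.

Lemma tc_sub g h : torus_continuous g -> torus_continuous h ->
  torus_continuous (fun x => g x - h x).
Proof. by move=> cg /tc_opp; exact: tc_add. Qed.

Lemma tc_norm g : torus_continuous g -> torus_continuous (fun x => `|g x|).
Proof.
move=> [pg cg]; split; first by move=> x i; rewrite pg.
by move=> x; exact: cvg_norm (cg x).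
Qed.

Lemma tc_sum (I : Type) (s : seq I) (g : I -> E -> R) :
  (forall i, torus_continuous (g i)) ->
  torus_continuous (fun x => \sum_(i <- s) g i x).
Proof.
move=> cg; elim: s => [|i s IH].
  by under eq_fun do rewrite big_nil; exact: tc_cst.
by under eq_fun do rewrite big_cons; exact: tc_add.
Qed.

Lemma tc_comp (f : R -> R) g : torus_continuous g ->
  (forall x, {for g x, continuous f}) -> torus_continuous (fun x => f (g x)).
Proof.
move=> [pg cg] cf; split; first by move=> x i; rewrite pg.
by move=> x; apply: continuous_comp; [exact: cg|exact: cf].
Qed.

Section SpaceTime.
Variable T : R.

Lemma st_tc g t : 0 < t < T -> st_continuous T g -> torus_continuous (g t).
Proof.
move=> tT [pg cg]; split; first exact: pg.
move=> x; apply: (@cvg_comp _ _ _ (fun x : E => (t, x))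
  (fun z : R * E => g z.1 z.2) (nbhs x) (nbhs (t, x))); last exact: cg.
apply: (@cvg_pair _ _ _ _ (nbhs t) (nbhs x)); [exact: cvg_cst|exact: cvg_id].
Qed.

Lemma tc_st g : torus_continuous g -> st_continuous T (fun=> g).
Proof.
move=> [pg cg]; split => // t x _.
apply: (@cvg_comp _ _ _ (fun z : R * E => z.2) g (nbhs (t, x)) (nbhs x));
  last exact: cg.
exact: cvg_snd.
Qed.

Lemma st_add g h : st_continuous T g -> st_continuous T h ->
  st_continuous T (fun t x => g t x + h t x).
Proof.
move=> [pg cg] [ph ch]; split; first by move=> t tT x i; rewrite pg// ph.
by move=> t x tT; exact: cvgD (cg t x tT) (ch t x tT).
Qed.

Lemma st_mul g h : st_continuous T g -> st_continuous T h ->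
  st_continuous T (fun t x => g t x * h t x).
Proof.
move=> [pg cg] [ph ch]; split; first by move=> t tT x i; rewrite pg// ph.
by move=> t x tT; exact: cvgM (cg t x tT) (ch t x tT).
Qed.

Lemma st_cst (c : R) : st_continuous T (fun _ _ => c).
Proof. exact/tc_st/tc_cst. Qed.

Lemma st_opp g : st_continuous T g -> st_continuous T (fun t x => - g t x).
Proof.
move=> [pg cg]; split; first by move=> t tT x i; rewrite pg.
by move=> t x tT; exact: cvgN (cg t x tT).
Qed.

Lemma st_sub g h : st_continuous T g -> st_continuous T h ->
  st_continuous T (fun t x => g t x - h t x).
Proof. by move=> cg /st_opp; exact: st_add. Qed.

Lemma st_sum (I : Type) (s : seq I) (g : I -> R -> E -> R) :
  (forall i, st_continuous T (g i)) ->
  st_continuous T (fun t x => \sum_(i <- s) g i t x).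
Proof.
move=> cg; elim: s => [|i s IH].
  by under eq_fun do under eq_fun do rewrite big_nil; exact: st_cst.
by under eq_fun do under eq_fun do rewrite big_cons; exact: st_add.
Qed.

(** By periodicity the values are those on a compact set, the closed cell times
    [[r, s]]. *)
Lemma st_bounded g (r s : R) : 0 < r -> s < T -> st_continuous T g ->
  exists M : R, forall t x, r <= t <= s -> `|g t x| <= M.
Proof.
move=> r0 sT [pg cg].
pose box : set E := [set v : E | forall i, `[0, 2 * pi]%classic (v ord0 i)].
pose K : set (R * E) := `[r, s]%classic `*` box.
have cK : compact K.
  apply: compact_setX; first exact: segment_compact.
  by apply: (@rV_compact _ _ (fun=> `[0, 2 * pi]%classic)) => _; exact: segment_compact.
pose G (z : R * E) := g z.1 z.2.
have cG : {within K, continuous G}.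
  apply: continuous_in_subspaceT => -[t x]; rewrite inE => -[/= + _].
  rewrite in_itv/= => /andP[rt ts]; apply: cg.
  by rewrite (lt_le_trans r0)//= (le_lt_trans ts).
have [M [_ hM]] := compact_bounded (continuous_compact cG cK).
exists (`|M| + 1) => t x /andP[rt ts].
have tT : 0 < t < T by rewrite (lt_le_trans r0)//= (le_lt_trans ts).
have [y [hy ey]] := periodic_reduce x.
rewrite (ey _ (g t)); last exact: pg.
apply: hM; first by rewrite (le_lt_trans (ler_norm M))// ltrDl.
exists (t, y) => //; split => /=; first by rewrite in_itv/= rt.
by move=> i; rewrite /= in_itv/=; have /andP[-> /ltW] := hy i.
Qed.

(** Evaluating at the clamped time turns a function that is only controlled on
    compact subintervals of [(0, T)] into one that is bounded and measurable on the
    whole space, without changing it on [[r, s]]. *)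
Definition clamp (r s t : R) : R := Num.max r (Num.min s t).

Lemma clamp_id (r s t : R) : r <= t <= s -> clamp r s t = t.
Proof.
move=> /andP[rt ts]; rewrite /clamp (min_idPr ts).
by apply/max_idPr.
Qed.

Lemma clamp_itv (r s t : R) : r <= s -> r <= clamp r s t <= s.
Proof. by move=> rs; rewrite /clamp le_max lexx/= ge_max rs/= ge_min lexx. Qed.

Lemma bm_st_clamp g (r s : R) : 0 < r -> r <= s -> s < T -> st_continuous T g ->
  bounded_measurable (fun z : MR * d.-tuple MR => g (clamp r s z.1) (pt z.2)).
Proof.
move=> r0 rs sT cg; split.
  apply: (@continuous_measurable_space_time _ d (fun z => g (clamp r s z.1) z.2)).
  move=> [t x]; have /andP[h1 h2] := clamp_itv t rs.
  have cT : 0 < clamp r s t < T by rewrite (lt_le_trans r0)//= (le_lt_trans h2).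
  apply: (@cvg_comp _ _ _ (fun z : R * E => (clamp r s z.1, z.2))
    (fun z : R * E => g z.1 z.2) (nbhs (t, x)) (nbhs (clamp r s t, x)));
    last by apply: cg.2.
  apply: (@cvg_pair _ _ _ _ (nbhs (clamp r s t)) (nbhs x)); last exact: cvg_snd.
  apply: (@cvg_comp _ _ _ (fun z : R * E => z.1) (clamp r s) (nbhs (t, x)) (nbhs t)).
    exact: cvg_fst.
  have cc (c : R) : {for t, continuous (fun _ : R => c : R^o)} by exact: cst_continuous.
  have ci : {for t, continuous (fun t : R => t : R^o)} by exact: cvg_id.
  exact: continuous_max (cc r) (continuous_min (cc s) ci).
have [M hM] := st_bounded r0 sT cg.
by exists M => z; apply: hM; exact: clamp_itv.
Qed.

Lemma bm_st g t : 0 < t < T -> st_continuous T g ->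
  bounded_measurable (fun x => g t (pt x)).
Proof.
move=> /andP[t0 tT] cg.
have := bm_pair1 (bm_st_clamp t0 (lexx t) tT cg) t.
by rewrite /= clamp_id// lexx.
Qed.

End SpaceTime.

Lemma bm_tc g : torus_continuous g -> bounded_measurable (fun x => g (pt x)).
Proof.
move=> cg; apply: (@bm_st 1 (fun=> g) (2^-1)); last exact: tc_st.
by apply/andP; split; lra.
Qed.

Definition tint (g : E -> R) : R := \int[torus_measure d]_x g (pt x).

Lemma tint_add g h : torus_continuous g -> torus_continuous h ->
  tint (fun x => g x + h x) = tint g + tint h.
Proof. by move=> cg ch; rewrite /tint bm_intD//; exact: bm_tc. Qed.

Lemma tint_sub g h : torus_continuous g -> torus_continuous h ->
  tint (fun x => g x - h x) = tint g - tint h.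
Proof. by move=> cg ch; rewrite /tint bm_intB//; exact: bm_tc. Qed.

Lemma tint_scale c g : torus_continuous g -> tint (fun x => c * g x) = c * tint g.
Proof. by move=> cg; rewrite /tint bm_intZ//; exact: bm_tc. Qed.

Lemma tint_sum (I : Type) (s : seq I) (g : I -> E -> R) :
  (forall i, torus_continuous (g i)) ->
  tint (fun x => \sum_(i <- s) g i x) = \sum_(i <- s) tint (g i).
Proof. by move=> cg; rewrite /tint bm_int_sum// => i; exact: bm_tc. Qed.

Lemma tint_le g h : torus_continuous g -> torus_continuous h ->
  (forall x, g x <= h x) -> tint g <= tint h.
Proof.
by move=> cg ch gh; apply: bm_int_le => //; exact: bm_tc.
Qed.

Lemma tint_ge0 g : (forall x, 0 <= g x) -> 0 <= tint g.
Proof. by move=> g0; exact: Rintegral_ge0. Qed.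

Lemma tint_norm g : torus_continuous g -> `|tint g| <= tint (fun x => `|g x|).
Proof. by move=> cg; apply: bm_int_norm; exact: bm_tc. Qed.

Lemma eq_tint g h : g =1 h -> tint g = tint h.
Proof. by move=> gh; apply: eq_Rintegral => x _. Qed.

Lemma pt_upd (x : d.-tuple MR) i (s : R) :
  pt (upd x i s) = pt (upd x i 0) + s *: basis i.
Proof.
apply/rowP => j; rewrite !mxE !tnth_upd eqxx/=.
by case: eqVneq => _; rewrite ?mulr1 ?mulr0 ?add0r ?addr0.
Qed.

(** Along each coordinate circle the fundamental theorem of calculus leaves a
    difference of two values that agree by periodicity. *)
Lemma tint_partial0 i g g' : torus_periodic g -> torus_continuous g' ->
  (forall x, is_derive x (basis i) (g : E -> R^o) (g' x)) -> tint g' = 0.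
Proof.
move=> pg cg' dg; have t0 := @tau_gt0 R.
apply: (mulfI (lt0r_neq0 t0)); rewrite mulr0 -(torus_int_upd i); last exact: bm_tc.
rewrite (_ : (fun x => _) = fun=> 0); first by rewrite Rintegral_cst// mul0r.
apply/funext => x; rewrite bm_int_mfrestr; last exact: (bm_upd i x (bm_tc cg')).
set x0 := pt (upd x i 0).
under eq_Rintegral do rewrite pt_upd.
transitivity (g (x0 + (2 * pi) *: basis i) - g (x0 + 0 *: basis i)); last first.
  by rewrite scale0r addr0 pg subrr.
apply: (@FTC_C1 _ (fun s => g (x0 + s *: basis i))
  (fun s => g' (x0 + s *: basis i))).
- exact: ltW.
- by move=> s _; apply: is_derive_line; exact: dg.
- move=> s _; apply: (@cvg_comp _ _ _ (fun s : R => x0 + s *: basis i) g' (nbhs s)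
    (nbhs (x0 + s *: basis i))).
    by apply: cvgD; [exact: cvg_cst|apply: cvgZr_tmp; exact: cvg_id].
  exact: cg'.2.
Qed.

Lemma tint_by_parts i g g' h h' :
  torus_continuous g -> torus_continuous g' ->
  torus_continuous h -> torus_continuous h' ->
  (forall x, is_derive x (basis i) (g : E -> R^o) (g' x)) ->
  (forall x, is_derive x (basis i) (h : E -> R^o) (h' x)) ->
  tint (fun x => g x * h' x) = - tint (fun x => g' x * h x).
Proof.
move=> cg cg' ch ch' dg dh; apply/eqP; rewrite -addr_eq0; apply/eqP.
rewrite -tint_add; [|exact: tc_mul..].
apply: (@tint_partial0 i (fun x => g x * h x)).
- by case: (tc_mul cg ch).
- by apply: tc_add; exact: tc_mul.
- move=> x; have H := is_deriveM (dg x) (dh x).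
  by apply: (is_derive_eq H); rewrite /GRing.scale/= [h x * _]mulrC.
Qed.

Section TimeIntegral.
Variable T : R.

Lemma st_time_continuous g x t : 0 < t < T -> st_continuous T g ->
  {for t, continuous (fun t => g t x)}.
Proof.
move=> tT [_ cg].
apply: (@cvg_comp _ _ _ (fun t : R => (t, x))
  (fun z : R * E => g z.1 z.2) (nbhs t) (nbhs (t, x))); last exact: cg.
apply: (@cvg_pair _ _ _ _ (nbhs t) (nbhs x)); [exact: cvg_id|exact: cvg_cst].
Qed.

Lemma tint_continuous g t : 0 < t < T -> st_continuous T g ->
  {for t, continuous (fun t => tint (g t))}.
Proof.
move=> /andP[t0 tT] cg.
pose u := t / 2; pose v := (t + T) / 2.
have u0 : 0 < u by rewrite divr_gt0.
have ut : u < t by rewrite /u; lra.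
have tv : t < v by rewrite /v; lra.
have vT : v < T by rewrite /v; lra.
have [M hM] := st_bounded u0 vT cg.
have sub s : `]u, v[%classic s -> 0 < s < T.
  by rewrite /= in_itv/= => /andP[us sv]; rewrite (lt_trans u0)//= (lt_trans sv).
have := @continuity_under_integral R _ _ (torus_measure d)
  (fun t x => g t (pt x)) setT measurableT u v _ _ (fun=> M).
apply.
- by move=> s /sub sT; apply: bm_integrable; exact: bm_st sT cg.
- by apply: aeW => /= x _ s; rewrite inE => /sub sT; exact: st_time_continuous.
- by apply: bm_integrable; exact: bm_cst.
- move=> s; rewrite /= in_itv/= => /andP[us sv]; apply: aeW => x _.
  by apply: hM; rewrite !ltW.
- by rewrite inE/= in_itv/= ut tv.
Qed.

Lemma tint_FTC g g' r s : 0 < r -> r <= s -> s < T ->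
  st_continuous T g -> st_continuous T g' ->
  (forall t x, 0 < t < T -> is_derive t 1 (fun t => g t x) (g' t x)) ->
  \int[lebesgue_measure]_(t in `[r, s]) tint (g' t) = tint (g s) - tint (g r).
Proof.
move=> r0 rs sT cg cg' dg.
have inT t : r <= t <= s -> 0 < t < T.
  by move=> /andP[rt ts]; rewrite (lt_le_trans r0)//= (le_lt_trans ts).
have bm := bm_st_clamp r0 rs sT cg'.
have mrs : measurable (`[r, s]%classic : set MR) by exact: measurable_itv.
have fin : (lebesgue_measure (`[r, s]%classic : set MR) < +oo)%E.
  by rewrite lebesgue_measure_itv/=; case: ifP => _; rewrite ltry.
have clampE t : t \in (`[r, s]%classic : set R) -> clamp r s t = t.
  by rewrite inE/= in_itv/=; exact: clamp_id.
transitivity (\int[lebesgue_measure]_(t in `[r, s])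
    \int[torus_measure d]_x g' (clamp r s t) (pt x)).
  by apply: eq_Rintegral => t ht; rewrite clampE.
rewrite -(bm_int_mfrestr mrs fin); last first.
  exact: (@bm_int1 _ _ _ _ R (mfrestr mrs fin) (torus_measure d) _ bm).
rewrite (@bm_fubini _ _ _ _ R (mfrestr mrs fin) (torus_measure d) _ bm).
have cgs : torus_continuous (g s) by apply: st_tc cg; rewrite (lt_le_trans r0).
have cgr : torus_continuous (g r) by apply: st_tc cg; rewrite r0 (le_lt_trans rs).
rewrite -tint_sub//.
apply: eq_Rintegral => x _.
rewrite bm_int_mfrestr; last exact: (bm_pair2 bm x).
transitivity (\int[lebesgue_measure]_(t in `[r, s]) g' t (pt x)).
  by apply: eq_Rintegral => t ht /=; rewrite clampE.
apply: (@FTC_C1 _ (fun t => g t (pt x)) (fun t => g' t (pt x))) => //.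
- by move=> t /inT; exact: dg.
- by move=> t /inT tT; exact: st_time_continuous.
Qed.

End TimeIntegral.

Lemma circle_int_indic (a e : R) : 0 <= a < 2 * pi -> 0 < e ->
  0 < \int[@circle_measure R]_s \1_(`[a, a + e[%classic : set MR) s.
Proof.
move=> /andP[a0 a2] e0.
pose b := Num.min (a + e) (2 * pi).
have ab : a < b by rewrite lt_min ltrDl e0.
rewrite /Rintegral integral_indic// setIT fine_gt0//.
pose A : set MR := `[a, a + e[%classic `&` `[0, 2 * pi]%classic.
change (0 < lebesgue_measure A < +oo)%E; rewrite /A.
apply/andP; split.
  apply: (@lt_le_trans _ _ (lebesgue_measure (`[a, b[%classic : set MR))).
    by rewrite lebesgue_measure_itv/= lte_fin ab -EFinB lte_fin subr_gt0.
  apply: le_measure; rewrite ?inE//; first exact: measurableI.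
  move=> s /=; rewrite !in_itv/= /b lt_min => /and3P[a1 -> /ltW ->].
  by rewrite a1 (le_trans a0 a1).
apply: (@le_lt_trans _ _ (lebesgue_measure (`[0, 2 * pi]%classic : set MR))).
  by apply: le_measure; rewrite ?inE//; exact: measurableI.
by rewrite lebesgue_measure_itv/=; case: ifP => _; rewrite ltry.
Qed.

Lemma bm_indic (A : set MR) : measurable A ->
  bounded_measurable (\1_A : MR -> R).
Proof.
move=> mA; split; first exact: measurable_indic.
by exists 1 => x; rewrite indicE; case: (_ \in _); rewrite ?normr1 ?normr0.
Qed.

Lemma torus_int_box n (y : n.-tuple R) (e : R) :
  (forall i, 0 <= tnth y i < 2 * pi) -> 0 < e ->
  0 < \int[@torus_measure R n]_x
    \prod_i \1_(`[tnth y i, tnth y i + e[%classic : set MR) (tnth x i).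
Proof.
move=> hy e0; elim: n y hy => [|n IH] y hy.
  under eq_Rintegral do rewrite big_ord0.
  by rewrite torus_int_cst expr0 mulr1.
have bi i : bounded_measurable (\1_(`[tnth y i, tnth y i + e[%classic) : MR -> R).
  exact: bm_indic.
rewrite torus_intS; last first.
  by apply: bm_prod => i; apply: bm_comp (bi i); exact: measurable_tnth.
pose y' := [tuple tnth y (lift ord0 i) | i < n].
have {IH} := IH y' (fun i => _); set J := (X in 0 < X) => J0.
have {}J0 : 0 < J by apply: J0 => i; rewrite tnth_mktuple.
rewrite [ltRHS](_ : _ = (\int[@circle_measure R]_s
   \1_(`[tnth y ord0, tnth y ord0 + e[%classic : set MR) s) * J).
  by rewrite mulr_gt0// circle_int_indic.
rewrite mulrC -bm_intZ//; apply: eq_Rintegral => s _.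
rewrite mulrC -bm_intZ; last first.
  apply: bm_prod => i; rewrite tnth_mktuple.
  by apply: bm_comp (bi _); exact: measurable_tnth.
apply: eq_Rintegral => z _; rewrite big_ord_recl tnth_tcons0; congr (_ * _).
by apply: eq_bigr => i _; rewrite tnth_mktuple tnth_tconsS.
Qed.

(** If [g] were positive at a point, it would be bounded below by a positive
    constant on a small box with its lower corner at the corresponding point of
    the half-open cell, and such a box meets the cell in positive measure. *)
Lemma tint_eq0 g : torus_continuous g -> (forall x, 0 <= g x) ->
  tint g = 0 -> forall x, g x = 0.
Proof.
move=> cg g0 ig x; apply/eqP; rewrite eq_le g0 andbT leNgt; apply/negP => gx.
have [y [hy ey]] := periodic_reduce x.
rewrite (ey _ g cg.1) in gx.
have := cg.2 y; move/cvgrPdist_lt => /(_ (g y / 2)).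
rewrite divr_gt0// => /(_ isT)/nbhs_ballP[e /= e0 he].
pose y' : d.-tuple R := [tuple y 0 i | i < d].
have J0 := @torus_int_box d y' e.
have {}J0 : 0 < \int[@torus_measure R d]_x
    \prod_i \1_(`[tnth y' i, tnth y' i + e[%classic : set MR) (tnth x i).
  by apply: J0 => // i; rewrite tnth_mktuple.
suff : 0 < tint g by rewrite ig ltxx.
have bP : bounded_measurable (fun x : d.-tuple MR =>
    \prod_i \1_(`[tnth y' i, tnth y' i + e[%classic : set MR) (tnth x i) : R).
  by apply: bm_prod => i; apply: bm_comp (bm_indic _) => //; exact: measurable_tnth.
apply: (@lt_le_trans _ _ ((g y / 2) * \int[@torus_measure R d]_x
    \prod_i \1_(`[tnth y' i, tnth y' i + e[%classic : set MR) (tnth x i))).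
  by rewrite mulr_gt0// divr_gt0.
rewrite -bm_intZ//; apply: bm_int_le.
- by apply: bm_mul => //; exact: bm_cst.
- exact: bm_tc.
move=> z.
have [/forallP hz|] := boolP [forall i, tnth z i \in `[tnth y' i, tnth y' i + e[].
  rewrite big1 => [|i _]; last by rewrite indicE mem_set//; exact: hz.
  rewrite mulr1; have : ball y e (pt z).
    rewrite -ball_normE /ball_/= /Num.norm/= mx_normrE; apply: bigmax_lt => //.
    move=> [i j] _ /=; rewrite !mxE ord1.
    have := hz j; rewrite tnth_mktuple in_itv/= => /andP[h1 h2].
    by rewrite ltr_norml; apply/andP; split; lra.
  by move=> /he; rewrite ltr_norml => /andP[h1 h2]; lra.
rewrite negb_forall => /existsP[i hi].
rewrite (bigD1 i)//= indicE memNset ?mul0r ?mulr0//.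
by move=> /= h; move: hi; rewrite h.
Qed.

End Periodic.

(** * The Sobolev inequality on the torus *)

Section Sobolev.
Context {R : realType}.
Local Notation MR := (measurableTypeR R).
Local Notation circ := (@circle_measure R).

Lemma itv_int_sub (g : R -> R) (a b : R) : 0 <= a -> a <= b -> b <= 2 * pi ->
  bounded_measurable (g : MR -> R) ->
  `|\int[lebesgue_measure]_(s in `[a, b]) g s| <= \int[circ]_s `|g s|.
Proof.
move=> a0 ab b2 bg.
have fin (D : set MR) : measurable D -> D `<=` `[0, 2 * pi] ->
    lebesgue_measure.-integrable D (EFin \o g).
  move=> mD Dsub; have [mg [M hM]] := bg.
  apply: measurable_bounded_integrable => //.
  - apply: (@le_lt_trans _ _ (lebesgue_measure (`[0, 2 * pi]%classic : set MR))).
      by apply: le_measure; rewrite ?inE.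
    by rewrite lebesgue_measure_itv/=; case: ifP => _; rewrite ltry.
  - exact: measurable_funS mg.
  - exists M; split; first exact: num_real.
    by move=> N MN x _; exact: le_trans (hM x) (ltW MN).
have sub : (`[a, b]%classic : set MR) `<=` `[0, 2 * pi].
  by apply: subset_itv; rewrite bnd_simp.
rewrite bm_int_mfrestr; last exact: bm_norm.
apply: (le_trans (le_normr_Rintegral _ _)); [exact: measurable_itv|exact: fin|].
rewrite /Rintegral fine_le//.
- apply: integrable_fin_num => //; apply: integrable_norm; exact: fin.
- apply: integrable_fin_num => //; apply: integrable_norm; exact: fin.
- apply: ge0_subset_integral => //.
  by apply/measurable_EFinP; apply: measurableT_comp => //; apply: measurable_funS bg.1.
Qed.

(** Two values of [g] differ by at most the integral of [|g'|]; averaging over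
    one of the two points replaces the value there by the mean. *)
Lemma circle_sup_le (g g' : R -> R) :
  bounded_measurable (g : MR -> R) -> bounded_measurable (g' : MR -> R) ->
  (forall (k : int) s, g (s + k%:~R * (2 * pi)) = g s) -> continuous g' ->
  (forall s : R, is_derive s 1 g (g' s)) ->
  forall s, g s <= (2 * pi)^-1 * \int[circ]_s g s + \int[circ]_s `|g' s|.
Proof.
move=> bg bg' pg cg' dg; have t0 := @tau_gt0 R.
set V := \int[circ]_s `|g' s|.
have key a b : 0 <= a <= 2 * pi -> 0 <= b <= 2 * pi -> g a <= g b + V.
  move=> /andP[a0 a2] /andP[b0 b2].
  have FTC x y : 0 <= x -> x <= y -> y <= 2 * pi -> `|g y - g x| <= V.
    move=> x0 xy y2.
    have <- : \int[lebesgue_measure]_(s in `[x, y]) g' s = g y - g x.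
      by apply: FTC_C1 => // s _; exact: cg'.
    exact: itv_int_sub.
  rewrite addrC -lerBlDr (le_trans (ler_norm _))//.
  by case/orP: (le_total a b) => ab; [rewrite distrC|]; exact: FTC.
have red s : exists2 s', 0 <= s' <= 2 * pi & g s = g s'.
  exists (s + (- Num.floor (s / (2 * pi)))%:~R * (2 * pi)); last by rewrite pg.
  have /andP[h1 h2] := floor_itv (s / (2 * pi)).
  move: h1 h2; rewrite intrD ler_pdivlMr// ltr_pdivrMr// intrN mulNr => h1 h2.
  by apply/andP; split; [lra|move: h2; rewrite mulrDl; lra].
have {}key a b : g a <= g b + V.
  by have [a' ha ->] := red a; have [b' hb ->] := red b; exact: key.
move=> s; rewrite -(ler_pM2l t0) [leRHS]mulrDr mulVKf ?gt_eqF//.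
rewrite mulrC -circle_int_cst [X in _ <= _ + X]mulrC -circle_int_cst -bm_intD//.
  apply: bm_int_le; [exact: bm_cst|apply: bm_add => //; exact: bm_cst|].
  by move=> b; exact: key.
exact: bm_cst.
Qed.

Lemma tc_powR d (S : 'rV[R]_d -> R) (a : R) : torus_continuous S ->
  (forall x, 0 < S x) -> torus_continuous (fun x => S x `^ a).
Proof.
move=> cS S0; apply: (tc_comp (f := fun y => y `^ a)) => // x.
apply/differentiable_continuous; rewrite -derivable1_diffP.
by have [] := @is_derive1_powR R a (S x) (S0 x).
Qed.

Lemma upd_upd n (x : n.-tuple MR) i s s' : upd (upd x i s) i s' = upd x i s'.
Proof. by apply: eq_from_tnth => j; rewrite !tnth_upd; case: eqP. Qed.

Lemma upd_id n (x : n.-tuple MR) i : upd x i (tnth x i) = x.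
Proof. by apply: eq_from_tnth => j; rewrite tnth_upd; case: eqP => [->|]. Qed.

Lemma coordinate_sup_le d i (h h' : 'rV[R]_d -> R) :
  torus_continuous h -> torus_continuous h' ->
  (forall x, is_derive x (basis i) (h : 'rV[R]_d -> R^o) (h' x)) ->
  forall x : d.-tuple MR, h (pt x) <=
    \int[circ]_s ((2 * pi)^-1 * h (pt (upd x i s)) + `|h' (pt (upd x i s))|).
Proof.
move=> ch ch' dh x.
have bu g : torus_continuous g -> bounded_measurable (fun s => g (pt (upd x i s))).
  by move=> cg; exact: (bm_upd i x (bm_tc cg)).
rewrite bm_intD; [|by apply: bm_mul; [exact: bm_cst|exact: bu]|exact/bm_norm/bu].
rewrite bm_intZ; last exact: bu.
rewrite -{1}(upd_id x i).
have E (g : 'rV[R]_d -> R) : (fun s => g (pt (upd x i s))) =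
    (fun s => g (pt (upd x i 0) + s *: basis i)).
  by apply/funext => s; rewrite pt_upd.
apply: (@circle_sup_le (fun s => h (pt (upd x i s))) (fun s => h' (pt (upd x i s)))).
- exact: bu.
- exact: bu.
- move=> k s; rewrite pt_upd [in RHS]pt_upd scalerDl addrA.
  by apply: periodic_int; exact: ch.1.
- rewrite E => s.
  apply: (@cvg_comp _ _ _ (fun s : R => pt (upd x i 0) + s *: basis i) h' (nbhs s)
    (nbhs (pt (upd x i 0) + s *: basis i))); last exact: ch'.2.
  by apply: cvgD; [exact: cvg_cst|apply: cvgZr_tmp; exact: cvg_id].
- by move=> s; rewrite E [pt (upd x i s)]pt_upd; apply: is_derive_line; exact: dh.
Qed.

Variable m : nat.
Let d := m.+3.
Local Notation E := 'rV[R]_d.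

Let D : R := d%:R.
Let D3 : 3 <= D. Proof. by rewrite /D ler_nat. Qed.

Lemma tint_cauchy_schwarz (f g : E -> R) (a b : R) :
  torus_continuous f -> torus_continuous g -> (forall x, 0 <= f x) ->
  0 < a -> 0 < b -> tint f <= a -> tint (fun x => g x ^+ 2) <= b ->
  tint (fun x => f x `^ 2^-1 * `|g x|) <= a `^ 2^-1 * b `^ 2^-1.
Proof.
move=> cf cg f0 a0 b0 fa gb.
have h2 : 0 < 2^-1 :> R by rewrite invr_gt0.
have := @bm_hoelder2 R _ _ (torus_measure d) 2^-1 2^-1 a b
  (fun x => f (pt x)) (fun x => g (pt x) ^+ 2) h2 h2.
rewrite (eq_tint (h := fun x => f x `^ 2^-1 * (g x ^+ 2) `^ 2^-1)).
  apply => //.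
  - by field.
  - exact: bm_tc.
  - by apply: (bm_tc (g := fun x => g x ^+ 2)); exact: tc_mul.
  - by move=> x; exact: sqr_ge0.
move=> x; have -> : g x ^+ 2 = `|g x| `^ 2%:R.
  by rewrite powR_mulrn ?normr_ge0// real_normK// num_real.
by rewrite -powRrM mulfV ?pnatr_eq0// powRr1.
Qed.

(** The argument of Gagliardo, for [S = |a|^2 + e] with [a] a vector field and
    [G i] the length of the derivative of [a] along [basis i]; the bound on [dS]
    is what these satisfy, and [S > 0] makes all powers of [S] differentiable.
    The power [h] of [S] is bounded by a function [F i] independent of the [i]-th
    coordinate, for each [i], so that the Loomis-Whitney inequality bounds the
    integral [P] of a power of [h] by the integrals of the [F i]. The
    Cauchy-Schwarz inequality bounds these by [Q], which contains the square root
    of [P]; the resulting power [ga] of [P] is less than one, so that it can be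
    absorbed in the left-hand side. *)
Lemma sobolev : exists2 C : R, 0 < C &
  forall (S : E -> R) (dS G : 'I_d -> E -> R) (e : R), 0 < e ->
    torus_continuous S -> (forall i, torus_continuous (dS i)) ->
    (forall i, torus_continuous (G i)) ->
    (forall x, e <= S x) ->
    (forall i x, is_derive x (basis i) (S : E -> R^o) (dS i x)) ->
    (forall i x, `|dS i x| <= 2 * (S x `^ 2^-1 * `|G i x|)) ->
    tint (fun x => S x `^ (D / (D - 2))) <=
      C * (tint S + \sum_i tint (fun x => G i x ^+ 2)) `^ (D / (D - 2)).
Proof.
have t0 := @tau_gt0 R.
have [CL CL0 LW] := @loomis_whitney R m.+1.
pose N : R := m.+2%:R.
have DN : D = N + 1 by rewrite /D /N natr1.
have ND : N = D - 1 by rewrite DN addrK.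
have N0 : 0 < N by rewrite ltr0n.
have D20 : 0 < D - 2 by move: D3; lra.
have D0 : 0 < D by move: D3; lra.
pose ka : R := N / (D - 2).
pose k2 : R := D / (D - 2).
have ka0 : 0 < ka by rewrite divr_gt0.
have k20 : 0 < k2 by rewrite divr_gt0.
pose K : R := 1 + (2 * pi) * (2 * ka).
have K0 : 0 < K by rewrite /K addr_gt0// mulr_gt0// mulr_gt0.
pose ga : R := D / (2 * N).
pose C1 : R := CL * K `^ (D / N).
have C10 : 0 < C1 by rewrite mulr_gt0// powR_gt0.
have ga1 : 0 < 1 - ga.
  rewrite /ga subr_gt0 ltr_pdivrMr ?mulr_gt0//.
  by move: D3; rewrite DN; lra.
exists (C1 `^ (1 - ga)^-1); first exact: powR_gt0.
move=> S dS G e e0 cS cdS cG eS dSE dSG.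
have S0 x : 0 < S x by exact: lt_le_trans (eS x).
pose h x := S x `^ ka.
pose dh i x := ka * S x `^ (ka - 1) * dS i x.
have ch : torus_continuous h by exact: tc_powR.
have cdh i : torus_continuous (dh i).
  apply: tc_mul => //; apply: tc_mul; [exact: tc_cst|exact: tc_powR].
have dhE i x : is_derive x (basis i) (h : E -> R^o) (dh i x).
  exact: (@is_derive_comp1 R _ S (fun y => y `^ ka) x (basis i) _ _ (dSE i x)
    (@is_derive1_powR R ka (S x) (S0 x))).
pose F i (x : d.-tuple MR) :=
  \int[circ]_s ((2 * pi)^-1 * h (pt (upd x i s)) + `|dh i (pt (upd x i s))|).
pose g i x := (2 * pi)^-1 * h x + `|dh i x|.
have cg i : torus_continuous (g i).
  by apply: tc_add; [apply: tc_mul => //; exact: tc_cst|exact: tc_norm].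
have bF i : bounded_measurable (F i).
  exact: (bm_int_upd i (bm_tc (cg i))).
have hF k x : h (pt x) <= F k x by exact: coordinate_sup_le.
have eF k x : e `^ ka <= F k x.
  apply: le_trans (hF k x).
  by apply: ge0_ler_powR; rewrite ?nnegrE ?eS// ltW.
have iF : forall (k : 'I_d) (x : d.-tuple MR) (s : MR), F k (upd x k s) = F k x.
  by move=> k x s; apply: eq_Rintegral => s' _; rewrite upd_upd.
pose H := tint S + \sum_i tint (fun x => G i x ^+ 2).
pose P := tint (fun x => S x `^ k2).
have sG k : 0 <= tint (fun x => G k x ^+ 2).
  by apply: tint_ge0 => x; exact: sqr_ge0.
have tS0 : 0 < tint S.
  apply: lt_le_trans (torus_int_ge (bm_tc cS) (fun x => eS (pt x))).
  by rewrite mulr_gt0// exprn_gt0.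
have H0 : 0 < H by rewrite /H ltr_pwDl// sumr_ge0.
have cSk : torus_continuous (fun x => S x `^ k2) by exact: tc_powR.
have P0 : 0 < P.
  have eP x : e `^ k2 <= S x `^ k2.
    by apply: ge0_ler_powR; rewrite ?nnegrE ?eS// ltW.
  apply: lt_le_trans (torus_int_ge (bm_tc cSk) (fun x => eP (pt x))).
  by rewrite mulr_gt0// ?exprn_gt0// powR_gt0.
pose Q := P `^ 2^-1 * H `^ 2^-1.
have kaE : k2 / 2 = ka - 2^-1.
  by rewrite /k2 /ka ND; field; rewrite gt_eqF.
have CS (f : E -> R) : torus_continuous f -> tint (fun x => f x ^+ 2) <= H ->
    tint (fun x => S x `^ (ka - 2^-1) * `|f x|) <= Q.
  move=> cf fH; rewrite (eq_tint (h := fun x => (S x `^ k2) `^ 2^-1 * `|f x|)).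
    by apply: tint_cauchy_schwarz => // x; exact: powR_ge0.
  by move=> x; rewrite -powRrM kaE.
have hQ : tint h <= Q.
  have cs : torus_continuous (fun x => S x `^ 2^-1) by exact: tc_powR.
  rewrite (eq_tint (h := fun x => S x `^ (ka - 2^-1) * `|S x `^ 2^-1|)).
    apply: CS => //; rewrite (eq_tint (h := S)).
      by rewrite /H lerDl sumr_ge0.
    move=> x; rewrite -powR_mulrn ?powR_ge0// -powRrM mulVf ?pnatr_eq0//.
    by rewrite powRr1// ltW.
  move=> x; rewrite ger0_norm ?powR_ge0// -powRD ?subrK//.
  by apply/implyP => _; rewrite gt_eqF.
have dhQ i : tint (fun x => `|dh i x|) <= 2 * ka * Q.
  apply: (@le_trans _ _ (2 * ka * tint (fun x => S x `^ (ka - 2^-1) * `|G i x|))).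
    rewrite -tint_scale; last first.
      by apply: tc_mul; [exact: tc_powR|exact: tc_norm].
    apply: tint_le; first exact: tc_norm.
      apply: tc_mul; first exact: tc_cst.
      by apply: tc_mul; [exact: tc_powR|exact: tc_norm].
    move=> x; rewrite /dh 2!normrM (gtr0_norm ka0) (ger0_norm (powR_ge0 _ _)).
    apply: (@le_trans _ _ (ka * S x `^ (ka - 1) * (2 * (S x `^ 2^-1 * `|G i x|)))).
      apply: ler_wpM2l; [by rewrite mulr_ge0 ?powR_ge0// ltW|exact: dSG].
    rewrite le_eqVlt; apply/orP; left; apply/eqP.
    have -> : ka - 2^-1 = (ka - 1) + 2^-1 by field.
    rewrite [in RHS]powRD; last by apply/implyP => _; rewrite gt_eqF.
    by ring.
  rewrite ler_wpM2l//; first by rewrite mulr_ge0// ltW.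
  apply: CS => //; rewrite /H (bigD1 i)//= addrCA lerDl addr_ge0 ?(ltW tS0)//.
  by rewrite sumr_ge0.
have Q0 : 0 < Q by rewrite mulr_gt0// powR_gt0.
have FQ i : \int[torus_measure d]_x F i x <= K * Q.
  rewrite (torus_int_upd i (bm_tc (cg i))).
  rewrite -/(tint (g i)) tint_add; last 2 first.
  - by apply: tc_mul => //; exact: tc_cst.
  - exact: tc_norm.
  rewrite tint_scale// [leLHS]mulrDr mulVKf ?gt_eqF// /K [leRHS]mulrDl mul1r.
  by apply: lerD => //; rewrite -[leRHS]mulrA; apply: ler_wpM2l; rewrite ?(ltW t0).
have Ppos : P <= C1 * (P * H) `^ ga.
  apply: (@le_trans _ _ (\int[torus_measure d]_x (\prod_i F i x `^ N^-1))).
    apply: bm_int_le; first exact: (bm_tc cSk).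
      apply: bm_prod => i; apply: bm_powR => //.
      by rewrite invr_ge0 ltW.
    move=> x; apply: (@le_trans _ _ (\prod_(i < d) h (pt x) `^ N^-1)).
      rewrite prodr_const card_ord -powR_mulrn ?powR_ge0// -powRrM /h -powRrM.
      suff -> : ka * (N^-1 * D) = k2 by [].
      by rewrite /ka /k2; field; rewrite !gt_eqF.
    apply: ler_prod => i _; rewrite powR_ge0/=.
    apply: ge0_ler_powR; rewrite ?nnegrE ?invr_ge0 ?(ltW N0)//.
      exact: powR_ge0.
    by rewrite (le_trans _ (hF i x))// powR_ge0.
  apply: (le_trans (LW F (e `^ ka) _ bF eF iF)); first exact: powR_gt0.
  rewrite /C1 -mulrA ler_pM2l//.
  apply: (@le_trans _ _ (\prod_(i < d) (K * Q) `^ N^-1)).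
    apply: ler_prod => i _; rewrite powR_ge0/=.
    apply: ge0_ler_powR; rewrite ?nnegrE ?invr_ge0 ?(ltW N0)//.
      by apply: Rintegral_ge0 => x _; rewrite (le_trans _ (eF i x))// powR_ge0.
    by rewrite mulr_ge0// ltW.
  rewrite prodr_const card_ord -powR_mulrn ?powR_ge0// -powRrM.
  rewrite powRM ?(ltW K0) ?(ltW Q0)// -/D [N^-1 * D]mulrC.
  rewrite ler_wpM2l ?powR_ge0// /Q -powRM ?(ltW P0) ?(ltW H0)//.
  rewrite -powRrM; suff -> : 2^-1 * (D / N) = ga by [].
  by rewrite /ga ND; field; apply: lt0r_neq0; move: D3; lra.
have Ple : P `^ (1 - ga) <= C1 * H `^ ga.
  have Pg : 0 < P `^ ga by rewrite powR_gt0.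
  rewrite -(ler_pM2r Pg) -powRD; last by apply/implyP => _; rewrite gt_eqF.
  rewrite subrK powRr1 ?(ltW P0)// -mulrA -powRM ?(ltW P0) ?(ltW H0)//.
  by rewrite [H * P]mulrC.
rewrite -/H -/k2 -/P.
have -> : P = (P `^ (1 - ga)) `^ (1 - ga)^-1.
  by rewrite -powRrM mulfV ?gt_eqF// powRr1// ltW.
have -> : k2 = ga * (1 - ga)^-1.
  rewrite /k2 /ga ND; field; repeat (apply/andP; split);
    by apply: lt0r_neq0; move: D3; lra.
rewrite powRrM -powRM ?powR_ge0 ?(ltW C10)//.
apply: ge0_ler_powR; rewrite ?nnegrE ?invr_ge0 ?(ltW ga1) ?powR_ge0//.
by rewrite mulr_ge0 ?powR_ge0// ltW.
Qed.

End Sobolev.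

(** * Multiplication from H^1 to L^2 *)

Section C1Fields.
Context {R : realType} {d : nat}.
Local Notation E := 'rV[R]_d.

(** The derivatives are carried as data, so that combinations of fields come with
    their derivatives in closed form. *)
Definition C1_field (a : 'I_d -> E -> R) (da : 'I_d -> 'I_d -> E -> R) : Prop :=
  [/\ forall i, torus_continuous (a i),
      forall j i, torus_continuous (da j i) &
      forall j i x, is_derive x (basis j) (a i : E -> R^o) (da j i x)].

Definition sqnorm (a : 'I_d -> E -> R) (x : E) : R := \sum_i a i x ^+ 2.

Definition energy (a : 'I_d -> E -> R) : R := tint (sqnorm a).

Definition dissipation (da : 'I_d -> 'I_d -> E -> R) : R :=
  tint (fun x => \sum_j sqnorm (da j) x).

Lemma sqnorm_ge0 a x : 0 <= sqnorm a x.
Proof. by apply: sumr_ge0 => i _; exact: sqr_ge0. Qed.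

Lemma tc_sqr (g : E -> R) : torus_continuous g ->
  torus_continuous (fun x => g x ^+ 2).
Proof. by move=> cg; exact: tc_mul. Qed.

Lemma tc_sqnorm a : (forall i, torus_continuous (a i)) ->
  torus_continuous (sqnorm a).
Proof. by move=> ca; apply: tc_sum => i; exact: tc_sqr. Qed.

Lemma energy_ge0 a : 0 <= energy a.
Proof. by apply: tint_ge0 => x; exact: sqnorm_ge0. Qed.

Lemma dissipation_ge0 da : 0 <= dissipation da.
Proof.
by apply: tint_ge0 => x; apply: sumr_ge0 => j _; exact: sqnorm_ge0.
Qed.

Lemma cauchy_schwarz_sum (I : finType) (a b : I -> R) :
  `|\sum_i a i * b i| <= (\sum_i a i ^+ 2) `^ 2^-1 * (\sum_i b i ^+ 2) `^ 2^-1.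
Proof.
have h0 (c : I -> R) : 0 <= \sum_i c i ^+ 2.
  by apply: sumr_ge0 => i _; exact: sqr_ge0.
set A := \sum_i a i ^+ 2; set B := \sum_i b i ^+ 2; set P := \sum_i a i * b i.
have hP : P ^+ 2 <= A * B.
  have [B0|B0] := eqVneq B 0.
    have b0 i : b i = 0.
      have /eqP := B0; rewrite psumr_eq0; last by move=> j _; exact: sqr_ge0.
      by move=> /allP/(_ i); rewrite mem_index_enum sqrf_eq0 => /(_ isT)/eqP.
    by rewrite /P big1 ?expr0n/= ?mulr_ge0 ?h0// => i _; rewrite b0 mulr0.
  have Bp : 0 < B by rewrite lt_neqAle eq_sym B0 h0.
  have : 0 <= \sum_i (B * a i - P * b i) ^+ 2 by exact: h0.
  rewrite (eq_bigr (fun i => B ^+ 2 * a i ^+ 2 - 2 * B * P * (a i * b i)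
      + P ^+ 2 * b i ^+ 2)); last by move=> i _; ring.
  rewrite big_split sumrB/= -!mulr_sumr -/A -/B -/P.
  rewrite (_ : _ + _ = B * (A * B - P ^+ 2)); last by ring.
  by rewrite pmulr_rge0// subr_ge0.
rewrite -powRM ?h0//.
have -> : `|P| = (P ^+ 2) `^ 2^-1.
  by rewrite powR12_sqrt ?sqr_ge0// sqrtr_sqr.
by apply: ge0_ler_powR; rewrite ?nnegrE ?invr_ge0 ?sqr_ge0 ?mulr_ge0 ?h0.
Qed.

End C1Fields.

Section Interpolation.
Context {R : realType}.
Variable m : nat.
Let d := m.+3.
Local Notation E := 'rV[R]_d.
Local Notation MR := (measurableTypeR R).
Let D : R := d%:R.
Let D3 : 3 <= D. Proof. by rewrite /D ler_nat. Qed.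

(** Hoelder's inequality with the weights [2 / q], [1 - D / q] and [(D - 2) / q]
    for [phi ^ q], [S] and the power of [S] in Sobolev's inequality leaves the
    factor [H ^ (D / q)], where [H] is the first term on the right; since
    [D / q < 1], the inequality of the means splits it off with coefficient one. *)
Lemma interpolation (q : R) : D < q -> exists2 C : R, 0 < C &
  forall (S : E -> R) (dS G : 'I_d -> E -> R) (e : R), 0 < e ->
    torus_continuous S -> (forall i, torus_continuous (dS i)) ->
    (forall i, torus_continuous (G i)) ->
    (forall x, e <= S x) ->
    (forall i x, is_derive x (basis i) (S : E -> R^o) (dS i x)) ->
    (forall i x, `|dS i x| <= 2 * (S x `^ 2^-1 * `|G i x|)) ->
  forall (phi : d.-tuple MR -> R) (N : R), 0 < N ->
    bounded_measurable phi -> (forall x, 0 <= phi x) ->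
    \int[torus_measure d]_x phi x `^ q <= N `^ q ->
    \int[torus_measure d]_x (S (pt x) * phi x ^+ 2) <=
      (tint S + \sum_i tint (fun x => G i x ^+ 2)) +
      C * N `^ (2 / (1 - D / q)) * tint S.
Proof.
move=> Dq; have [CS CS0 sob] := @sobolev R m.
have q0 : 0 < q by move: D3 Dq; lra.
pose th : R := D / q.
have th0 : 0 < th by rewrite divr_gt0//; move: D3; lra.
have th1 : 0 < 1 - th by rewrite subr_gt0 ltr_pdivrMr// mul1r.
have D20 : 0 < D - 2 by move: D3; lra.
pose ga : R := (D - 2) / q.
have ga0 : 0 < ga by rewrite divr_gt0.
pose k2 : R := D / (D - 2).
have k20 : 0 < k2 by rewrite divr_gt0//; move: D3; lra.
exists (CS `^ (ga / (1 - th))); first exact: powR_gt0.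
move=> S dS G e e0 cS cdS cG eS dSE dSG phi N N0 bphi phi0 phiN.
have S0 x : 0 < S x by exact: lt_le_trans (eS x).
set A := tint S; set H := A + _.
have A0 : 0 < A.
  apply: lt_le_trans (torus_int_ge (bm_tc cS) (fun x => eS (pt x))).
  by rewrite mulr_gt0// exprn_gt0// tau_gt0.
have H0 : 0 < H.
  by rewrite /H ltr_pwDl// sumr_ge0// => i _; apply: tint_ge0 => x; exact: sqr_ge0.
have {}sob := sob S dS G e e0 cS cdS cG eS dSE dSG.
have cSk : torus_continuous (fun x => S x `^ k2) by exact: tc_powR.
have bpq : bounded_measurable (fun x => phi x `^ q).
  by apply: bm_powR => //; exact: ltW.
have al0 : 0 < 2 / q by rewrite divr_gt0.
have al1 : 2 / q + (1 - th) + ga = 1 by rewrite /th /ga; field; rewrite gt_eqF.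
have Nq0 : 0 < N `^ q by rewrite powR_gt0.
have P0 : 0 < CS * H `^ k2 by rewrite mulr_gt0// powR_gt0.
have Hol := @bm_hoelder3 R _ _ (torus_measure d) _ _ _ _ _ _
  (fun x => phi x `^ q) (fun x => S (pt x)) (fun x => S (pt x) `^ k2)
  al0 th1 ga0 al1 Nq0 A0 P0 bpq (bm_tc cS) (bm_tc cSk)
  (fun x => powR_ge0 _ _) (fun x => ltW (S0 _)) (fun x => powR_ge0 _ _)
  phiN (lexx A) sob.
have E x : S (pt x) * phi x ^+ 2 = (phi x `^ q) `^ (2 / q) *
    (S (pt x) `^ (1 - th) * (S (pt x) `^ k2) `^ ga).
  rewrite -powRrM (_ : q * (2 / q) = 2); last by field; rewrite gt_eqF.
  rewrite powR_mulrn// mulrC; congr (_ * _).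
  rewrite -powRrM -powRD; last by apply/implyP => _; rewrite gt_eqF.
  rewrite (_ : 1 - th + k2 * ga = 1) ?powRr1 ?(ltW (S0 _))//.
  by rewrite /th /k2 /ga; field; rewrite !gt_eqF.
have {E} -> : (fun x => S (pt x) * phi x ^+ 2) = _ := funext E.
apply: (le_trans Hol).
pose X : R := CS `^ (ga / (1 - th)) * N `^ (2 / (1 - th)) * A.
have X0 : 0 < X by rewrite !mulr_gt0// powR_gt0.
rewrite -/X.
have := @weighted_amgm R bool (fun b => if b then th else 1 - th)
  (fun b => if b then H else X).
rewrite !big_bool/= => W.
apply: (@le_trans _ _ (H `^ th * X `^ (1 - th))).
  rewrite le_eqVlt; apply/orP; left; apply/eqP.
  rewrite /X !powRM ?mulr_ge0 ?powR_ge0 ?(ltW A0) ?(ltW CS0)// -!powRrM.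
  rewrite (_ : q * (2 / q) = 2); last by field; rewrite gt_eqF.
  rewrite (_ : ga / (1 - th) * (1 - th) = ga); last by field; rewrite gt_eqF.
  rewrite (_ : 2 / (1 - th) * (1 - th) = 2); last by field; rewrite gt_eqF.
  rewrite (_ : k2 * ga = th).
    by ring.
  by rewrite /th /k2 /ga; field; rewrite !gt_eqF.
apply: (le_trans (W _ _ _)).
- by case.
- by rewrite addrC subrK.
- by case; exact: ltW.
- rewrite lerD//.
  + by rewrite ler_piMl ?(ltW H0)//; move: th1; lra.
  + by rewrite ler_piMl ?(ltW X0)//; move: th0; lra.
Qed.

(** The interpolation inequality applies to [S = sqnorm a + e], whose derivatives
    are controlled by the Cauchy-Schwarz inequality, and [e] then tends to zero. *)
Lemma bilinear_bound_fin (q : R) : D < q -> exists2 C : R, 0 < C &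
  forall a da, C1_field a da ->
  forall (phi : d.-tuple MR -> R) (N : R), 0 <= N ->
    bounded_measurable phi -> (forall x, 0 <= phi x) ->
    \int[torus_measure d]_x phi x `^ q <= N `^ q ->
    \int[torus_measure d]_x (sqnorm a (pt x) * phi x ^+ 2) <=
      energy a + dissipation da + C * N `^ (2 / (1 - D / q)) * energy a.
Proof.
move=> Dq; have [C C0 itp] := interpolation Dq; exists C => //.
have q0 : 0 < q by move: D3 Dq; lra.
move=> a da [ca cda dae] phi N N0 bphi phi0 phiN.
have V0 : 0 < (2 * pi : R) ^+ d by rewrite exprn_gt0// tau_gt0.
set V := (2 * pi : R) ^+ d in V0.
set p := 2 / (1 - D / q).
have p0 : 0 < p by rewrite divr_gt0// subr_gt0 ltr_pdivrMr// mul1r.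
have ep e (N' : R) : 0 < e -> 0 < N' -> N <= N' ->
    \int[torus_measure d]_x (sqnorm a (pt x) * phi x ^+ 2) <=
    (energy a + e * V) + dissipation da + C * N' `^ p * (energy a + e * V).
  move=> e0 N'0 NN'.
  pose S x := sqnorm a x + e.
  pose dS j x := \sum_i 2 * (a i x * da j i x).
  pose G j x := Num.sqrt (sqnorm (da j) x).
  have cs := tc_sqnorm ca.
  have cS : torus_continuous S by apply: tc_add => //; exact: tc_cst.
  have cdS j : torus_continuous (dS j).
    by apply: tc_sum => i; apply: tc_mul; [exact: tc_cst|exact: tc_mul].
  have cG j : torus_continuous (G j).
    apply: (tc_comp (f := Num.sqrt)); first exact: tc_sqnorm.
    by move=> x; exact: sqrt_continuous.
  have GE j x : G j x ^+ 2 = sqnorm (da j) x by rewrite sqr_sqrtr// sqnorm_ge0.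
  have eS x : e <= S x by rewrite /S lerDr sqnorm_ge0.
  have dSE j x : is_derive x (basis j) (S : E -> R^o) (dS j x).
    have h i : is_derive x (basis j) (a i ^+ 2 : E -> R^o) (2 * (a i x * da j i x)).
      apply: (is_derive_eq (is_deriveX 2 (dae j i x))).
      by rewrite /GRing.scale/= expr1 mulrA.
    have := is_deriveD (is_derive_sum h) (is_derive_cst (e : R^o) x (basis j)).
    rewrite addr0; congr is_derive; apply/funext => y.
    by rewrite /S /sqnorm /= fct_sumE/= -[RHS]/(_ + _); congr (_ + _).
  have dSG j x : `|dS j x| <= 2 * (S x `^ 2^-1 * `|G j x|).
    rewrite /dS -mulr_sumr normrM ger0_norm// ler_wpM2l//.
    apply: (le_trans (cauchy_schwarz_sum _ _)).
    apply: ler_pM; rewrite ?powR_ge0//.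
      apply: ge0_ler_powR; rewrite ?nnegrE ?invr_ge0 ?sqnorm_ge0//.
        by rewrite (le_trans (ltW e0)).
      by rewrite /S lerDl ltW.
    by rewrite ger0_norm ?sqrtr_ge0// powR12_sqrt// sqnorm_ge0.
  have phiN' : \int[torus_measure d]_x phi x `^ q <= N' `^ q.
    by rewrite (le_trans phiN)//; apply: ge0_ler_powR; rewrite ?nnegrE// ltW.
  have := itp S dS G e e0 cS cdS cG eS dSE dSG phi N' N'0 bphi phi0 phiN'.
  have -> : tint S = energy a + e * V.
    rewrite /S tint_add//; last exact: tc_cst.
    by rewrite /tint torus_int_cst.
  have -> : \sum_i tint (fun x => G i x ^+ 2) = dissipation da.
    rewrite /dissipation tint_sum; last by move=> j; exact: tc_sqnorm.
    by apply: eq_bigr => j _; apply: eq_tint => x; exact: GE.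
  apply: le_trans; apply: bm_int_le.
  - by apply: bm_mul; [exact: (bm_tc cs)|exact: bm_mul].
  - by apply: bm_mul; [exact: (bm_tc cS)|exact: bm_mul].
  - by move=> x; rewrite ler_wpM2r ?sqr_ge0// /S lerDl ltW.
apply/ler_addgt0Pr => e e0.
have [N' [N'0 NN' hN']] : exists N' : R, [/\ 0 < N', N <= N' &
    C * N' `^ p * energy a <= C * N `^ p * energy a + e / 2].
  have [NE|NE] := eqVneq N 0.
    pose b := e / 2 / (C * (energy a + 1)).
    have E1 : 0 < energy a + 1 by rewrite ltr_wpDl// energy_ge0.
    have b0 : 0 < b by rewrite divr_gt0 ?mulr_gt0 ?invr_gt0.
    exists (b `^ p^-1); split; first exact: powR_gt0.
      by rewrite NE powR_ge0.
    rewrite NE powR0 ?gt_eqF// mulr0 mul0r add0r -powRrM mulVf ?gt_eqF//.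
    rewrite powRr1 ?(ltW b0)//.
    apply: (@le_trans _ _ (C * b * (energy a + 1))).
      by rewrite ler_wpM2l ?lerDl// mulr_ge0// ltW.
    by rewrite le_eqVlt; apply/orP; left; apply/eqP; rewrite /b; field;
      rewrite !gt_eqF.
  exists N; split => //; first by rewrite lt_neqAle eq_sym NE.
  by rewrite lerDl divr_ge0// ltW.
pose M := V * (1 + C * N' `^ p).
have M0 : 0 < M by rewrite mulr_gt0// ltr_pwDl// mulr_ge0 ?powR_ge0// ltW.
have e'0 : 0 < e / 2 / M by rewrite !divr_gt0.
apply: (le_trans (ep _ _ e'0 N'0 NN')).
have -> : energy a + e / 2 / M * V + dissipation da +
    C * N' `^ p * (energy a + e / 2 / M * V) =
    energy a + dissipation da + C * N' `^ p * energy a + (e / 2 / M) * M.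
  by rewrite /M; ring.
by rewrite divfK ?gt_eqF//; move: hN'; lra.
Qed.

End Interpolation.

(** * Components of smooth fields *)

Section SmoothFields.
Context {R : realType} {d : nat}.
Local Notation E := 'rV[R]_d.

(** The derivatives in space and time of [u t x] are directional derivatives of
    the function of [(t, x)], for which smoothness is assumed. *)
Lemma derive_slice_space (W : normedModType R) (G : R^o * E -> W) t x v :
  'D_v (fun y => G (t, y)) x = 'D_((0, v) : R^o * E) G (t, x).
Proof.
rewrite /derive; set F := (X in lim (X @ _) = _).
set F' := (X in _ = lim (X @ _)); suff -> : F = F' by [].
apply/funext => h; rewrite /F /F' /=; congr (_ *: (G _ - _)).
by rewrite /GRing.scale/= /GRing.add/= /add_pair/= scaler0 add0r.
Qed.

Lemma derive_slice_time (W : normedModType R) (G : R^o * E -> W) t x :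
  'D_1 (fun s : R => G (s, x)) t = 'D_((1, 0) : R^o * E) G (t, x).
Proof.
rewrite /derive; set F := (X in lim (X @ _) = _).
set F' := (X in _ = lim (X @ _)); suff -> : F = F' by [].
apply/funext => h; rewrite /F /F' /=; congr (_ *: (G _ - _)).
by rewrite /GRing.scale/= /GRing.add/= /add_pair/= scaler0 add0r.
Qed.

Lemma derivable_slice_space (W : normedModType R) (G : R^o * E -> W) t x v :
  derivable G (t, x) ((0, v) : R^o * E) -> derivable (fun y => G (t, y)) x v.
Proof.
rewrite /derivable; set F := (X in cvg (X @ _) -> _).
set F' := (X in _ -> cvg (X @ _)); suff -> : F = F' by [].
apply/funext => h; rewrite /F /F' /=; congr (_ *: (G _ - _)).
by rewrite /GRing.scale/= /GRing.add/= /add_pair/= scaler0 add0r.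
Qed.

Lemma derivable_slice_time (W : normedModType R) (G : R^o * E -> W) t x :
  derivable G (t, x) ((1, 0) : R^o * E) -> derivable (fun s : R => G (s, x)) t 1.
Proof.
rewrite /derivable; set F := (X in cvg (X @ _) -> _).
set F' := (X in _ -> cvg (X @ _)); suff -> : F = F' by [].
apply/funext => h; rewrite /F /F' /=; congr (_ *: (G _ - _)).
by rewrite /GRing.scale/= /GRing.add/= /add_pair/= scaler0 add0r.
Qed.

Lemma is_derive_coord (V : normedModType R) (g : V -> E) (x v : V) i :
  derivable g x v -> is_derive x v (fun y => g y 0 i : R^o) ('D_v g x 0 i).
Proof.
move=> dg; have dgi := (derivable_mxP g x v).1 dg 0 i.
by apply: DeriveDef => //; rewrite derive_mx// mxE.
Qed.

Lemma torus_periodic_derive (W : normedModType R) (g : E -> W) v :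
  torus_periodic g -> torus_periodic ('D_v g).
Proof.
move=> pg x i; rewrite /derive; set F := (X in lim (X @ _) = _).
set F' := (X in _ = lim (X @ _)); suff -> : F = F' by [].
by apply/funext => h; rewrite /F /F' /= addrA !pg.
Qed.

Section Components.
Variables (T : R) (u : R -> E -> E).
Hypothesis su : smooth_QT T u.
Let U (z : R^o * E) : E := u z.1 z.2.

Definition comp (u : R -> E -> E) i t x : R := u t x 0 i.
Definition dcomp (u : R -> E -> E) j i t x : R := 'D_(basis j) (u t) x 0 i.
Definition d2comp (u : R -> E -> E) k j i t x : R :=
  'D_(basis k) ('D_(basis j) (u t)) x 0 i.
Definition tcomp (u : R -> E -> E) i t x : R := 'D_1 (fun s : R => u s x) t 0 i.

Let space v : R^o * E := (0, v).
Let time : R^o * E := (1, 0).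

Let smoothU (s : seq (R^o * E)) t x : 0 < t < T ->
  {for (t, x), continuous (iter_derive s U)} /\
  forall v, derivable (iter_derive s U) (t, x) v.
Proof. by move=> tT; have [_ /(_ s (t, x) tT)] := su. Qed.

Let st_of (g : R^o * E -> E) (h : R -> E -> E) i :
  (forall t x, h t x = g (t, x)) ->
  (forall t, 0 < t < T -> torus_periodic (h t)) ->
  (forall t x, 0 < t < T -> {for (t, x), continuous g}) ->
  st_continuous T (fun t x => h t x 0 i).
Proof.
move=> hg ph cg; split; first by move=> t tT x j; rewrite ph.
move=> t x tT.
rewrite (_ : (fun z : R * E => h z.1 z.2 0 i) = (fun z : R * E => g z 0 i)).
  apply: (@cvg_comp _ _ _ (g : R * E -> E) (fun M : E => M 0 i) (nbhs (t, x))
    (nbhs (g (t, x)))); first exact: cg.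
  exact: coord_continuous.
by apply/funext => -[s y] /=; rewrite hg.
Qed.

Lemma st_comp i : st_continuous T (comp u i).
Proof.
apply: (@st_of U u i).
- by [].
- exact: su.1.
- by move=> t x tT; have [] := smoothU [::] x tT.
Qed.

Lemma st_dcomp j i : st_continuous T (dcomp u j i).
Proof.
apply: (@st_of (iter_derive [:: space (basis j)] U)
  (fun t x => 'D_(basis j) (u t) x) i).
- by move=> t x; rewrite /= -(@derive_slice_space _ U).
- by move=> t tT; apply: torus_periodic_derive; exact: su.1.
- by move=> t x tT; have [] := smoothU [:: space (basis j)] x tT.
Qed.

Let d1E t j : 'D_(basis j) (u t) =
  fun y => iter_derive [:: space (basis j)] U (t, y).
Proof. by apply/funext => y; rewrite /= -(@derive_slice_space _ U). Qed.

Lemma st_d2comp k j i : st_continuous T (d2comp u k j i).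
Proof.
apply: (@st_of (iter_derive [:: space (basis k); space (basis j)] U)
  (fun t x => 'D_(basis k) ('D_(basis j) (u t)) x) i).
- by move=> t x; rewrite d1E derive_slice_space.
- by move=> t tT; do 2 apply: torus_periodic_derive; exact: su.1.
- by move=> t x tT; have [] := smoothU [:: space (basis k); space (basis j)] x tT.
Qed.

Lemma st_tcomp i : st_continuous T (tcomp u i).
Proof.
have [pu _] := su; split.
  move=> t tT x j; rewrite /tcomp.
  have h y := derivable_slice_time ((smoothU [::] y tT).2 time).
  have E1 y : 'D_1 (fun s : R => u s y) t 0 i = 'D_1 (fun s : R => u s y 0 i : R^o) t.
    by have [_ ->] := @is_derive_coord R^o (fun s : R => u s y) t 1 i (h y).
  rewrite !E1.
  have N : \forall s \near t, u s (x + (2 * pi) *: basis j) 0 i = u s x 0 i.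
    have : \forall s \near t, s \in `]0, T[.
      by apply: near_in_itvoo; rewrite in_itv.
    by apply: filterS => s; rewrite in_itv/= => sT; rewrite pu.
  exact: near_eq_derive N.
move=> t x tT.
rewrite (_ : (fun z : R * E => tcomp u i z.1 z.2) =
    (fun z : R * E => iter_derive [:: time] U z 0 i)).
  apply: (@cvg_comp _ _ _ (iter_derive [:: time] U : R * E -> E)
    (fun M : E => M 0 i) (nbhs (t, x))
    (nbhs (iter_derive [:: time] U (t, x)))).
    by have [] := smoothU [:: time] x tT.
  exact: coord_continuous.
by apply/funext => -[s y] /=; rewrite /tcomp (@derive_slice_time _ U).
Qed.

Lemma is_derive_comp j i t x : 0 < t < T ->
  is_derive x (basis j) (comp u i t : E -> R^o) (dcomp u j i t x).
Proof.
move=> tT; apply: is_derive_coord.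
exact: (derivable_slice_space ((smoothU [::] x tT).2 (space (basis j)))).
Qed.

Lemma is_derive_dcomp k j i t x : 0 < t < T ->
  is_derive x (basis k) (dcomp u j i t : E -> R^o) (d2comp u k j i t x).
Proof.
move=> tT; apply: is_derive_coord; rewrite d1E.
exact: (derivable_slice_space
  ((smoothU [:: space (basis j)] x tT).2 (space (basis k)))).
Qed.

Lemma is_derive_tcomp i t x : 0 < t < T ->
  is_derive t 1 (fun s : R => comp u i s x) (tcomp u i t x).
Proof.
move=> tT; apply: (@is_derive_coord R^o (fun s : R => u s x) t 1 i).
exact: (derivable_slice_time ((smoothU [::] x tT).2 time)).
Qed.

Lemma C1_comp t : 0 < t < T -> C1_field (comp u ^~ t) (fun j i => dcomp u j i t).
Proof.
move=> tT; split.
- by move=> i; exact: st_tc tT (st_comp i).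
- by move=> j i; exact: st_tc tT (st_dcomp j i).
- by move=> j i x; exact: is_derive_comp.
Qed.

End Components.
End SmoothFields.

(** * The Navier-Stokes equations in weak form *)

Section NavierStokesIdentities.
Context {R : realType} {d : nat}.
Local Notation E := 'rV[R]_d.
Implicit Types a b c : 'I_d -> E -> R.
Implicit Types da db dc : 'I_d -> 'I_d -> E -> R.

Definition pairing a b : R := tint (fun x => \sum_i a i x * b i x).

Definition grad_pairing da db : R := tint (fun x => \sum_j \sum_i da j i x * db j i x).

(** [convection a db c] is the integral of ((a . grad) b) . c. *)
Definition convection a db c : R :=
  tint (fun x => \sum_j \sum_i a j x * db j i x * c i x).

Lemma C1_sub a da b db : C1_field a da -> C1_field b db ->
  C1_field (fun i x => a i x - b i x) (fun j i x => da j i x - db j i x).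
Proof.
move=> [ca cda dae] [cb cdb dbe]; split.
- by move=> i; exact: tc_sub.
- by move=> j i; exact: tc_sub.
- by move=> j i x; exact: is_deriveB (dae j i x) (dbe j i x).
Qed.

(** The sum of the two sides is the integral of [a] against the gradient of
    [b . c], which vanishes after integration by parts because [a] is
    divergence-free. *)
Lemma convection_antisym a da b db c dc :
  C1_field a da -> C1_field b db -> C1_field c dc ->
  (forall x, \sum_j da j j x = 0) ->
  convection a db c = - convection a dc b.
Proof.
move=> [ca cda dae] [cb cdb dbe] [cc cdc dce] diva.
pose h x := \sum_i b i x * c i x.
pose dh j x := \sum_i (b i x * dc j i x + c i x * db j i x).
have ch : torus_continuous h by apply: tc_sum => i; exact: tc_mul.
have cdh j : torus_continuous (dh j).
  by apply: tc_sum => i; apply: tc_add; exact: tc_mul.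
have dhE j x : is_derive x (basis j) (h : E -> R^o) (dh j x).
  have H i := is_deriveM (dbe j i x) (dce j i x).
  have := is_derive_sum H.
  congr is_derive; apply/funext => y.
  by rewrite /h fct_sumE.
apply/eqP; rewrite -addr_eq0 -tint_add; last 2 first.
- by apply: tc_sum => j; apply: tc_sum => i; apply: tc_mul => //; exact: tc_mul.
- by apply: tc_sum => j; apply: tc_sum => i; apply: tc_mul => //; exact: tc_mul.
rewrite (eq_tint (h := fun x => \sum_j a j x * dh j x)); last first.
  move=> x; rewrite -big_split/=; apply: eq_bigr => j _.
  rewrite -big_split/= mulr_sumr; apply: eq_bigr => i _; ring.
rewrite tint_sum; last by move=> j; exact: tc_mul.
rewrite (eq_bigr (fun j => - tint (fun x => da j j x * h x))); last first.
  by move=> j _; apply: tint_by_parts (dae j j) (dhE j).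
rewrite sumrN -tint_sum; last by move=> j; exact: tc_mul.
rewrite (eq_tint (h := fun=> 0)); last by move=> x; rewrite -mulr_suml diva mul0r.
by rewrite /tint Rintegral_cst// mul0r oppr0.
Qed.

Lemma convection_self0 a da b db : C1_field a da -> C1_field b db ->
  (forall x, \sum_j da j j x = 0) -> convection a db b = 0.
Proof.
move=> Ca Cb diva; have := convection_antisym Ca Cb Cb diva; lra.
Qed.

Lemma eq_coord4 (A B C G F : E) i : A - B + C + G = F ->
  A 0 i - B 0 i + C 0 i + G 0 i = F 0 i.
Proof. by move=> <-; rewrite !mxE. Qed.

(** The pressure gradient is orthogonal to divergence-free fields. It may be
    integrated by parts because the equation expresses it through continuous
    fields. *)
Lemma navier_stokes_weak (T : R) (u f : R -> E -> E) t phi dphi :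
  smooth_QT T u -> smooth_QT T f -> navier_stokes T u f -> 0 < t < T ->
  C1_field phi dphi -> (forall x, \sum_j dphi j j x = 0) ->
  pairing (tcomp u ^~ t) phi =
    - grad_pairing (fun j i => dcomp u j i t) dphi
    - convection (comp u ^~ t) (fun j i => dcomp u j i t) phi
    + pairing (comp f ^~ t) phi.
Proof.
move=> su sf [pr nse] tT Cphi divphi.
have [ppr eqn] := nse t tT.
have [cphi cdphi dphie] := Cphi.
have divu x : \sum_j dcomp u j j t x = 0 by have [_ _] := eqn x.
have cu i := st_tc tT (st_comp su i).
have cdu j i := st_tc tT (st_dcomp su j i).
have cd2u k j i := st_tc tT (st_d2comp su k j i).
have ctu i := st_tc tT (st_tcomp su i).
have cf i := st_tc tT (st_comp sf i).
pose dp i x := 'D_(basis i) (pr t : E -> R^o) x.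
have tens x i : div_tensor (u t) x 0 i = \sum_j comp u j t x * dcomp u j i t x.
  rewrite /div_tensor summxE.
  transitivity (\sum_j (comp u j t x * dcomp u j i t x +
      comp u i t x * dcomp u j j t x)); last first.
    by rewrite big_split/= -mulr_sumr divu mulr0 addr0.
  apply: eq_bigr => j _.
  have H k := is_deriveM (is_derive_comp su j j x tT) (is_derive_comp su j k x tT).
  have coordE l : (fun y : E => (u t y 0 j *: u t y) 0 l : R^o) =
      (comp u j t * comp u l t : E -> R^o).
    by apply/funext => y; rewrite mxE.
  have dv : derivable (fun y => u t y 0 j *: u t y) x (basis j).
    apply/derivable_mxP => k l; rewrite (ord1 k) coordE.
    by have [] := H l.
  have [_ <-] := is_derive_coord i dv; rewrite coordE.
  by have [_ ->] := H i.
have eqi x i : dp i x = comp f i t x - tcomp u i t x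
    + \sum_j d2comp u j j i t x - \sum_j comp u j t x * dcomp u j i t x.
  have [_ /(eq_coord4 i) + _] := eqn x; rewrite tens.
  have -> : laplacian (u t) x 0 i = \sum_j d2comp u j j i t x by exact: summxE.
  have -> : gradient (pr t) x 0 i = dp i x by rewrite mxE.
  have -> : (derive1 (fun s : R => u s x) t) 0 i = tcomp u i t x.
    by rewrite derive1E.
  by rewrite -/(comp f i t x) => <-; ring.
have cdp i : torus_continuous (dp i).
  rewrite (_ : dp i = fun x => comp f i t x - tcomp u i t x
    + \sum_j d2comp u j j i t x - \sum_j comp u j t x * dcomp u j i t x).
    apply: tc_sub; last by apply: tc_sum => j; exact: tc_mul.
    by apply: tc_add; [exact: tc_sub|exact: tc_sum].
  by apply/funext => x; exact: eqi.
have cpr : torus_continuous (pr t).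
  split => // x; apply: differentiable_continuous.
  by have [] := eqn x.
have dpe i x : is_derive x (basis i) (pr t : E -> R^o) (dp i x).
  by apply: DeriveDef => //; apply: diff_derivable; have [] := eqn x.
have press : pairing dp phi = 0.
  rewrite /pairing tint_sum; last by move=> i; exact: tc_mul.
  rewrite (eq_bigr (fun i => - tint (fun x => dphi i i x * pr t x))); last first.
    move=> i _; rewrite (eq_tint (h := fun x => phi i x * dp i x)).
      exact: tint_by_parts (dphie i i) (dpe i).
    by move=> x; rewrite mulrC.
  rewrite sumrN -tint_sum; last by move=> j; exact: tc_mul.
  rewrite (eq_tint (h := fun=> 0)); last first.
    by move=> x; rewrite -mulr_suml divphi mul0r.
  by rewrite /tint Rintegral_cst// mul0r oppr0.
have visc : tint (fun x => \sum_i (\sum_j d2comp u j j i t x) * phi i x) =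
    - grad_pairing (fun j i => dcomp u j i t) dphi.
  rewrite (eq_tint (h := fun x => \sum_j \sum_i d2comp u j j i t x * phi i x)); last first.
    move=> x; rewrite exchange_big/=; apply: eq_bigr => i _.
    by rewrite mulr_suml.
  rewrite tint_sum; last by move=> j; apply: tc_sum => i; exact: tc_mul.
  rewrite /grad_pairing tint_sum; last by move=> j; apply: tc_sum => i; exact: tc_mul.
  rewrite -sumrN; apply: eq_bigr => j _.
  rewrite tint_sum; last by move=> i; exact: tc_mul.
  rewrite tint_sum; last by move=> i; exact: tc_mul.
  rewrite -sumrN; apply: eq_bigr => i _.
  have dd x := is_derive_dcomp su j j i x tT.
  rewrite (tint_by_parts (cdu j i) (cd2u j j i) (cphi i) (cdphi j i) dd (dphie j i)).
  by rewrite opprK.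
pose V x := \sum_i (\sum_j d2comp u j j i t x) * phi i x.
pose C x := \sum_j \sum_i comp u j t x * dcomp u j i t x * phi i x.
pose F x := \sum_i comp f i t x * phi i x.
pose P x := \sum_i dp i x * phi i x.
have cV : torus_continuous V.
  by apply: tc_sum => i; exact: (tc_mul (tc_sum _ (fun j => cd2u j j i)) (cphi i)).
have cC : torus_continuous C.
  by apply: tc_sum => j; apply: tc_sum => i;
    exact: (tc_mul (tc_mul (cu j) (cdu j i)) (cphi i)).
have cF : torus_continuous F.
  by apply: tc_sum => i; exact: (tc_mul (cf i) (cphi i)).
have cP : torus_continuous P.
  by apply: tc_sum => i; exact: (tc_mul (cdp i) (cphi i)).
transitivity (tint (fun x => ((V x - C x) + F x) - P x)).
  apply: eq_tint => x; rewrite /V /C /F /P exchange_big/=.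
  rewrite -sumrB -big_split/= -sumrB; apply: eq_bigr => i _.
  by rewrite eqi -mulr_suml; ring.
have cVC := tc_sub cV cC; have cVCF := tc_add cVC cF.
by rewrite tint_sub// tint_add// tint_sub// [tint V]visc [tint P]press subr0.
Qed.

End NavierStokesIdentities.

(** * Multiplication by a field in the critical Lebesgue space *)

Section BilinearBound.
Context {R : realType}.
Local Notation MR := (measurableTypeR R).

Section NormL.
Context {d : nat}.
Local Notation E := 'rV[R]_d.
Local Notation mu := (@torus_measure R d).

Lemma normL_fin (q : R) (g : E -> E) : 1 <= q ->
  torus_continuous (fun x => enorm (g x)) ->
  \int[mu]_x enorm (g (pt x)) `^ q = fine (normL q%:E g) `^ q.
Proof.
move=> q1 cg; have q0 : 0 < q by exact: lt_le_trans q1.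
have bg : bounded_measurable (fun x => enorm (g (pt x)) `^ q).
  by apply: bm_powR; [exact: ltW|exact: (bm_tc cg)].
rewrite /normL unlock /Lnorm.
under eq_integral => x _.
  rewrite /= ger0_norm ?sqrtr_ge0//; over.
rewrite bm_int_EFin// poweR_EFin/= -powRrM mulVf ?gt_eqF// powRr1//.
by apply: Rintegral_ge0 => x _; exact: powR_ge0.
Qed.

(** The excess of the norm of [g] over its essential supremum is continuous and
    nonnegative, and its integral is zero. *)
Lemma normL_infty (g : E -> E) :
  torus_continuous (fun x => enorm (g x)) ->
  forall x, enorm (g x) <= fine (normL +oo%E g).
Proof.
move=> cg; have bg := bm_tc cg; have [mg [M hM]] := bg.
pose f (x : d.-tuple MR) := (enorm (g (pt x)))%:E.
have N0 : (0 <= normL +oo%E g)%E by exact: Lnorm_ge0.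
have muT : (0 < mu setT)%E.
  have h := @torus_int_cst R d 1.
  have t0 : 0 < (2 * pi : R) ^+ d by rewrite exprn_gt0// tau_gt0.
  rewrite lt0e measure_ge0 andbT; apply/eqP => mu0.
  move: h; rewrite Rintegral_cst// (congr1 fine mu0 : fine _ = 0) mulr0 mul1r.
  by move=> /esym/eqP; rewrite gt_eqF.
have NE : normL +oo%E g = ess_sup mu (abse \o f).
  by rewrite /normL unlock /Lnorm ifT.
have Nfin : normL +oo%E g \is a fin_num.
  rewrite ge0_fin_numE// NE; apply: (@le_lt_trans _ _ M%:E); last exact: ltry.
  by apply/ess_supP; apply: aeW => x /=; rewrite lee_fin.
set N := fine _.
have ae : {ae mu, forall x, enorm (g (pt x)) <= N}.
  have := ess_sup_ge mu (abse \o f).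
  apply: filterS => x /=; rewrite -NE -[X in (_ <= X)%E -> _]fineK// lee_fin.
  exact: le_trans (ler_norm _).
pose h x := Num.max (enorm (g x) - N) 0.
have ch : torus_continuous h.
  have c1 := tc_sub cg (tc_cst N).
  split; first by move=> x i; rewrite /h c1.1.
  move=> x; apply: (@continuous_max R _ (fun x : E => (enorm (g x) - N) : R^o)
    (fun=> 0 : R^o)); first exact: c1.2.
  exact: cst_continuous.
have h0 x : 0 <= h x by rewrite /h le_max lexx orbT.
have ih : tint h = 0.
  rewrite /tint /Rintegral (_ : (\int[mu]_x _)%E = 0%E)//.
  transitivity (\int[mu]_(x in setT) (cst 0%E x))%E; last by rewrite integral0.
  apply: ae_eq_integral => //.
  - by apply/measurable_EFinP; exact: (bm_tc ch).1.
  - apply: filterS ae => x hx _ /=; congr EFin.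
    by apply/max_idPr; rewrite subr_le0.
move=> x; have := tint_eq0 ch h0 ih x; rewrite /h => /eqP.
by rewrite eq_le => /andP[+ _]; rewrite ge_max lexx andbT subr_le0.
Qed.

End NormL.

Section Bound.
Variable m : nat.
Let d := m.+3.
Local Notation E := 'rV[R]_d.

(** The relation between [p] and [q] makes [p] the exponent [2 / (1 - d / q)] of
    the interpolation inequality; when [q] is infinite, [p = 2] and the bound
    holds pointwise. *)
Lemma bilinear_bound (p q : \bar R) : (1 <= p < +oo)%E -> (1 <= q)%E ->
  (2%:E / p + d%:R%:E / q = 1)%E ->
  exists2 C : R, 0 < C &
  forall g : E -> E, torus_continuous (fun x => enorm (g x)) ->
  forall a da, C1_field a da ->
    tint (fun x => sqnorm a x * enorm (g x) ^+ 2) <=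
    energy a + dissipation da + C * fine (normL q g) `^ fine p * energy a.
Proof.
case: p => [p| |] /andP[p1 p2] //.
have {}p1 : 1 <= p by rewrite -lee_fin.
have p0 : 0 < p by exact: lt_le_trans p1.
case: q => [q|_|//].
  rewrite lee_fin => q1; have q0 : 0 < q by exact: lt_le_trans q1.
  rewrite !inver !gt_eqF// -!EFinM -EFinD => -[pq].
  have dq : d%:R < q.
    have p20 : 0 < 2 / p by rewrite divr_gt0.
    have : d%:R / q < 1 by move: pq p20; lra.
    by rewrite ltr_pdivrMr// mul1r.
  have [C C0 hC] := @bilinear_bound_fin R m q dq.
  exists C => // g cg a da Ca.
  have := hC a da Ca (fun x => enorm (g (pt x))) (fine (normL q%:E g)).
  have -> : 2 / (1 - d%:R / q) = p.
    have -> : 1 - d%:R / q = 2 / p by move: pq; lra.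
    by field; rewrite gt_eqF.
  apply.
  - by apply: fine_ge0; exact: Lnorm_ge0.
  - exact: (bm_tc cg).
  - by move=> x; exact: sqrtr_ge0.
  - by rewrite normL_fin.
rewrite invey mule0 adde0 inver gt_eqF// -EFinM => -[pE].
have p2e : p = 2.
  by have := congr1 ( *%R^~ p) pE; rewrite /= divfK ?gt_eqF// mul1r.
exists 1 => // g cg a da Ca; have [ca cda _] := Ca.
rewrite p2e/= mul1r powR_mulrn; last by apply: fine_ge0; exact: Lnorm_ge0.
apply: (@le_trans _ _ (fine (normL +oo%E g) ^+ 2 * energy a)); last first.
  by rewrite lerDr addr_ge0// ?energy_ge0 ?dissipation_ge0.
rewrite /energy -tint_scale; last exact: tc_sqnorm.
apply: tint_le.
- by apply: tc_mul; [exact: tc_sqnorm|exact: tc_sqr].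
- by apply: tc_mul; [exact: tc_cst|exact: tc_sqnorm].
- move=> x; rewrite mulrC ler_wpM2r ?sqnorm_ge0//.
  have gN := normL_infty cg x.
  by rewrite ler_sqr ?nnegrE ?sqrtr_ge0// (le_trans _ gN)// sqrtr_ge0.
Qed.

End Bound.
End BilinearBound.

(** * Integrable functions near time zero *)

Section TimeLemmas.
Context {R : realType}.
Local Notation mu := (@lebesgue_measure R).
Local Notation MR := (measurableTypeR R).

Lemma small_integral (b : R -> R) (e : R) : mu.-integrable setT (EFin \o b) ->
  (forall t, 0 <= b t) -> 0 < e ->
  exists2 h : R, 0 < h & forall A : set MR, measurable A -> (mu A < h%:E)%E ->
    \int[mu]_(t in A) b t < e.
Proof.
move=> ib b0 e0; have [h [h0 hA]] := integral_normr_continuous ib e0.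
exists h => // A mA /(hA _ mA); congr (_ < _).
by apply: eq_Rintegral => t _; rewrite ger0_norm.
Qed.

(** Otherwise [b s >= 1 / s >= 1 / z] for [z / 2 < s < z] and all small [z], so
    that the integral of [b] over this interval would be at least [1 / 2], however
    small [z] is. *)
Lemma small_times (b : R -> R) : mu.-integrable setT (EFin \o b) ->
  (forall t, 0 <= b t) ->
  forall eta : R, 0 < eta -> exists2 s : R, 0 < s < eta & s * b s <= 1.
Proof.
move=> ib b0 eta eta0.
have half0 : 0 < 2^-1 :> R by rewrite invr_gt0.
have [h h0 hA] := small_integral ib b0 half0.
pose z := Num.min eta h.
have z0 : 0 < z by rewrite lt_min eta0.
apply: contrapT => hn.
have bz s : z / 2 < s < z -> z^-1 <= b s.
  move=> /andP[s1 s2].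
  have s0 : 0 < s by rewrite (lt_trans _ s1)// divr_gt0.
  rewrite leNgt; apply/negP => bs; apply: hn; exists s.
    by rewrite s0/= (lt_le_trans s2)// ge_min lexx.
  rewrite (@le_trans _ _ (s * z^-1))//; first by rewrite ler_wpM2l ?ltW.
  by rewrite ler_pdivrMr// mul1r ltW.
pose A : set MR := `]z / 2, z[%classic.
have zz : z / 2 < z by rewrite ltr_pdivrMr// ltr_pMr// ltrDl.
have muA : mu A = (z / 2)%:E.
  by rewrite /A lebesgue_measure_itv/= lte_fin zz -EFinB; congr EFin; field.
have mA : measurable A by exact: measurable_itv.
have : \int[mu]_(t in A) b t < 2^-1.
  by apply: hA => //; rewrite muA lte_fin (lt_le_trans zz)// ge_min lexx orbT.
rewrite ltNge => /negP; apply.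
have -> : 2^-1 = \int[mu]_(t in A) z^-1.
  by rewrite Rintegral_cst// (congr1 fine muA : fine _ = z / 2); field; rewrite gt_eqF.
apply: le_Rintegral => //.
- apply: measurable_bounded_integrable => //.
  + by rewrite [X in (X < _)%E]muA ltry.
  + exact: bounded_cst.
- exact: integrableS ib.
Qed.

(** On an interval where the integral of [b] is less than [1 / 2], the inequality
    at the maximum point of [y] gives [y s <= 2 * y r]. Starting from the small
    values of [y] near time zero, [y] vanishes up to a time that depends on [b]
    only, and then on successive intervals of that length. *)
Lemma gronwall_zero (T : R) (y b : R -> R) :
  mu.-integrable setT (EFin \o b) -> (forall t, 0 <= b t) ->
  (forall t, 0 < t < T -> 0 <= y t) ->
  (forall t, 0 < t < T -> {for t, continuous y}) ->
  (forall r s M : R, 0 < r -> r <= s -> s < T ->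
    (forall t, r <= t <= s -> y t <= M) ->
    y s <= y r + M * \int[mu]_(t in `[r, s]) b t) ->
  (forall eps eta : R, 0 < eps -> 0 < eta ->
    exists2 s, 0 < s < eta & y s <= eps) ->
  forall t, 0 < t < T -> y t = 0.
Proof.
move=> ib b0 y0 cy hy small.
have half0 : 0 < 2^-1 :> R by rewrite invr_gt0.
have [h h0 hA] := small_integral ib b0 half0.
have step r s : 0 < r -> r <= s -> s < T -> s - r < h -> y s <= 2 * y r.
  move=> r0 rs sT srh.
  have inT t : r <= t <= s -> 0 < t < T.
    by move=> /andP[rt ts]; rewrite (lt_le_trans r0)//= (le_lt_trans ts).
  have cw : {within `[r, s], continuous y}.
    apply: continuous_in_subspaceT => t; rewrite inE/= in_itv/= => /inT; exact: cy.
  have [c] := EVT_max rs cw; rewrite in_itv/= => /andP[rc cs] hc.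
  have intb : \int[mu]_(t in `[r, c]) b t < 2^-1.
    apply: hA; first exact: measurable_itv.
    rewrite lebesgue_measure_itv/=; case: ifP => _; last by rewrite lte_fin.
    by rewrite -EFinB lte_fin (le_lt_trans _ srh)// lerB.
  have yc0 : 0 <= y c by apply: y0; apply: inT; rewrite rc.
  have ys : y s <= y c by apply: hc; rewrite in_itv/= rs lexx.
  have := hy r c (y c) r0 rc (le_lt_trans cs sT).
  have mle t : r <= t <= c -> y t <= y c.
    by move=> /andP[rt tc]; apply: hc; rewrite in_itv/= rt (le_trans tc).
  move=> /(_ mle); have := ler_wpM2l yc0 (ltW intb); lra.
have zero n t : 0 < t < T -> t <= n%:R * (h / 2) -> y t = 0.
  elim: n t => [|n IH] t tT; first by rewrite mul0r leNgt; case/andP: tT => ->.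
  move=> tn; have /andP[t0 tT'] := tT.
  apply/eqP; rewrite eq_le y0// andbT.
  have [th|th] := leP t (h / 2).
    apply/ler_addgt0Pr => e e0; rewrite add0r.
    have [s /andP[s0 st] ys] := small (e / 2) t (divr_gt0 e0 (ltr0Sn _ _)) t0.
    by have := step s t s0 (ltW st) tT' _; lra.
  have s0 : 0 < t - h / 2 by rewrite subr_gt0.
  have := step (t - h / 2) t s0 _ tT' _.
  rewrite (IH (t - h / 2)) ?mulr0.
  - by apply; lra.
  - by rewrite s0/=; lra.
  - by move: tn; rewrite -natr1 mulrDl mul1r; lra.
move=> t tT; have h20 : 0 < h / 2 by rewrite divr_gt0.
apply: (zero (Num.truncn (t / (h / 2))).+1) => //.
by rewrite -ler_pdivrMr// ltW// truncnS_gt.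
Qed.

End TimeLemmas.

(** * Functions on the open time interval *)

Section OpenInterval.
Context {R : realType}.
Local Notation mu := (@lebesgue_measure R).
Local Notation MR := (measurableTypeR R).
Variable T : R.
Hypothesis T0 : 0 < T.
Local Notation I := (`]0, T[%classic : set R).

Let F (n : nat) : set MR := `[T / n.+3%:R, T - T / n.+3%:R]%classic.

Let ndF : nondecreasing_seq F.
Proof.
move=> n k nk; rewrite subsetEset; apply: subset_itv; rewrite bnd_simp.
  by rewrite ler_pM2l// lef_pV2 ?posrE ?ltr0n// ler_nat !ltnS.
by rewrite lerB// ler_pM2l// lef_pV2 ?posrE ?ltr0n// ler_nat !ltnS.
Qed.

Let bigcupF : \bigcup_n F n = I.
Proof.
apply/seteqP; split => t.
  move=> [n _]; rewrite /F/= !in_itv/= => /andP[h1 h2].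
  have h : 0 < T / n.+3%:R by rewrite divr_gt0// ltr0n.
  by rewrite (lt_le_trans h h1)/= (le_lt_trans h2)// gtrBl.
rewrite /= in_itv/= => /andP[t0 tT].
pose z := Num.min t (T - t).
have z0 : 0 < z by rewrite lt_min t0 subr_gt0.
exists (Num.truncn (T / z)) => //.
have h : T / (Num.truncn (T / z)).+3%:R <= z.
  rewrite ler_pdivrMr ?ltr0n// mulrC -ler_pdivrMr//.
  by rewrite (le_trans (ltW (truncnS_gt _)))// ler_nat ltnS -addn2 leq_addr.
rewrite /F/= in_itv/=; apply/andP; split.
  by rewrite (le_trans h)// ge_min lexx.
have zT : z <= T - t by rewrite ge_min lexx orbT.
by rewrite lerBrDl -lerBrDr (le_trans h).
Qed.

Lemma measurable_fun_itvoo (k : R -> R) :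
  (forall r s, 0 < r -> r <= s -> s < T -> measurable_fun (`[r, s]%classic : set MR) k) ->
  measurable_fun (I : set MR) k.
Proof.
move=> hk; rewrite -bigcupF.
apply/(measurable_fun_bigcup _ _).2; first by move=> n; exact: measurable_itv.
move=> n; have h : 0 < T / n.+3%:R by rewrite divr_gt0// ltr0n.
have h3 : T / n.+3%:R <= T / 3 by rewrite ler_pM2l// lef_pV2 ?posrE ?ltr0n// ler_nat.
rewrite /F; set z := T / n.+3%:R in h h3 *.
by apply: hk => //; [move: h3 T0; lra|rewrite gtrBl].
Qed.

Lemma continuous_measurable_itvoo (k : R -> R) :
  (forall t, 0 < t < T -> {for t, continuous k}) ->
  measurable_fun (I : set MR) k.
Proof.
move=> ck; apply: open_continuous_measurable_fun; first exact: itv_open.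
by move=> t; rewrite inE/= in_itv/=; exact: ck.
Qed.

Lemma integrable_patch (k : R -> R) : measurable_fun (I : set MR) k ->
  (forall t, 0 < t < T -> 0 <= k t) ->
  (\int[mu]_(t in I) (k t)%:E < +oo)%E ->
  mu.-integrable setT (EFin \o (k \_ I)).
Proof.
move=> mk k0 kfin; rewrite -restrict_EFin.
apply/integrable_restrict => //; rewrite setTI; apply/integrableP; split.
  exact/measurable_EFinP.
apply: le_lt_trans kfin; rewrite le_eqVlt; apply/orP; left; apply/eqP.
apply: eq_integral => t; rewrite inE/= in_itv/= => tT.
by rewrite ger0_norm// k0.
Qed.

Lemma patch_ge0 (k : R -> R) : (forall t, 0 < t < T -> 0 <= k t) ->
  forall t, 0 <= (k \_ I) t.
Proof.
move=> k0 t; rewrite patchE; case: ifPn => //.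
by rewrite inE/= in_itv/=; exact: k0.
Qed.

(** Monotone convergence along the compact intervals [F n], which exhaust the open
    one; the bound concerns only intervals that come close to both ends. *)
Lemma integrable_patch_bounded (k : R -> R) (K r0 s0 : R) : 0 < r0 -> s0 < T ->
  (forall t, 0 < t < T -> {for t, continuous k}) ->
  (forall t, 0 < t < T -> 0 <= k t) ->
  (forall r s, 0 < r -> r < r0 -> s0 < s -> s < T -> r <= s ->
     \int[mu]_(t in `[r, s]) k t <= K) ->
  mu.-integrable setT (EFin \o (k \_ I)).
Proof.
move=> r00 s0T ck k0 hK.
have mk := continuous_measurable_itvoo ck.
apply: integrable_patch => //.
have FI n : F n `<=` I by rewrite -bigcupF; exact: bigcup_sup.
have cvgF := @ge0_nondecreasing_set_cvg_integral _ MR R F (EFin \o k) mu ndF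
  (fun n => measurable_itv _)
  (fun n => measurable_funS (measurable_itv _) (FI n) (proj2 (measurable_EFinP _ _ ) mk)).
have kF n t : F n t -> (0 <= (EFin \o k) t)%E.
  by move=> /FI; rewrite /= in_itv/= lee_fin; exact: k0.
have {}cvgF := cvgF kF; rewrite bigcupF in cvgF.
apply: (@le_lt_trans _ _ K%:E); last exact: ltry.
rewrite -(cvg_lim _ cvgF)//; apply: lime_le; first by apply/cvg_ex; eexists; exact: cvgF.
pose z := Num.min r0 (T - s0).
have z0 : 0 < z by rewrite lt_min r00 subr_gt0.
near=> n.
have nz : T / n.+3%:R < z.
  rewrite ltr_pdivrMr ?ltr0n// mulrC -ltr_pdivrMr//.
  apply: (lt_le_trans (truncnS_gt _)); rewrite ler_nat !ltnS.
  by apply: (@leq_trans n); [near: n; exact: nbhs_infty_ge|rewrite -addn2 leq_addr].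
have h : 0 < T / n.+3%:R by rewrite divr_gt0// ltr0n.
have h3 : T / n.+3%:R <= T / 3 by rewrite ler_pM2l// lef_pV2 ?posrE ?ltr0n// ler_nat.
have zs : z <= T - s0 by rewrite ge_min lexx orbT.
rewrite /F; set w := T / n.+3%:R in nz h h3 *.
have inT t : `[w, T - w]%classic t -> 0 < t < T.
  rewrite /= in_itv/= => /andP[h1 h2].
  by rewrite (lt_le_trans h h1)/= (le_lt_trans h2)// gtrBl.
have ik : mu.-integrable (`[w, T - w]%classic : set MR) (EFin \o k).
  apply: continuous_compact_integrable; first exact: segment_compact.
  by apply: continuous_in_subspaceT => t; rewrite inE => /inT; exact: ck.
rewrite -[leLHS]fineK; last by apply: integrable_fin_num => //; exact: measurable_itv.
rewrite lee_fin; apply: hK => //.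
- by rewrite (lt_le_trans nz)// ge_min lexx.
- by move: nz zs; lra.
- by rewrite gtrBl.
- by move: h3 T0; lra.
Unshelve. all: by end_near. Qed.

Lemma continuous_integrable_itv (k : R -> R) (r s : R) : 0 < r -> s < T ->
  (forall t, 0 < t < T -> {for t, continuous k}) ->
  mu.-integrable `[r, s] (EFin \o k).
Proof.
move=> r0 sT ck; apply: continuous_compact_integrable; first exact: segment_compact.
apply: continuous_in_subspaceT => t; rewrite inE/= in_itv/= => /andP[rt ts].
by apply: ck; rewrite (lt_le_trans r0)//= (le_lt_trans ts).
Qed.

(** By continuity a violation at [t] persists on an interval ending at [t], which
    has positive measure. *)
Lemma ae_continuous_le (y : R -> R) (K : R) :
  (forall t, 0 < t < T -> {for t, continuous y}) ->
  {ae mrestr mu (measurable_itv `]0, T[), forall t, 0 < t < T -> y t <= K} ->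
  forall t, 0 < t < T -> y t <= K.
Proof.
move=> cy [N [mN N0 hN]] t tT; rewrite leNgt; apply/negP => yK.
have /andP[t0 tT'] := tT.
have : \forall s \near t, K < y s by apply: (cvgr_gt (y t) (cy t tT)).
move/nbhs_ballP => [e /= e0 he].
pose z := Num.min e (Num.min t (T - t)).
have z0 : 0 < z by rewrite !lt_min e0 t0 subr_gt0.
have ze : z <= e by rewrite ge_min lexx.
have zt : z <= t by rewrite !ge_min lexx !orbT.
have zT : z <= T - t by rewrite !ge_min lexx !orbT.
pose A : set MR := `]t - z, t[%classic.
have AN : A `<=` N `&` I.
  move=> s; rewrite /A/= in_itv/= => /andP[s1 s2].
  have sT : 0 < s < T by apply/andP; split; lra.
  split; last by rewrite /= in_itv.
  apply: hN => /= /(_ sT); rewrite leNgt => /negP; apply; apply: he.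
  by rewrite /ball/= ger0_norm; lra.
have : (mu A <= 0)%E.
  rewrite -N0; apply: le_measure => //; rewrite inE; first exact: measurable_itv.
  by apply: measurableI => //; exact: measurable_itv.
rewrite /A lebesgue_measure_itv/= lte_fin ifT; last by lra.
by rewrite -EFinB lee_fin; lra.
Qed.

End OpenInterval.

Section IntegralMonotone.
Context {d} {X : measurableType d} {R : realType} (mu : {measure set X -> \bar R}).

(** The integral of a nonnegative function is the supremum of the integrals of the
    simple functions below it, and this is monotone for arbitrary functions. The
    mixed norm is such an integral of a function of time that is under control
    only on [(0, T)]. *)
Lemma ge0_le_integral_nonmeasurable (f g : X -> \bar R) :
  (forall x, (0 <= f x)%E) -> (forall x, (f x <= g x)%E) ->
  (\int[mu]_x f x <= \int[mu]_x g x)%E.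
Proof.
move=> f0 fg; have g0 x : (0 <= g x)%E by exact: le_trans (fg x).
rewrite !ge0_integralTE//; apply: le_ereal_sup => _ [h hf <-].
by exists h => // x; exact: le_trans (fg x).
Qed.

End IntegralMonotone.

(** * Energy and dissipation of a smooth solution *)

Section ClassN.
Context {R : realType} {d : nat}.
Local Notation E := 'rV[R]_d.
Local Notation mu := (@lebesgue_measure R).
Local Notation MR := (measurableTypeR R).

Definition energy_at (u : R -> E -> E) t : R := energy (comp u ^~ t).
Definition dissipation_at (u : R -> E -> E) t : R := dissipation (fun j i => dcomp u j i t).

Lemma enorm_sqr (u : R -> E -> E) t x : enorm (u t x) ^+ 2 = sqnorm (comp u ^~ t) x.
Proof.
rewrite /enorm sqr_sqrtr; first by apply: eq_bigr => i _.
by apply: sumr_ge0 => i _; exact: sqr_ge0.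
Qed.

Lemma enormE (u : R -> E -> E) t x : enorm (u t x) = Num.sqrt (sqnorm (comp u ^~ t) x).
Proof. by rewrite -enorm_sqr sqrtr_sqr ger0_norm// sqrtr_ge0. Qed.

Variables (T : R) (u f : R -> E -> E).
Hypothesis T0 : 0 < T.
Hypothesis su : smooth_QT T u.

Lemma st_sqnorm : st_continuous T (fun t => sqnorm (comp u ^~ t)).
Proof.
by apply: st_sum => i; apply: st_mul; exact: st_comp.
Qed.

Lemma energy_at_continuous t : 0 < t < T -> {for t, continuous (energy_at u)}.
Proof. by move=> tT; exact: tint_continuous tT st_sqnorm. Qed.

Lemma dissipation_at_continuous t : 0 < t < T -> {for t, continuous (dissipation_at u)}.
Proof.
move=> tT; apply: (tint_continuous (T := T)) => //.
by apply: st_sum => j; apply: st_sum => i; apply: st_mul; exact: st_dcomp.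
Qed.

Lemma st_enorm : st_continuous T (fun t x => enorm (u t x)).
Proof.
have [p c] := st_sqnorm; split.
  by move=> t tT x i; rewrite !enormE p.
move=> t x tT.
rewrite (_ : (fun z : R * E => enorm (u z.1 z.2)) =
    (fun z => Num.sqrt (sqnorm (comp u ^~ z.1) z.2))).
  apply: (@cvg_comp _ _ _ (fun z : R * E => sqnorm (comp u ^~ z.1) z.2)
    (@Num.sqrt R) (nbhs (t, x)) (nbhs (sqnorm (comp u ^~ t) x))); first exact: c.
  exact: sqrt_continuous.
by apply/funext => z; rewrite enormE.
Qed.

Lemma tc_enorm t : 0 < t < T -> torus_continuous (fun x => enorm (u t x)).
Proof. by move=> tT; exact: st_tc tT st_enorm. Qed.

Lemma energy_at_normL t : 0 < t < T -> energy_at u t = fine (normL 2%:E (u t)) ^+ 2.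
Proof.
move=> tT; rewrite -[RHS]powR_mulrn; last by apply: fine_ge0; exact: Lnorm_ge0.
rewrite -normL_fin; [|by rewrite ler1n|exact: tc_enorm].
apply: eq_Rintegral => x _.
by rewrite powR_mulrn ?sqrtr_ge0// enorm_sqr.
Qed.

Lemma normL_fin_num q t : (1 <= q)%E -> 0 < t < T -> normL q (u t) \is a fin_num.
Proof.
move=> q1 tT; rewrite ge0_fin_numE; last exact: Lnorm_ge0.
have [mg [M hM]] := bm_tc (tc_enorm tT).
case: q q1 => [q| |] //; rewrite ?lee_fin => q1.
  have q0 : 0 < q by exact: lt_le_trans q1.
  rewrite /normL unlock /Lnorm.
  under eq_integral do rewrite /= ger0_norm ?sqrtr_ge0//.
  rewrite bm_int_EFin; last by apply: bm_powR; [exact: ltW|exact: (bm_tc (tc_enorm tT))].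
  by rewrite poweR_EFin ltry.
rewrite /normL unlock /Lnorm; case: ifPn => // _.
apply: (@le_lt_trans _ _ M%:E); last exact: ltry.
by apply/ess_supP; apply: aeW => x /=; rewrite lee_fin.
Qed.

(** An essential bound for a continuous function of time holds at every time. *)
Lemma energy_bounded : (normLL T +oo%E 2%:E u < +oo)%E ->
  exists2 M : R, 0 <= M & forall t, 0 < t < T -> energy_at u t <= M.
Proof.
rewrite /normLL unlock /Lnorm ifT; last first.
  rewrite /= /mrestr setTI lebesgue_measure_itv/= lte_fin T0.
  by rewrite -EFinB lte_fin subr0.
set K := ess_sup _ _ => Ky.
have ae := ess_sup_ge (mrestr mu (measurable_itv `]0, T[))
  (abse \o (fun t => normL 2%:E (u t))).
exists (fine K ^+ 2); first exact: sqr_ge0.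
apply: (ae_continuous_le energy_at_continuous); apply: filterS ae => t /= tK tT.
have fin := normL_fin_num (q := 2%:E) _ tT.
have {}fin : normL 2%:E (u t) \is a fin_num by apply: fin; rewrite lee_fin ler1n.
have N0 : (0 <= normL 2%:E (u t))%E by exact: Lnorm_ge0.
rewrite -/K gee0_abs// in tK.
have Kfin : K \is a fin_num by rewrite ge0_fin_numE// (le_trans N0).
rewrite energy_at_normL// ler_sqr ?nnegrE ?fine_ge0//; last exact: le_trans tK.
by rewrite fine_le.
Qed.

End ClassN.

Section TimeDerivative.
Context {R : realType} {d : nat}.
Local Notation E := 'rV[R]_d.
Local Notation mu := (@lebesgue_measure R).
Variable T : R.

Definition time_C1 (a ta : 'I_d -> R -> E -> R) : Prop :=
  [/\ forall i, st_continuous T (a i), forall i, st_continuous T (ta i) &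
      forall i t x, 0 < t < T -> is_derive t 1 (fun t => a i t x) (ta i t x)].

Lemma time_C1_comp u : smooth_QT T u -> time_C1 (comp u) (tcomp u).
Proof.
move=> su; split; [exact: st_comp|exact: st_tcomp|].
by move=> i t x tT; exact: (is_derive_tcomp su i x tT).
Qed.

Lemma time_C1_sub a ta b tb : time_C1 a ta -> time_C1 b tb ->
  time_C1 (fun i t x => a i t x - b i t x) (fun i t x => ta i t x - tb i t x).
Proof.
move=> [ca cta ae] [cb ctb be]; split.
- by move=> i; exact: st_sub.
- by move=> i; exact: st_sub.
- by move=> i t x tT; exact: (is_deriveB (ae i t x tT) (be i t x tT)).
Qed.

Lemma time_C1_cst (phi : 'I_d -> E -> R) : (forall i, torus_continuous (phi i)) ->
  time_C1 (fun i _ => phi i) (fun _ _ _ => 0).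
Proof.
move=> cphi; split.
- by move=> i; exact: tc_st.
- by move=> i; exact: st_cst.
- by move=> i t x tT; exact: (is_derive_cst (phi i x) t 1).
Qed.

Lemma st_pairing (a b : 'I_d -> R -> E -> R) :
  (forall i, st_continuous T (a i)) -> (forall i, st_continuous T (b i)) ->
  st_continuous T (fun t x => \sum_i a i t x * b i t x).
Proof. by move=> ca cb; apply: st_sum => i; exact: st_mul (ca i) (cb i). Qed.

Lemma pairing_continuous (a b : 'I_d -> R -> E -> R) t :
  (forall i, st_continuous T (a i)) -> (forall i, st_continuous T (b i)) ->
  0 < t < T -> {for t, continuous (fun t => pairing (a ^~ t) (b ^~ t))}.
Proof. by move=> ca cb tT; exact: tint_continuous tT (st_pairing ca cb). Qed.

Lemma energyE (a : 'I_d -> E -> R) : energy a = pairing a a.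
Proof. by apply: eq_tint => x; apply: eq_bigr => i _; rewrite expr2. Qed.

Lemma pairing_FTC a ta b tb r s : time_C1 a ta -> time_C1 b tb ->
  0 < r -> r <= s -> s < T ->
  \int[mu]_(t in `[r, s]) (pairing (ta ^~ t) (b ^~ t) + pairing (a ^~ t) (tb ^~ t)) =
  pairing (a ^~ s) (b ^~ s) - pairing (a ^~ r) (b ^~ r).
Proof.
move=> [ca cta ae] [cb ctb be] r0 rs sT.
pose g t x := \sum_i a i t x * b i t x.
pose g' t x := \sum_i ta i t x * b i t x + \sum_i a i t x * tb i t x.
have cg : st_continuous T g by exact: st_pairing.
have cg' : st_continuous T g' by apply: st_add; exact: st_pairing.
have dg t x : 0 < t < T -> is_derive t 1 (fun t => g t x) (g' t x).
  move=> tT; have H i := is_deriveM (ae i t x tT) (be i t x tT).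
  have := is_derive_sum H.
  rewrite (_ : (fun t => g t x) =
      \sum_(i < d) (fun t => a i t x) * (fun t => b i t x)); last first.
    by apply/funext => t'; rewrite /g fct_sumE.
  congr is_derive; rewrite /g' -big_split/=; apply: eq_bigr => i _.
  by rewrite /GRing.scale/=; ring.
rewrite -(tint_FTC r0 rs sT cg cg' dg).
apply: eq_Rintegral => t; rewrite inE/= in_itv/= => /andP[rt ts].
have tT : 0 < t < T by rewrite (lt_le_trans r0)//= (le_lt_trans ts).
rewrite -tint_add//.
  exact: st_tc tT (st_pairing cta cb).
exact: st_tc tT (st_pairing ca ctb).
Qed.

End TimeDerivative.

Section Estimates.
Context {R : realType} {d : nat}.
Local Notation E := 'rV[R]_d.
Implicit Types (a b c : 'I_d -> E -> R) (da db dc : 'I_d -> 'I_d -> E -> R).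

Lemma young (x y ka : R) : 0 < ka ->
  `|x * y| <= (2 * ka)^-1 * x ^+ 2 + ka / 2 * y ^+ 2.
Proof.
move=> ka0; rewrite normrM -(real_normK (num_real x)) -(real_normK (num_real y)).
set X := `|x|; set Y := `|y|; rewrite -subr_ge0.
rewrite (_ : _ - _ = (2 * ka)^-1 * (X - ka * Y) ^+ 2).
  by rewrite mulr_ge0 ?sqr_ge0// invr_ge0 mulr_ge0// ltW.
by field; rewrite gt_eqF.
Qed.

Lemma convection_bound a da b db c dc ka : 0 < ka ->
  C1_field a da -> C1_field b db -> C1_field c dc ->
  `|convection a db c| <= (2 * ka)^-1 * dissipation db +
     ka / 2 * tint (fun x => sqnorm a x * sqnorm c x).
Proof.
move=> ka0 [ca _ _] [_ cdb _] [cc _ _].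
have ct j i : torus_continuous (fun x => a j x * db j i x * c i x).
  exact: (tc_mul (tc_mul (ca j) (cdb j i)) (cc i)).
have cD : torus_continuous (fun x => \sum_j sqnorm (db j) x).
  by apply: tc_sum => j; exact: (tc_sqnorm (cdb j)).
have cQ := tc_mul (tc_sqnorm ca) (tc_sqnorm cc).
have cS : torus_continuous (fun x => \sum_j \sum_i a j x * db j i x * c i x).
  by apply: tc_sum => j; apply: tc_sum => i; exact: ct.
apply: (le_trans (tint_norm cS)).
rewrite /dissipation -tint_scale// -tint_scale// -tint_add//; last 2 first.
- exact: (tc_mul (tc_cst _) cD).
- exact: (tc_mul (tc_cst _) cQ).
apply: tint_le.
- exact: tc_norm.
- exact: (tc_add (tc_mul (tc_cst _) cD) (tc_mul (tc_cst _) cQ)).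
move=> x; apply: (le_trans (ler_norm_sum _ _ _)).
rewrite mulr_sumr [sqnorm a x * _]mulr_suml mulr_sumr -big_split/=.
apply: ler_sum => j _; apply: (le_trans (ler_norm_sum _ _ _)).
rewrite !mulr_sumr -big_split/=; apply: ler_sum => i _.
by rewrite mulrAC mulrC -exprMn; exact: young.
Qed.

Lemma grad_pairing_bound da db ka : 0 < ka ->
  (forall j i, torus_continuous (da j i)) ->
  (forall j i, torus_continuous (db j i)) ->
  `|grad_pairing da db| <= (2 * ka)^-1 * dissipation da + ka / 2 * dissipation db.
Proof.
move=> ka0 cda cdb.
have cD : torus_continuous (fun x => \sum_j sqnorm (da j) x).
  by apply: tc_sum => j; exact: (tc_sqnorm (cda j)).
have cQ : torus_continuous (fun x => \sum_j sqnorm (db j) x).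
  by apply: tc_sum => j; exact: (tc_sqnorm (cdb j)).
have cS : torus_continuous (fun x => \sum_j \sum_i da j i x * db j i x).
  by apply: tc_sum => j; apply: tc_sum => i; exact: (tc_mul (cda j i) (cdb j i)).
apply: (le_trans (tint_norm cS)).
rewrite /dissipation -tint_scale// -tint_scale// -tint_add//; last 2 first.
- exact: (tc_mul (tc_cst _) cD).
- exact: (tc_mul (tc_cst _) cQ).
apply: tint_le.
- exact: tc_norm.
- exact: (tc_add (tc_mul (tc_cst _) cD) (tc_mul (tc_cst _) cQ)).
move=> x; apply: (le_trans (ler_norm_sum _ _ _)).
rewrite !mulr_sumr -big_split/=.
apply: ler_sum => j _; apply: (le_trans (ler_norm_sum _ _ _)).
rewrite !mulr_sumr -big_split/=; apply: ler_sum => i _.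
exact: young.
Qed.

(** With [c = a - b] and [b] divergence-free, the first term on the right vanishes
    by antisymmetry, and in the second the derivatives can be moved from [a] to
    the difference. *)
Lemma convection_sub a da b db c dc :
  C1_field a da -> C1_field b db -> C1_field c dc ->
  convection a da c - convection b db c =
  convection b (fun j i x => da j i x - db j i x) c +
  convection (fun i x => a i x - b i x) da c.
Proof.
move=> [ca cda _] [cb cdb _] [cc _ _].
have ct (e : 'I_d -> E -> R) (de : 'I_d -> 'I_d -> E -> R) :
    (forall i, torus_continuous (e i)) ->
    (forall j i, torus_continuous (de j i)) ->
    torus_continuous (fun x => \sum_j \sum_i e j x * de j i x * c i x).
  move=> ce cde; apply: tc_sum => j; apply: tc_sum => i.
  exact: (tc_mul (tc_mul (ce j) (cde j i)) (cc i)).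
have cs i := tc_sub (ca i) (cb i).
have cds j i := tc_sub (cda j i) (cdb j i).
rewrite /convection -(tint_sub (ct _ _ ca cda) (ct _ _ cb cdb)).
rewrite -(tint_add (ct _ _ cb cds) (ct _ _ cs cda)).
apply: eq_tint => x; rewrite -sumrB -big_split/=; apply: eq_bigr => j _.
by rewrite -sumrB -big_split/=; apply: eq_bigr => i _; ring.
Qed.

Lemma pairing_subl a b c : (forall i, torus_continuous (a i)) ->
  (forall i, torus_continuous (b i)) -> (forall i, torus_continuous (c i)) ->
  pairing (fun i x => a i x - b i x) c = pairing a c - pairing b c.
Proof.
move=> ca cb cc; rewrite /pairing -tint_sub.
- by apply: eq_tint => x; rewrite -sumrB; apply: eq_bigr => i _; ring.
- by apply: tc_sum => i; exact: (tc_mul (ca i) (cc i)).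
- by apply: tc_sum => i; exact: (tc_mul (cb i) (cc i)).
Qed.

Lemma pairing_subr a b c : (forall i, torus_continuous (a i)) ->
  (forall i, torus_continuous (b i)) -> (forall i, torus_continuous (c i)) ->
  pairing c (fun i x => a i x - b i x) = pairing c a - pairing c b.
Proof.
move=> ca cb cc; rewrite /pairing -tint_sub.
- by apply: eq_tint => x; rewrite -sumrB; apply: eq_bigr => i _; ring.
- by apply: tc_sum => i; exact: (tc_mul (cc i) (ca i)).
- by apply: tc_sum => i; exact: (tc_mul (cc i) (cb i)).
Qed.

Lemma grad_pairing_subl da db dc : (forall j i, torus_continuous (da j i)) ->
  (forall j i, torus_continuous (db j i)) -> (forall j i, torus_continuous (dc j i)) ->
  grad_pairing (fun j i x => da j i x - db j i x) dc =
  grad_pairing da dc - grad_pairing db dc.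
Proof.
move=> ca cb cc; rewrite /grad_pairing -tint_sub.
- apply: eq_tint => x; rewrite -sumrB; apply: eq_bigr => j _.
  by rewrite -sumrB; apply: eq_bigr => i _; ring.
- by apply: tc_sum => j; apply: tc_sum => i; exact: (tc_mul (ca j i) (cc j i)).
- by apply: tc_sum => j; apply: tc_sum => i; exact: (tc_mul (cb j i) (cc j i)).
Qed.

Lemma grad_pairing_self da : grad_pairing da da = dissipation da.
Proof.
apply: eq_tint => x; apply: eq_bigr => j _; apply: eq_bigr => i _.
by rewrite expr2.
Qed.

End Estimates.

Section EnergyConsequences.
Context {R : realType} {d : nat}.
Local Notation E := 'rV[R]_d.
Local Notation mu := (@lebesgue_measure R).
Local Notation MR := (measurableTypeR R).
Variables (T : R) (u f : R -> E -> E).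
Hypothesis T0 : 0 < T.
Hypothesis su : smooth_QT T u.
Hypothesis sf : smooth_QT T f.
Hypothesis nse : navier_stokes T u f.

Lemma divergence_free t : 0 < t < T -> forall x, \sum_j dcomp u j j t x = 0.
Proof. by move=> tT x; have [pr /(_ t tT)[_ /(_ x)[_ _]]] := nse. Qed.

Lemma energy_rate t : 0 < t < T ->
  pairing (tcomp u ^~ t) (comp u ^~ t) =
  - dissipation_at u t + pairing (comp f ^~ t) (comp u ^~ t).
Proof.
move=> tT; have Cu := C1_comp su tT.
rewrite (navier_stokes_weak su sf nse tT Cu (divergence_free tT)).
rewrite (convection_self0 Cu Cu (divergence_free tT)) subr0.
by rewrite grad_pairing_self.
Qed.

(** The energy identity on [[r, s]] bounds the dissipation by the energy at time
    [r] and the energy input, whose limit exists as the two ends are approached. *)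
Lemma dissipation_integrable : (normLL T +oo%E 2%:E u < +oo)%E ->
  improper_integrable T (fun t => inner (u t) (f t)) ->
  mu.-integrable setT (EFin \o (dissipation_at u \_ `]0, T[)).
Proof.
move=> ub [_ [l hl]].
have [M M0 hM] := energy_bounded T0 su ub.
move/cvgrPdist_lt : hl => /(_ 1 ltr01)[[A B] /= [A0 BT] hAB].
have [e1 /= e10 he1] := A0; have [e2 /= e20 he2] := BT.
have inner_pairing t : inner (u t) (f t) = pairing (comp f ^~ t) (comp u ^~ t).
  by apply: eq_Rintegral => x _; apply: eq_bigr => i _; rewrite mulrC.
have ccont t : 0 < t < T -> {for t, continuous (dissipation_at u)}.
  exact: dissipation_at_continuous.
have pcont t : 0 < t < T ->
    {for t, continuous (fun t => pairing (comp f ^~ t) (comp u ^~ t))}.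
  by move=> tT; exact: (pairing_continuous (st_comp sf) (st_comp su) tT).
apply: (@integrable_patch_bounded _ T T0 (dissipation_at u) (M / 2 + (`|l| + 1)) e1 (T - e2)) => //.
- by rewrite gtrBl.
- by move=> t _; exact: dissipation_ge0.
move=> r s r0 re es sT rs.
have tu := time_C1_comp su.
have := pairing_FTC tu tu r0 rs sT.
have -> : \int[mu]_(t in `[r, s]) (pairing (tcomp u ^~ t) (comp u ^~ t) +
    pairing (comp u ^~ t) (tcomp u ^~ t)) =
    \int[mu]_(t in `[r, s]) (2 * (pairing (comp f ^~ t) (comp u ^~ t) - dissipation_at u t)).
  apply: eq_Rintegral => t; rewrite inE/= in_itv/= => /andP[rt ts].
  have tT : 0 < t < T by rewrite (lt_le_trans r0)//= (le_lt_trans ts).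
  have <- : pairing (tcomp u ^~ t) (comp u ^~ t) = pairing (comp u ^~ t) (tcomp u ^~ t).
    by apply: eq_tint => x; apply: eq_bigr => i _; rewrite mulrC.
  by rewrite energy_rate//; ring.
have ip := continuous_integrable_itv r0 sT pcont.
have id := continuous_integrable_itv r0 sT ccont.
have mrs : measurable (`[r, s]%classic : set MR) by exact: measurable_itv.
rewrite RintegralZl//; last exact: (integrableB mrs ip id).
rewrite RintegralB// -!energyE.
have := hAB (r, s); rewrite /= => hrs.
have : `|l - \int[mu]_(t in `[r, s]) inner (u t) (f t)| < 1.
  apply: hrs; split => /=.
    by apply: he1 => //=; rewrite /ball/= sub0r normrN ger0_norm// ltW.
  apply: he2 => //=; rewrite /ball/= ger0_norm; first by move: es; lra.
  by rewrite subr_ge0 ltW.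
have -> : \int[mu]_(t in `[r, s]) inner (u t) (f t) =
    \int[mu]_(t in `[r, s]) pairing (comp f ^~ t) (comp u ^~ t).
  by apply: eq_Rintegral => t _; rewrite inner_pairing.
set P := \int[mu]_(t in _) pairing _ _; set D := \int[mu]_(t in _) dissipation_at u t.
move=> hP hE.
have rT : 0 < r < T by rewrite r0 (le_lt_trans rs).
have Mr : energy (comp u ^~ r) <= M by exact: hM.
have s0 : 0 <= energy (comp u ^~ s) by exact: energy_ge0.
have := ler_norm l; move: hP; rewrite ltr_norml => /andP[h1 h2] hl.
by move: h1 h2 hE Mr s0 hl; lra.
Qed.

End EnergyConsequences.

Section LpLq.
Context {R : realType} {d : nat}.
Local Notation E := 'rV[R]_d.
Local Notation mu := (@lebesgue_measure R).
Local Notation MR := (measurableTypeR R).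
Variables (T : R) (u : R -> E -> E).
Hypothesis T0 : 0 < T.
Hypothesis su : smooth_QT T u.
Local Notation I := (`]0, T[%classic : set R).

(** For finite [q] this is the measurability of partial integrals. For infinite [q]
    the norm is a supremum of functions continuous in time, so that its
    superlevel sets are open. *)
Lemma measurable_normL q : (1 <= q)%E ->
  measurable_fun (I : set MR) (fun t => fine (normL q (u t))).
Proof.
case: q => [q| |] //; first rewrite lee_fin => q1.
  have q0 : 0 < q by exact: lt_le_trans q1.
  apply: measurable_fun_itvoo => // r s r0 rs sT.
  have bq : bounded_measurable (fun z : MR * d.-tuple MR =>
      enorm (u (clamp r s z.1) (pt z.2)) `^ q).
    apply: bm_powR; first exact: ltW.
    exact: bm_st_clamp r0 rs sT (st_enorm su).
  have [mI _] := @bm_int1 _ _ _ _ R (@circle_measure R) (@torus_measure R d) _ bq.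
  have mJ : measurable_fun [set: MR] (fun t : MR =>
      (\int[@torus_measure R d]_x enorm (u (clamp r s t) (pt x)) `^ q) `^ q^-1).
    exact: (measurableT_comp (measurable_powR _) mI).
  apply: (eq_measurable_fun (fun t : MR =>
      (\int[@torus_measure R d]_x enorm (u (clamp r s t) (pt x)) `^ q) `^ q^-1)); last first.
    exact: measurable_funTS.
  move=> t; rewrite inE/= in_itv/= => rts; rewrite clamp_id//.
  have tT : 0 < t < T.
    by move/andP : rts => [rt ts]; rewrite (lt_le_trans r0)//= (le_lt_trans ts).
  rewrite (normL_fin q1 (tc_enorm su tT)).
  by rewrite -powRrM mulfV ?gt_eqF// powRr1// fine_ge0// Lnorm_ge0.
move=> _; apply: (measurability _ (RGenOInfty.measurableE R)) => //.
move=> _ [_ [c ->] <-].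
pose A := [set t : R | 0 < t < T /\ exists x, c < enorm (u t x)].
rewrite (_ : _ `&` _ = A).
  apply: open_measurable; rewrite openE => t [tT [x cx]].
  have h1 : \forall s \near t, c < enorm (u s x).
    exact: (cvgr_gt _ (st_time_continuous tT (st_enorm su))).
  have h2 : \forall s \near t, s \in `]0, T[.
    by apply: near_in_itvoo; rewrite in_itv.
  rewrite /interior; near=> s; split.
    by have := near h2 s; rewrite in_itv/=; apply.
  by exists x; near: s.
apply/seteqP; split => t; rewrite /A /= !in_itv/= andbT.
  move=> [tT cN]; split => //; apply: contrapT => hx.
  have hc x : enorm (u t x) <= c by rewrite leNgt; apply/negP => cx; apply: hx; exists x.
  have c0 : 0 <= c by apply: le_trans (hc 0); exact: sqrtr_ge0.
  suff : (normL +oo%E (u t) <= c%:E)%E.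
    move=> h; have := normL_fin_num su (leey _) tT; move: h cN.
    by case: (normL +oo%E (u t)) => //= r; rewrite lee_fin => rc /(le_lt_trans rc); rewrite ltxx.
  rewrite /normL unlock /Lnorm; case: ifPn => _; last by rewrite lee_fin.
  apply/ess_supP; apply: aeW => x /=; rewrite lee_fin ger0_norm ?sqrtr_ge0//.
move=> [tT [x cx]]; split => //.
exact: (lt_le_trans cx (normL_infty (tc_enorm su tT) x)).
Unshelve. all: by end_near. Qed.

Lemma LpLq_integrable (p q : \bar R) : (1 <= p < +oo)%E -> (1 <= q)%E ->
  (normLL T p q u < +oo)%E ->
  mu.-integrable setT (EFin \o ((fun t => fine (normL q (u t)) `^ fine p) \_ I)).
Proof.
case: p => [p| |] /andP[p1 p2] // q1.
have {}p1 : 1 <= p by rewrite -lee_fin.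
have p0 : 0 < p by exact: lt_le_trans p1.
rewrite /normLL unlock /Lnorm => /(lty_poweRy (lt0r_neq0 (_ : 0 < p^-1))).
rewrite invr_gt0 => /(_ p0) fin.
have ma : measurable_fun (I : set MR) (fun t => fine (normL q (u t)) `^ p).
  exact: (measurableT_comp (measurable_powR p) (measurable_normL q1)).
have a0 t : 0 <= fine (normL q (u t)) `^ p by exact: powR_ge0.
apply: integrable_patch => //=.
apply: le_lt_trans fin.
pose g := (fun t => fine (normL q (u t)) `^ p) \_ I.
have mg : measurable_fun setT (EFin \o g).
  by apply/measurable_EFinP; apply/(measurable_restrictT _ _).1.
have g0 t : (0 <= (EFin \o g) t)%E by rewrite lee_fin; exact: patch_ge0.
rewrite [leLHS](_ : _ =
    (\int[mrestr mu (measurable_itv `]0%R, T[)]_t (EFin \o g) t)%E); last first.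
  rewrite ge0_integral_mrestr//; apply: eq_integral => t tI.
  by rewrite /= /g patchE tI.
apply: ge0_le_integral_nonmeasurable => // t.
rewrite /= /g patchE; case: ifPn => [|_]; last exact: poweR_ge0.
rewrite inE/= in_itv/= => tT.
rewrite gee0_abs ?Lnorm_ge0// -poweR_EFin fineK//.
exact: (normL_fin_num su q1 tT).
Qed.

End LpLq.

(** * Square-integrable fields *)

Section SquareIntegrable.
Context {R : realType} {d : nat}.
Local Notation E := 'rV[R]_d.
Local Notation MR := (measurableTypeR R).
Local Notation mu := (@torus_measure R d).

Definition square_integrable (h : E -> E) : Prop :=
  (forall i, measurable_fun [set: d.-tuple MR] (fun x => h (pt x) 0 i)) /\
  (normL 2%:E h < +oo)%E.

Lemma dot_ge0 (a : E) : 0 <= dot a a.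
Proof. by apply: sumr_ge0 => i _; rewrite -expr2 sqr_ge0. Qed.

Lemma measurable_dot (g h : E -> E) :
  (forall i, measurable_fun [set: d.-tuple MR] (fun x => g (pt x) 0 i)) ->
  (forall i, measurable_fun [set: d.-tuple MR] (fun x => h (pt x) 0 i)) ->
  measurable_fun [set: d.-tuple MR] (fun x => dot (g (pt x)) (h (pt x)) : R).
Proof.
move=> mg mh; rewrite /dot; elim: (index_enum _) => [|i s IH].
  by under eq_fun do rewrite big_nil; exact: measurable_cst.
under eq_fun do rewrite big_cons.
by apply: measurable_funD => //; exact: measurable_funM.
Qed.

Lemma square_integrableE (h : E -> E) : square_integrable h ->
  mu.-integrable setT (EFin \o (fun x => dot (h (pt x)) (h (pt x)))) /\
  \int[mu]_x dot (h (pt x)) (h (pt x)) = fine (normL 2%:E h) ^+ 2.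
Proof.
move=> [mh]; rewrite /normL unlock /Lnorm.
have E x : (`|(enorm (h (pt x)))%:E| `^ 2 = (dot (h (pt x)) (h (pt x)))%:E)%E.
  rewrite /= ger0_norm ?sqrtr_ge0// powR_mulrn ?sqrtr_ge0//.
  by rewrite sqr_sqrtr// dot_ge0.
under eq_integral do rewrite E.
move=> /(lty_poweRy (lt0r_neq0 (_ : 0 < 2^-1))); rewrite invr_gt0 ltr0n => /(_ isT) fin.
split.
  apply/integrableP; split; first by apply/measurable_EFinP; exact: measurable_dot.
  apply: le_lt_trans fin; rewrite le_eqVlt; apply/orP; left; apply/eqP.
  by apply: eq_integral => x _; rewrite /= ger0_norm// dot_ge0.
rewrite fine_poweR -powR_mulrn ?powR_ge0// -powRrM mulVf ?pnatr_eq0//.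
rewrite powRr1//; apply: fine_ge0; apply: integral_ge0 => x _.
by rewrite lee_fin dot_ge0.
Qed.

Lemma dot_young (a b : E) ka : 0 < ka ->
  `|dot a b| <= ka / 2 * dot a a + (2 * ka)^-1 * dot b b.
Proof.
move=> ka0; apply: (le_trans (ler_norm_sum _ _ _)).
rewrite /dot !mulr_sumr -big_split/=; apply: ler_sum => i _.
by rewrite mulrC -!expr2 addrC; exact: young.
Qed.

Lemma integrable_dot (g h : E -> E) : square_integrable g -> square_integrable h ->
  mu.-integrable setT (EFin \o (fun x => dot (g (pt x)) (h (pt x)))).
Proof.
move=> Lg Lh.
have [ig _] := square_integrableE Lg; have [ih _] := square_integrableE Lh.
have := integrableD measurableT ig ih.
apply: le_integrable => //.
  by apply/measurable_EFinP; apply: measurable_dot; [exact: Lg.1|exact: Lh.1].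
move=> x _; rewrite /= lee_fin [leRHS]ger0_norm ?addr_ge0 ?dot_ge0//.
apply: (le_trans (dot_young _ _ (ltr01))).
have := dot_ge0 (g (pt x)); have := dot_ge0 (h (pt x)); lra.
Qed.

Lemma inner_bound (g h : E -> E) ka : 0 < ka -> square_integrable g -> square_integrable h ->
  `|inner g h| <= ka / 2 * fine (normL 2%:E g) ^+ 2 +
                  (2 * ka)^-1 * fine (normL 2%:E h) ^+ 2.
Proof.
move=> ka0 Lg Lh.
have [ig <-] := square_integrableE Lg; have [ih <-] := square_integrableE Lh.
have igh := integrable_dot Lg Lh.
apply: (le_trans (le_normr_Rintegral _ igh)) => //.
rewrite -RintegralZl// -RintegralZl// -RintegralD//; last 2 first.
- exact: (integrableZl measurableT _ ig).
- exact: (integrableZl measurableT _ ih).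
apply: le_Rintegral => //.
- exact: integrable_norm.
- apply: (integrableD measurableT (integrableZl measurableT _ ig)
    (integrableZl measurableT _ ih)).
- by move=> x _; exact: dot_young.
Qed.

Lemma inner_subr (g h k : E -> E) : square_integrable g -> square_integrable h ->
  square_integrable k ->
  inner g (fun x => h x - k x) = inner g h - inner g k.
Proof.
move=> Lg Lh Lk; rewrite /inner -RintegralB//; try exact: integrable_dot.
apply: eq_Rintegral => x _; rewrite /dot -sumrB; apply: eq_bigr => i _.
by rewrite !mxE mulrBr.
Qed.

Lemma square_integrable_smooth (T : R) (u : R -> E -> E) t :
  smooth_QT T u -> 0 < t < T -> square_integrable (u t).
Proof.
move=> su tT; split.
  by move=> i; have [] := bm_tc (st_tc tT (st_comp su i)).
have q1 : (1 <= 2%:E :> \bar R)%E by rewrite lee_fin ler1n.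
have := normL_fin_num su q1 tT.
by rewrite ge0_fin_numE//; exact: Lnorm_ge0.
Qed.

Lemma L2_field_smooth (T : R) (u : R -> E -> E) t :
  smooth_QT T u -> 0 < t < T -> L2_field (u t).
Proof.
move=> su tT; have [h1 h2] := square_integrable_smooth su tT.
by split => //; exact: su.1.
Qed.

End SquareIntegrable.

(** * Uniqueness *)

Lemma half_lt (R : realFieldType) (x : R) : 0 < x -> x / 2 < x.
Proof. by move=> x0; rewrite ltr_pdivrMr// ltr_pMr// ltr1n. Qed.

Section Uniqueness.
Context {R : realType}.
Variable m : nat.
Let d := m.+3.
Local Notation E := 'rV[R]_d.
Local Notation mu := (@lebesgue_measure R).
Local Notation MR := (measurableTypeR R).

Variables (T : R) (p q : \bar R) (u v f : R -> E -> E) (u0 : E -> E).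
Hypotheses (T0 : 0 < T) (hu : class_N T u f) (hv : class_N T v f)
  (hu0 : weakL2_cvg 0^'+ u u0) (hv0 : weakL2_cvg 0^'+ v u0)
  (hp : (1 <= p < +oo)%E) (hq : (1 <= q)%E)
  (hpq : (2%:E / p + d%:R%:E / q = 1)%E)
  (huLpq : (normLL T p q u < +oo)%E) (hvc : L2_continuous_at0 v u0).
Local Notation I := (`]0, T[%classic : set R).

Let su : smooth_QT T u. Proof. by have [[]] := hu. Qed.
Let sv : smooth_QT T v. Proof. by have [[]] := hv. Qed.
Let sf : smooth_QT T f. Proof. by have [] := hu. Qed.
Let nsu : navier_stokes T u f. Proof. by have [] := hu. Qed.
Let nsv : navier_stokes T v f. Proof. by have [] := hv. Qed.

Let W i t x := comp u i t x - comp v i t x.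
Let dW j i t x := dcomp u j i t x - dcomp v j i t x.
Let tW i t x := tcomp u i t x - tcomp v i t x.
Let Y t := energy (W ^~ t).
Let a t := fine (normL q (u t)) `^ fine p.

Let a_ge0 t : 0 <= a t. Proof. exact: powR_ge0. Qed.

Let CW t : 0 < t < T -> C1_field (W ^~ t) (fun j i => dW j i t).
Proof. by move=> tT; exact: (C1_sub (C1_comp su tT) (C1_comp sv tT)). Qed.

Let timeW : time_C1 T W tW.
Proof. exact: (time_C1_sub (time_C1_comp su) (time_C1_comp sv)). Qed.

Let divW t : 0 < t < T -> forall x, \sum_j dW j j t x = 0.
Proof.
move=> tT x; rewrite /dW sumrB (divergence_free nsu tT) (divergence_free nsv tT).
by rewrite subr0.
Qed.

Let inT r s t : 0 < r -> s < T -> r <= t <= s -> 0 < t < T.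
Proof. by move=> r0 sT /andP[rt ts]; rewrite (lt_le_trans r0)//= (le_lt_trans ts). Qed.

Let multiplier_bound : exists2 C : R, 0 < C & forall t, 0 < t < T ->
  forall b db, C1_field b db ->
    tint (fun x => sqnorm b x * sqnorm (comp u ^~ t) x) <=
    energy b + dissipation db + C * a t * energy b.
Proof.
have [C C0 hC] := @bilinear_bound R m p q hp hq hpq.
exists C => // t tT b db Cb.
rewrite (eq_tint (h := fun x => sqnorm b x * enorm (u t x) ^+ 2)).
  exact: (hC _ (tc_enorm su tT) _ _ Cb).
by move=> x; rewrite enorm_sqr.
Qed.

(** The two equations have the same force, which cancels. *)
Let difference_rate t phi dphi : 0 < t < T ->
  C1_field phi dphi -> (forall x, \sum_j dphi j j x = 0) ->
  pairing (tW ^~ t) phi =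
  - (grad_pairing (fun j i => dcomp u j i t) dphi -
     grad_pairing (fun j i => dcomp v j i t) dphi)
  - (convection (comp u ^~ t) (fun j i => dcomp u j i t) phi -
     convection (comp v ^~ t) (fun j i => dcomp v j i t) phi).
Proof.
move=> tT Cphi divphi; have [cphi _ _] := Cphi.
have ctu i := st_tc tT (st_tcomp su i); have ctv i := st_tc tT (st_tcomp sv i).
rewrite (pairing_subl ctu ctv cphi).
rewrite (navier_stokes_weak su sf nsu tT Cphi divphi).
rewrite (navier_stokes_weak sv sf nsv tT Cphi divphi).
have sub (g1 g2 x1 x2 y : R) :
  (- g1 - x1 + y) - (- g2 - x2 + y) = - (g1 - g2) - (x1 - x2) by ring.
exact: sub.
Qed.

(** Only the transport of [u] by the difference contributes; after its derivatives
    have been moved to the difference, Young's inequality and the multiplier bound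
    absorb it in the dissipation of the difference. *)
Let energy_inequality : exists2 C : R, 0 < C & forall t, 0 < t < T ->
  pairing (tW ^~ t) (W ^~ t) + pairing (W ^~ t) (tW ^~ t) <= (1 + C * a t) * Y t.
Proof.
have [C C0 hC] := multiplier_bound.
exists C => // t tT.
have <- : pairing (tW ^~ t) (W ^~ t) = pairing (W ^~ t) (tW ^~ t).
  by apply: eq_tint => x; apply: eq_bigr => i _; rewrite mulrC.
have Cu := C1_comp su tT; have Cv := C1_comp sv tT; have Cw := CW tT.
have [cu cdu _] := Cu; have [cv cdv _] := Cv; have [cw cdw _] := Cw.
rewrite (difference_rate tT Cw (divW tT)).
rewrite -(grad_pairing_subl cdu cdv cdw) (convection_sub Cu Cv Cw).
rewrite (convection_self0 Cv Cw (divergence_free nsv tT)).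
rewrite (convection_antisym Cw Cu Cw (divW tT)) add0r opprK.
rewrite grad_pairing_self.
have := convection_bound ltr01 Cw Cw Cu.
have := hC t tT _ _ Cw.
rewrite /Y -/(W ^~ t).
set Q := tint _; set D := dissipation _; set X := convection _ _ _.
rewrite -/(energy (W ^~ t)) => hQ; rewrite ler_norml => /andP[_ hX].
by move: hQ hX; lra.
Qed.

Let Y_ge0 t : 0 <= Y t. Proof. exact: energy_ge0. Qed.

Let Y_continuous t : 0 < t < T -> {for t, continuous Y}.
Proof.
move=> tT; have [cW _ _] := timeW.
have -> : Y = fun t => pairing (W ^~ t) (W ^~ t) by apply/funext => s; exact: energyE.
exact: (pairing_continuous cW cW tT).
Qed.

Let a_integrable : mu.-integrable setT (EFin \o (a \_ I)).
Proof. exact: (LpLq_integrable T0 su hp hq huLpq). Qed.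

Let disu_integrable : mu.-integrable setT (EFin \o (dissipation_at u \_ I)).
Proof. by have [[_ h1] _ _ h2 _] := hu; exact: (dissipation_integrable T0 su sf nsu h1 h2). Qed.

Let disv_integrable : mu.-integrable setT (EFin \o (dissipation_at v \_ I)).
Proof. by have [[_ h1] _ _ h2 _] := hv; exact: (dissipation_integrable T0 sv sf nsv h1 h2). Qed.

Let energies_bounded : exists2 M : R, 0 <= M &
  forall t, 0 < t < T -> energy_at u t <= M /\ energy_at v t <= M.
Proof.
have [[_ h1] _ _ _ _] := hu; have [[_ h2] _ _ _ _] := hv.
have [M1 M10 hM1] := energy_bounded T0 su h1.
have [M2 M20 hM2] := energy_bounded T0 sv h2.
exists (M1 + M2); first exact: addr_ge0.
by move=> t tT; have := hM1 t tT; have := hM2 t tT; split; lra.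
Qed.

(** By Young's inequality each term splits into the dissipation at time [t], which
    is integrable, and a quantity that depends on [t] only through the bounded
    energy and is controlled by the choice of [s]. *)
Let tested_rate : exists2 C : R, 0 < C & forall M h s t : R, 0 < h ->
  0 < s < T -> 0 < t < T -> energy_at u t <= M -> energy_at v t <= M ->
  `|pairing (tW ^~ t) (comp u ^~ s)| <=
    (h^-1 + h / 2) * (dissipation_at u t + dissipation_at v t) +
    h * (M + (dissipation_at u s + C * M * a s)).
Proof.
have [C C0 hC] := multiplier_bound.
exists C => // M h s t h0 sT tT uM vM.
have Cu := C1_comp su tT; have Cv := C1_comp sv tT; have Cs := C1_comp su sT.
have [cu cdu _] := Cu; have [cv cdv _] := Cv; have [cs cds _] := Cs.
rewrite (difference_rate tT Cs (divergence_free nsu sT)).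
have g1 := grad_pairing_bound h0 cdu cds.
have g2 := grad_pairing_bound h0 cdv cds.
have c1 := convection_bound h0 Cu Cu Cs.
have c2 := convection_bound h0 Cv Cv Cs.
have q1 := hC s sT _ _ Cu.
have q2 := hC s sT _ _ Cv.
have CMa (e : R) : e <= M -> C * a s * e <= C * M * a s.
  by move=> eM; rewrite [leRHS]mulrAC ler_wpM2l// mulr_ge0// ltW.
have {}q1 := le_trans q1 (lerD (lerD uM (lexx _)) (CMa _ uM)).
have {}q2 := le_trans q2 (lerD (lerD vM (lexx _)) (CMa _ vM)).
have h20 : 0 <= h / 2 by rewrite divr_ge0// ltW.
have {}q1 := ler_wpM2l h20 q1; have {}q2 := ler_wpM2l h20 q2.
rewrite -/(dissipation_at u t) in g1 c1 q1; rewrite -/(dissipation_at v t) in g2 c2 q2.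
rewrite -/(dissipation_at u s) in g1 g2.
have hE : (2 * h)^-1 = h^-1 / 2 by rewrite invfM mulrC.
rewrite hE in g1 g2 c1 c2.
set G1 := grad_pairing _ _ in g1 *; set G2 := grad_pairing _ _ in g2 *.
set X1 := convection _ _ _ in c1 *; set X2 := convection _ _ _ in c2 *.
set Du := dissipation_at u t in g1 c1 q1 *; set Dv := dissipation_at v t in g2 c2 q2 *.
set Ds := dissipation_at u s in g1 g2 *.
apply: (@le_trans _ _ (`|G1| + `|G2| + (`|X1| + `|X2|))).
  apply: (le_trans (ler_normB _ _)); rewrite normrN; apply: lerD; exact: ler_normB.
apply: (le_trans (lerD (lerD g1 g2) (lerD (le_trans c1 (lerD (lexx _) q1))
  (le_trans c2 (lerD (lexx _) q2))))).
rewrite le_eqVlt; apply/orP; left; apply/eqP.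
by field; rewrite gt_eqF.
Qed.

Let pairing_W (s r : R) : 0 < s < T -> 0 < r < T ->
  pairing (W ^~ r) (comp u ^~ s) = inner (u r) (u s) - inner (v r) (u s).
Proof.
move=> sT rT; rewrite /W pairing_subl//.
- by move=> i; exact: (st_tc rT (st_comp su i)).
- by move=> i; exact: (st_tc rT (st_comp sv i)).
- by move=> i; exact: (st_tc sT (st_comp su i)).
Qed.

(** Both solutions converge weakly to the same initial datum. *)
Let pairing_W_cvg0 s : 0 < s < T ->
  forall eps : R, 0 < eps ->
    \forall r \near 0^'+, `|pairing (W ^~ r) (comp u ^~ s)| < eps.
Proof.
move=> sT eps eps0; have Ls := L2_field_smooth su sT.
have H0 : (fun r => inner (u r) (u s) - inner (v r) (u s)) @ 0^'+ --> (0 : R).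
  rewrite -[X in _ --> X](subrr (inner u0 (u s))).
  exact: (cvgB (hu0.2 _ Ls) (hv0.2 _ Ls)).
have H := (cvgr0Pnorm_lt _).1 H0 eps eps0.
near=> r.
have rT : 0 < r < T by apply/andP; split; near: r; [exact: nbhs_right_gt|exact: nbhs_right_lt].
by rewrite pairing_W//; near: r; exact: H.
Unshelve. all: by end_near. Qed.

(** In <u - v, v> = <u - v, v - u0> + <u - v, u0> the first term is small by the
    strong convergence of [v] and the boundedness of the energies, the second by
    weak convergence. *)
Let pairing_Wv_cvg0 : forall eps : R, 0 < eps ->
    \forall s \near 0^'+, `|pairing (W ^~ s) (comp v ^~ s)| < eps.
Proof.
move=> eps eps0; have [M M0 hM] := energies_bounded.
have Lu0 := hu0.1.
have e2 : 0 < eps / 2 by rewrite divr_gt0.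
have H0 : (fun r => inner (u r) u0 - inner (v r) u0) @ 0^'+ --> (0 : R).
  rewrite -[X in _ --> X](subrr (inner u0 u0)).
  exact: (cvgB (hu0.2 _ Lu0) (hv0.2 _ Lu0)).
have H := (cvgr0Pnorm_lt _).1 H0 _ e2.
pose ka := eps / (4 * (M + 1)).
have M1 : 0 < M + 1 by rewrite ltr_wpDl.
have ka0 : 0 < ka by rewrite divr_gt0// mulr_gt0.
pose e := Num.min 1 (ka * eps / 4).
have e0 : 0 < e by rewrite lt_min ltr01/= divr_gt0// mulr_gt0.
have small : \forall s \near 0^'+, (normL 2%:E (fun x => (v s x - u0 x)%R) < e%:E)%E.
  have nb : nbhs (0 : \bar R)%E [set y : \bar R | (y < e%:E)%E].
    apply: open_nbhs_nbhs; split; last by rewrite /= lte_fin.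
    exact: open_ereal_lt_ereal.
  by move: hvc; rewrite /L2_continuous_at0 => /(_ _ nb).
near=> s.
have sT : 0 < s < T by apply/andP; split; near: s; [exact: nbhs_right_gt|exact: nbhs_right_lt].
have hs : `|inner (u s) u0 - inner (v s) u0| < eps / 2 by near: s; exact: H.
have Ns : (normL 2%:E (fun x => (v s x - u0 x)%R) < e%:E)%E by near: s; exact: small.
have Lu := square_integrable_smooth su sT; have Lv := square_integrable_smooth sv sT.
have L0 : square_integrable u0 by split; have [] := Lu0.
pose z x := v s x - u0 x.
have Lz : square_integrable z.
  split; last exact: (lt_trans Ns (ltry _)).
  move=> i; rewrite (_ : (fun x => _) = (fun x => v s (pt x) 0 i - u0 (pt x) 0 i)).
    by apply: measurable_funB; [exact: Lv.1|exact: L0.1].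
  by apply/funext => x; rewrite !mxE.
have -> : pairing (W ^~ s) (comp v ^~ s) =
    (inner (u s) z - inner (v s) z) + (inner (u s) u0 - inner (v s) u0).
  rewrite !inner_subr// /W pairing_subl//.
  - by rewrite -[pairing _ _]/(inner (u s) (v s)) -[X in _ - X]/(inner (v s) (v s)); ring.
  - by move=> i; exact: (st_tc sT (st_comp su i)).
  - by move=> i; exact: (st_tc sT (st_comp sv i)).
  - by move=> i; exact: (st_tc sT (st_comp sv i)).
have [uM vM] := hM s sT.
rewrite (energy_at_normL su sT) in uM; rewrite (energy_at_normL sv sT) in vM.
have b1 := inner_bound ka0 Lu Lz; have b2 := inner_bound ka0 Lv Lz.
set N := fine (normL 2%:E z) in b1 b2.
have N0 : 0 <= N by apply: fine_ge0; exact: Lnorm_ge0.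
have Ne : N < e.
  rewrite -lte_fin /N fineK// ge0_fin_numE; first exact: Lz.2.
  exact: Lnorm_ge0.
have N2 : ka^-1 * N ^+ 2 <= eps / 4.
  rewrite mulrC ler_pdivrMr//.
  apply: (@le_trans _ _ e); last first.
    by rewrite /e ge_min orbC [eps / 4 * ka]mulrC mulrA lexx.
  rewrite expr2 (le_trans _ (ltW Ne))// ler_piMr// (le_trans (ltW Ne))//.
  by rewrite /e ge_min lexx.
have kM : ka * M <= eps / 4.
  rewrite /ka mulrAC ler_pdivrMr ?mulr_gt0//.
  rewrite (_ : eps / 4 * _ = eps * (M + 1)); last by field.
  by rewrite ler_wpM2l ?lerDl// ltW.
have hE : (2 * ka)^-1 = ka^-1 / 2 by rewrite invfM mulrC.
rewrite hE in b1 b2.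
have k20 : 0 <= ka / 2 by rewrite divr_ge0// ltW.
have {}uM := ler_wpM2l k20 uM; have {}vM := ler_wpM2l k20 vM.
apply: (le_lt_trans (ler_normD _ _)).
have := ler_normB (inner (u s) z) (inner (v s) z).
move: b1 b2 uM vM N2 kM hs.
set x1 := _ ^+ 2; set x2 := _ ^+ 2; set x3 := N ^+ 2.
lra.
Unshelve. all: by end_near. Qed.

(** The energy of the difference is <u - v, u> - <u - v, v> at time [s]. For the
    first term the equation of the difference is tested against the fixed field
    [u s] on [[r, s]], where [r] is so small that the value at [r] is small by weak
    convergence. Over this interval the rate integrates to a small quantity plus
    [h * (s - r)] times an expression in [dissipation_at u s] and [a s]. These two
    need not be bounded as [s] tends to zero, but their products with [s] are
    bounded for suitable arbitrarily small [s], and [h] is at disposal. *)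
Let difference_small (eps eta : R) : 0 < eps -> 0 < eta ->
  exists2 s, 0 < s < eta & Y s <= eps.
Proof.
move=> eps0 eta0.
have [M M0 hM] := energies_bounded; have [C C0 hC] := tested_rate.
pose k t := (dissipation_at u \_ I) t + ((dissipation_at v \_ I) t + (a \_ I) t).
have ku0 := @patch_ge0 _ T (dissipation_at u) (fun t _ => dissipation_ge0 _).
have kv0 := @patch_ge0 _ T (dissipation_at v) (fun t _ => dissipation_ge0 _).
have ka0 := @patch_ge0 _ T a (fun t _ => a_ge0 t).
have kE t : 0 < t < T -> k t = dissipation_at u t + (dissipation_at v t + a t).
  move=> tT; have tI : t \in I by rewrite inE/= in_itv.
  by rewrite /k /patch tI.
have k0 t : 0 <= k t := addr_ge0 (ku0 t) (addr_ge0 (kv0 t) (ka0 t)).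
have ik : mu.-integrable setT (EFin \o k).
  exact: (integrableD measurableT disu_integrable
    (integrableD measurableT disv_integrable a_integrable)).
(* [B] bounds [s * (M + (dissipation_at u s + C * M * a s))] for the chosen [s] *)
pose B := M + 1 + C * M.
have B0 : 0 < B by rewrite /B addrAC ltr_wpDl// addr_ge0// mulr_ge0// ltW.
pose h := eps / 4 / B.
have h0 : 0 < h by rewrite !divr_gt0.
(* coefficient of the dissipation in the rate, compensated by a short interval *)
pose A := h^-1 + h / 2.
have A0 : 0 < A by rewrite addr_gt0// ?invr_gt0// divr_gt0.
have eA0 : 0 < eps / 4 / A by rewrite !divr_gt0.
have [de de0 hde] := small_integral ik k0 eA0.
have e40 : 0 < eps / 4 by rewrite divr_gt0.
have [e1 /= e10 he1] := pairing_Wv_cvg0 e40.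
pose z := Num.min eta (Num.min T (Num.min 1 (Num.min de e1))).
have z0 : 0 < z by rewrite !lt_min eta0 T0 ltr01 de0 e10.
have [s /andP[s0 sz] sk] := small_times ik k0 z0.
have [seta sT' s1 sde se1] : [/\ s < eta, s < T, s < 1, s < de & s < e1].
  by move: sz; rewrite !lt_min => /and5P[].
exists s; first by rewrite s0.
have sT : 0 < s < T by rewrite s0.
have Cs := C1_comp su sT; have [cs cds _] := Cs.
have hWv : `|pairing (W ^~ s) (comp v ^~ s)| < eps / 4.
  by apply: he1 => //=; rewrite sub0r normrN gtr0_norm.
have hWu : `|pairing (W ^~ s) (comp u ^~ s)| <= eps / 4 + eps / 4 + eps / 4.
  have [e2 /= e20 he2] := pairing_W_cvg0 sT e40.
  pose r := Num.min (s / 2) (e2 / 2).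
  have r0 : 0 < r by rewrite lt_min !divr_gt0.
  have rs : r <= s by rewrite (@le_trans _ _ (s / 2))// ?ge_min ?lexx// ltW// half_lt.
  have hr : `|pairing (W ^~ r) (comp u ^~ s)| < eps / 4.
    apply: he2 => //=; rewrite sub0r normrN gtr0_norm//.
    by rewrite (@le_lt_trans _ _ (e2 / 2))// ?ge_min ?lexx ?orbT// half_lt.
  have FTC := pairing_FTC timeW (time_C1_cst T cs) r0 rs sT'.
  have [cW ctW _] := timeW.
  pose c := h * (M + (dissipation_at u s + C * M * a s)).
  have c0 : 0 <= c.
    rewrite mulr_ge0 ?(ltW h0)// addr_ge0// addr_ge0 ?dissipation_ge0//.
    by rewrite !mulr_ge0// ltW.
  have cst t : 0 < t < T -> {for t, continuous (fun t =>
      pairing (tW ^~ t) (comp u ^~ s))}.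
    by move=> tT; exact: (pairing_continuous ctW (fun i => tc_st T (cs i)) tT).
  have it := continuous_integrable_itv r0 sT' cst.
  have E0 t : pairing (tW ^~ t) (comp u ^~ s) +
      pairing (W ^~ t) (fun=> fun=> 0) = pairing (tW ^~ t) (comp u ^~ s).
    rewrite [X in _ + X](_ : _ = 0) ?addr0// /pairing.
    rewrite (eq_tint (h := fun=> 0)); first by rewrite /tint Rintegral_cst// mul0r.
    by move=> x; rewrite big1// => i _; rewrite mulr0.
  have mrs : measurable (`[r, s]%classic : set MR) by exact: measurable_itv.
  have irs : mu.-integrable (`[r, s]%classic : set MR) (EFin \o k).
    exact: integrableS ik.
  have muE : fine (mu (`[r, s]%classic : set MR)) = s - r.
    rewrite lebesgue_measure_itv/= lte_fin; case: ltP => // sr.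
    by rewrite (_ : s = r) ?subrr//; apply/eqP; rewrite eq_le sr rs.
  have mufin : (mu (`[r, s]%classic : set MR) < +oo)%E.
    by rewrite lebesgue_measure_itv/=; case: ifP => _; rewrite ltry.
  have ic : mu.-integrable (`[r, s]%classic : set MR) (EFin \o (fun=> c)).
    apply: measurable_bounded_integrable => //; exact: bounded_cst.
  have iAk := integrableZl mrs A irs.
  have hk : \int[mu]_(t in `[r, s]) k t < eps / 4 / A.
    apply: hde => //; rewrite -[X in (X < _)%E]fineK ?muE ?lte_fin//.
      by rewrite (lt_trans _ sde)// gtrBl.
    by rewrite ge0_fin_numE.
  have : `|pairing (W ^~ s) (comp u ^~ s) - pairing (W ^~ r) (comp u ^~ s)| <=
      A * \int[mu]_(t in `[r, s]) k t + c * (s - r).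
    rewrite -FTC; under eq_Rintegral do rewrite E0.
    apply: (le_trans (le_normr_Rintegral mrs it)).
    rewrite -muE -Rintegral_cst// -RintegralZl// -RintegralD//.
    apply: le_Rintegral => //.
    - exact: integrable_norm.
    - exact: (integrableD mrs iAk ic).
    - move=> t; rewrite /= in_itv/= => rts; have tT := inT r0 sT' rts.
      have [uM vM] := hM t tT.
      apply: (le_trans (hC M h s t h0 sT tT uM vM)); rewrite lerD2r.
      apply: ler_wpM2l; first exact: ltW.
      by rewrite (kE _ tT) addrA lerDl.
  have Ak : A * \int[mu]_(t in `[r, s]) k t <= eps / 4.
    by rewrite mulrC -ler_pdivlMr// ltW.
  have csr : c * (s - r) <= eps / 4.
    apply: (@le_trans _ _ (c * s)).
      by apply: ler_wpM2l => //; rewrite gerBl ltW.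
    rewrite (_ : eps / 4 = h * B); last by rewrite /h divfK// gt_eqF.
    rewrite /c -mulrA; apply: ler_wpM2l; first exact: ltW.
    have ks : s * (dissipation_at u s + a s) <= 1.
      apply: le_trans sk; apply: ler_wpM2l; first exact: ltW.
      by rewrite (kE _ sT) lerD2l lerDr dissipation_ge0.
    have du0 : 0 <= s * dissipation_at u s by rewrite mulr_ge0 ?(ltW s0)// dissipation_ge0.
    have as0 : 0 <= s * a s by rewrite mulr_ge0 ?(ltW s0).
    have h1 : s * dissipation_at u s <= 1 by apply: le_trans ks; rewrite mulrDr lerDl.
    have h2 : s * a s <= 1 by apply: le_trans ks; rewrite mulrDr lerDr.
    have h3 : M * s <= M by rewrite ler_piMr// ltW.
    have h4 : C * M * (s * a s) <= C * M.
      by rewrite ler_piMr// mulr_ge0// ltW.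
    rewrite (_ : _ * s = M * s + (s * dissipation_at u s + C * M * (s * a s))); last by ring.
    by rewrite /B -[leRHS]addrA; exact: (lerD h3 (lerD h1 h4)).
  move=> hD; have := ler_normD (pairing (W ^~ s) (comp u ^~ s) -
    pairing (W ^~ r) (comp u ^~ s)) (pairing (W ^~ r) (comp u ^~ s)).
  rewrite subrK => hs; apply: (le_trans hs).
  exact: (lerD (le_trans hD (lerD Ak csr)) (ltW hr)).
have -> : Y s = pairing (W ^~ s) (comp u ^~ s) - pairing (W ^~ s) (comp v ^~ s).
  have cv i : torus_continuous (comp v i s) by exact: (st_tc sT (st_comp sv i)).
  have [cw _ _] := CW sT.
  by rewrite /Y energyE {2}/W pairing_subr.
move: hWu hWv; rewrite ler_norml ltr_norml => /andP[_ h1] /andP[h2 _].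
by move: h1 h2; lra.
Qed.

(** Gronwall's argument; strong continuity of the difference at time zero is
    replaced by smallness along a sequence of times. *)
Lemma difference_energy0 t : 0 < t < T -> Y t = 0.
Proof.
have [C C0 hC] := energy_inequality.
pose b := (fun t => 1 + C * a t) \_ I.
have b0 : forall t, 0 <= b t.
  by apply: patch_ge0 => s _; rewrite addr_ge0// mulr_ge0// ltW.
have i1 : mu.-integrable setT (EFin \o ((fun=> (1 : R)) \_ I)).
  have muI : (mu (I : set MR) < +oo)%E.
    by rewrite lebesgue_measure_itv/=; case: ifP => _; rewrite ltry.
  by apply: integrable_patch => //; rewrite integral_cst// mul1e.
have ib : mu.-integrable setT (EFin \o b).
  have := integrableD measurableT i1 (integrableZl measurableT C a_integrable).
  congr (integrable _ _ _); apply/funext => s /=.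
  by rewrite /b !patchE; case: ifP => _; rewrite -?EFinM -EFinD// mulr0 addr0.
apply: (@gronwall_zero R T Y b ib b0 (fun t _ => Y_ge0 t) Y_continuous
  _ difference_small).
move=> r s M r0 rs sT hM.
have [cW ctW _] := timeW.
rewrite -lerBlDl /Y 2!energyE -(pairing_FTC timeW timeW r0 rs sT).
have mrs : measurable (`[r, s]%classic : set MR) by exact: measurable_itv.
have irs : mu.-integrable (`[r, s]%classic : set MR) (EFin \o b).
  exact: integrableS ib.
rewrite -RintegralZl//; apply: le_Rintegral => //.
- apply: (continuous_integrable_itv r0 sT) => t' tT.
  exact: (cvgD (pairing_continuous ctW cW tT) (pairing_continuous cW ctW tT)).
- exact: (integrableZl mrs M irs).
- move=> t' /=; rewrite in_itv/= => rts; have tT := inT r0 sT rts.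
  apply: (le_trans (hC t' tT)).
  have tI : t' \in I by rewrite inE/= in_itv.
  rewrite /b patchE tI mulrC; apply: ler_wpM2r; last exact: hM.
  by rewrite addr_ge0// mulr_ge0// ltW.
Qed.

Lemma uniqueness t : 0 < t < T -> u t = v t.
Proof.
move=> tT; apply/funext => x; apply/rowP => i.
have [cw _ _] := CW tT.
have := tint_eq0 (tc_sqnorm cw) (sqnorm_ge0 _) (difference_energy0 tT) x.
move=> /eqP; rewrite psumr_eq0; last by move=> j _; exact: sqr_ge0.
move=> /allP/(_ i); rewrite mem_index_enum sqrf_eq0 subr_eq0 => /(_ isT)/eqP.
by [].
Qed.

End Uniqueness.

Theorem theorem1p3 (R : realType) (d : nat) (T : R) (p q : \bar R)
    (u v f : R -> 'rV[R]_d -> 'rV[R]_d) (u0 : 'rV[R]_d -> 'rV[R]_d)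
    (hd : (3 <= d)%N) (hT : 0 < T)
    (hu : class_N T u f) (hv : class_N T v f)
    (hu0 : weakL2_cvg 0^'+ u u0) (hv0 : weakL2_cvg 0^'+ v u0)
    (hp : (1 <= p < +oo)%E) (hq : (1 <= q)%E)
    (hpq : (2%:E / p + d%:R%:E / q = 1)%E)
    (huLpq : (normLL T p q u < +oo)%E)
    (hvc : L2_continuous_at0 v u0) :
  forall t : R, 0 < t < T -> u t = v t.
Proof.
case: d => [|[|[|m]]] // in u v f u0 hd hu hv hu0 hv0 hpq huLpq hvc *.
move=> t tT.
exact: (uniqueness hT hu hv hu0 hv0 hp hq hpq huLpq hvc tT).
Qed.
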